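(* Let $D=\{(x_1,y_1),\dots,(x_N,y_N)\}$ be an $n\times m$ signal, i.e. $N:=nm$. Let $k\ge 1$ be an integer and $\varepsilon\in(0,1/4)$ be an error parameter. Let $(C,u)$ be the output of a call to $\textsc{Signal-Coreset}(D,k,\varepsilon/\Delta)$ (the algorithm defined in the context) for a sufficiently large constant $\Delta\ge 1$. Then $(C,u)$ is a $(k,\varepsilon)$-coreset for $D$ of size $$|C|\in \frac{(k\log N)^{O(1)}}{\varepsilon^4}.$$ Moreover, $(C,u)$ can be computed in $O(kN)$ time.
   Context: **Signals.** Write $[n]=\{1,\dots,n\}$. An $n\times m$ signal is a set $D=\{(x,g(x))\mid x\in[n]\times[m]\}$ for a function $g:[n]\times[m]\to\mathbb{R}$ (a real $n\times m$ matrix). A sub-signal of $D$ is a subset $\{(x,g(x))\mid x\in\{i_1,\dots,i_2\}\times\{j_1,\dots,j_2\}\}$ with $1\le i_1\le i_2\le n$, $1\le j_1\le j_2\le m$. In $((i,j),y)\in D$, $i$ is the row index and $j$ the column index. The transpose of a sub-signal $B$ is $B^T=\{((j,i),y)\mid((i,j),y)\in B\}$. **Segmentations and loss.** For an integer $k\ge1$, a function $s:\mathbb{R}^2\to\mathbb{R}$ is a $k$-segmentation if there is a partition of $\mathbb{R}^2$ into $k$ pairwise disjoint axis-parallel rectangles (possibly unbounded) such that $s$ is constant on each of them. Segmentations are evaluated only on $[n]\times[m]$, and a function on $[n]\times[m]$ is called a $k$-segmentation if it is the restriction of one; for real $r\ge1$, an $r$-segmentation means a $\lfloor r\rfloor$-segmentation.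 For a signal or sub-signal $B$, $\ell(B,s):=\sum_{(x,y)\in B}(s(x)-y)^2$, and $\mathrm{opt}_k(B)$ is the minimum of $\ell(B,s)$ over all $k$-segmentations $s$. For $\alpha,\beta>1$, an $(\alpha,\beta)_k$-approximation of $D$ is a $\beta k$-segmentation $s:[n]\times[m]\to\mathbb{R}$ with $\ell(D,s)\le\alpha\,\mathrm{opt}_k(D)$. **Coreset.** A $(k,\varepsilon)$-coreset for $D$ is a pair $(C,u)$, where $C\subseteq([n]\times[m])\times\mathbb{R}$ is an ordered set and $u:C\to[0,\infty)$ is a weight function, such that $(C,u)$ suffices to approximate $\ell(D,s)$ up to a multiplicative factor of $1\pm\varepsilon$, in time that depends only on $|C|$ and $k$, for any $k$-segmentation $s$. That is, there is a procedure (not depending on $D$) that receives only $(C,u)$ and $s$ and returns within that time a number $\mathrm{loss}$ with $|\ell(D,s)-\mathrm{loss}|\le\varepsilon\,\ell(D,s)$. **Algorithm $\textsc{SlicePartition}(E,\tau)$** (input: a sub-signal $E$, its columns re-indexed $1,\dots,q$, and a threshold $\tau$). Start with $\mathcal{B}:=\emptyset$, $c:=1$. While $c\le q$: let $B$ be the $c$-th column of $E$. If $\mathrm{opt}_1(B)>\tau$, call $\textsc{SlicePartition}(B^T,\tau)$, add to $\mathcal{B}$ the transposes of all returned sub-signals, and set $c:=c+1$. Otherwise, starting with $e:=c$, increase $e$ by one as long as $e<q$ and the sub-signal of $E$ formed by columns $c,\dots,e+1$ has $\mathrm{opt}_1\le\tau$; add the sub-signal formed by columns $c,\dots,e$ to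 $\mathcal{B}$ and set $c:=e+1$. Return $\mathcal{B}$. **Algorithm $\textsc{Partition}(D,\gamma,\sigma)$.** Start with $\mathcal{B}:=\emptyset$, $r:=1$. While $r\le n$: starting with $e:=r$, let $\mathcal{B}':=\textsc{SlicePartition}(R,\gamma^2\sigma)$, where $R$ is row $r$ of $D$. If $|\mathcal{B}'|>1/\gamma$, keep $e=r$. Otherwise, increase $e$ by one as long as $e<n$ and $\textsc{SlicePartition}$ with threshold $\gamma^2\sigma$ applied to rows $r,\dots,e+1$ of $D$ returns at most $1/\gamma$ sub-signals. Add to $\mathcal{B}$ all sub-signals returned by $\textsc{SlicePartition}$ with threshold $\gamma^2\sigma$ on rows $r,\dots,e$, and set $r:=e+1$. Return $\mathcal{B}$. **Algorithm $\textsc{Signal-Coreset}(D,k,\varepsilon)$.** 1. Let $s$ be an $(\alpha,\beta)_k$-approximation of $D$ with $\alpha\in O(k\log(nm))$ and $\beta\in k^{O(1)}\log^2(nm)$, obtained by an algorithm that computes such an $s$ in $O(knm)$ time. 2. Set $\gamma:=\varepsilon^2/(\beta k)$, $\sigma:=\ell(D,s)/\alpha$, $C:=\emptyset$. 3. $\mathcal{B}:=\textsc{Partition}(D,\gamma,\sigma)$. 4. For every $B\in\mathcal{B}$: compute (by Caratheodory's theorem, in $O(|B|)$ time) $C_B\subseteq B$ with $|C_B|=4$ and $u_B:C_B\to[0,\infty)$ such that $\sum_{(a,b)\in C_B}u_B((a,b))\cdot(b,b^2,1)=\sum_{(x,y)\in B}(y,y^2,1)$; replace the coordinates $a$ of the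 4 pairs $(a,b)\in C_B$ by the 4 corner coordinates of $B$ (keeping labels $b$ and weights); set $C:=C\cup C_B$ and $u((a,b)):=u_B((a,b))$ for every $(a,b)\in C_B$. 5. Return $(C,u)$. The ordered set $C$ is understood as a list: entries may repeat and weights are attached to positions. **Conventions.** Running times count unit-cost arithmetic operations and comparisons on real numbers. Constants hidden in $O(\cdot)$, including in the exponent, are absolute; asymptotic bounds are understood for sufficiently large $N$. *)

(* Defs.v *)
(* MathComp / MathComp-Analysis; R is an arbitrary realType. *)
From HB Require Import structures.
From mathcomp Require Import all_boot all_order all_algebra.
From mathcomp Require Import all_classical all_reals all_analysis.

Set Implicit Arguments.
Unset Strict Implicit.
Unset Printing Implicit Defensive.

Import Order.TTheory GRing.Theory Num.Theory.

Local Open Scope classical_set_scope.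
Local Open Scope ring_scope.

(* An n x m signal is a matrix D : 'M[R]_(n, m). Indices are 0-based: the
   matrix position (i, j) is the point (i + 1, j + 1) of [n] x [m]. *)

(* (i1, i2, (j1, j2)) is {i1, ..., i2} x {j1, ..., j2}, ends included, empty
   when i2 < i1 or j2 < j1. The sub-signals of D are named by their nonempty
   rectangles inside the matrix. *)
Definition rect : Type := ((nat * nat) * (nat * nat))%type.

Definition in_rect (B : rect) (i j : nat) : bool :=
  ((B.1.1 <= i <= B.1.2) && (B.2.1 <= j <= B.2.2))%N.

Definition full_rect (n m : nat) : rect := ((0, n.-1), (0, m.-1))%N.

(* The rectangle of B^T, a sub-signal of D^T when B is one of D. *)
Definition tr_rect (B : rect) : rect := (B.2, B.1).

(** * Segmentations and loss *)

Definition box (R : realType) (Q : interval R * interval R) : set (R * R) :=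
  [set` Q.1] `*` [set` Q.2].

Definition plane_segmentation (R : realType) (k : nat) (f : R * R -> R) : Prop :=
  exists P : 'I_k -> interval R * interval R,
    [/\ forall l, box (P l) !=set0,
        trivIset setT (fun l => box (P l)),
        \bigcup_l box (P l) = setT &
        forall l x y, box (P l) x -> box (P l) y -> f x = f y].

Definition segmentation (R : realType) (n m k : nat) (s : 'M[R]_(n, m)) : Prop :=
  exists2 f : R * R -> R, plane_segmentation k f &
    forall (i : 'I_n) (j : 'I_m), s i j = f (i.+1%:R, j.+1%:R).

Definition loss (R : realType) (n m : nat) (D : 'M[R]_(n, m)) (B : rect)
    (s : 'M[R]_(n, m)) : R :=
  \sum_(i < n) \sum_(j < m | in_rect B i j) (s i j - D i j) ^+ 2.

(* The infimum is attained: only finitely many partitions of [n] x [m] are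
   traces of partitions of the plane. *)
Definition opt (R : realType) (n m : nat) (D : 'M[R]_(n, m)) (k : nat)
    (B : rect) : R :=
  inf [set loss D B s | s in [set s | segmentation k s]].

Definition approximation (R : realType) (n m : nat) (alpha beta : R) (k : nat)
    (D s : 'M[R]_(n, m)) : Prop :=
  [/\ 1 < alpha, 1 < beta, segmentation (Num.truncn (beta * k%:R)) s &
      loss D (full_rect n m) s <= alpha * opt D k (full_rect n m)].

(** * Real RAM programs
   Structured programs over a read-only input and a working memory, each made
   of integer cells and real cells. Cells are addressed by integer expressions,
   so the fixed registers of a real RAM are the cells with constant addresses.
   Real numbers can be combined by field operations and compared, but not
   rounded to integers; division by zero gives 0. Programs contain only integer constants, so one program
   is run on signals of all sizes. *)

Inductive iexp : Type :=
  | IConst of nat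
  | IInput of iexp
  | ILoad of iexp
  | IAdd of iexp & iexp
  | ISub of iexp & iexp
  | IMul of iexp & iexp.

Inductive rexp : Type :=
  | RInput of iexp
  | RLoad of iexp
  | ROfInt of iexp
  | RAdd of rexp & rexp
  | RSub of rexp & rexp
  | RMul of rexp & rexp
  | RDiv of rexp & rexp.

Inductive bexp : Type :=
  | BLeI of iexp & iexp
  | BLeR of rexp & rexp
  | BNot of bexp
  | BAnd of bexp & bexp.

Inductive cmd : Type :=
  | Skip
  | IStore of iexp & iexp
  | RStore of iexp & rexp
  | Seq of cmd & cmd
  | If of bexp & cmd & cmd
  | While of bexp & cmd.

Record memory (R : realType) : Type :=
  Memory { icell : nat -> nat; rcell : nat -> R }.

Definition empty_memory (R : realType) : memory R :=
  Memory (fun=> 0%N) (fun=> 0).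

Definition update (T : Type) (f : nat -> T) (a : nat) (v : T) : nat -> T :=
  fun x => if x == a then v else f x.

Section Evaluation.
Context (R : realType) (inp st : memory R).

Fixpoint ieval (e : iexp) : nat :=
  match e with
  | IConst c => c
  | IInput e1 => icell inp (ieval e1)
  | ILoad e1 => icell st (ieval e1)
  | IAdd e1 e2 => (ieval e1 + ieval e2)%N
  | ISub e1 e2 => (ieval e1 - ieval e2)%N
  | IMul e1 e2 => (ieval e1 * ieval e2)%N
  end.

Fixpoint reval (e : rexp) : R :=
  match e with
  | RInput e1 => rcell inp (ieval e1)
  | RLoad e1 => rcell st (ieval e1)
  | ROfInt e1 => (ieval e1)%:R
  | RAdd e1 e2 => reval e1 + reval e2
  | RSub e1 e2 => reval e1 - reval e2
  | RMul e1 e2 => reval e1 * reval e2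
  | RDiv e1 e2 => reval e1 / reval e2
  end.

Fixpoint beval (b : bexp) : bool :=
  match b with
  | BLeI e1 e2 => (ieval e1 <= ieval e2)%N
  | BLeR e1 e2 => reval e1 <= reval e2
  | BNot b1 => ~~ beval b1
  | BAnd b1 b2 => beval b1 && beval b2
  end.

End Evaluation.

(* Every node of an expression and every executed command costs one unit. *)
Fixpoint icost (e : iexp) : nat :=
  match e with
  | IConst _ => 1
  | IInput e1 | ILoad e1 => (icost e1).+1
  | IAdd e1 e2 | ISub e1 e2 | IMul e1 e2 => (icost e1 + icost e2).+1
  end.

Fixpoint rcost (e : rexp) : nat :=
  match e with
  | RInput e1 | RLoad e1 | ROfInt e1 => (icost e1).+1
  | RAdd e1 e2 | RSub e1 e2 | RMul e1 e2 | RDiv e1 e2 =>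
      (rcost e1 + rcost e2).+1
  end.

Fixpoint bcost (b : bexp) : nat :=
  match b with
  | BLeI e1 e2 => (icost e1 + icost e2).+1
  | BLeR e1 e2 => (rcost e1 + rcost e2).+1
  | BNot b1 => (bcost b1).+1
  | BAnd b1 b2 => (bcost b1 + bcost b2).+1
  end.

(* [exec inp p st st' t]: on input inp and started in st, the program p halts
   in st' after t steps. *)
Inductive exec (R : realType) (inp : memory R) :
    cmd -> memory R -> memory R -> nat -> Prop :=
  | exec_Skip st : exec inp Skip st st 1
  | exec_IStore a e st :
      exec inp (IStore a e) st
        (Memory (update (icell st) (ieval inp st a) (ieval inp st e)) (rcell st))
        (icost a + icost e).+1
  | exec_RStore a e st :
      exec inp (RStore a e) st
        (Memory (icell st) (update (rcell st) (ieval inp st a) (reval inp st e)))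
        (icost a + rcost e).+1
  | exec_Seq p q st st1 st2 t1 t2 :
      exec inp p st st1 t1 -> exec inp q st1 st2 t2 ->
      exec inp (Seq p q) st st2 (t1 + t2).+1
  | exec_IfTrue b p q st st1 t :
      beval inp st b -> exec inp p st st1 t ->
      exec inp (If b p q) st st1 (bcost b + t).+1
  | exec_IfFalse b p q st st1 t :
      ~~ beval inp st b -> exec inp q st st1 t ->
      exec inp (If b p q) st st1 (bcost b + t).+1
  | exec_WhileTrue b p st st1 st2 t1 t2 :
      beval inp st b -> exec inp p st st1 t1 -> exec inp (While b p) st1 st2 t2 ->
      exec inp (While b p) st st2 (bcost b + t1 + t2).+1
  | exec_WhileFalse b p st :
      ~~ beval inp st b -> exec inp (While b p) st st (bcost b).+1.

Definition runs (R : realType) (p : cmd) (inp out : memory R) (t : nat) : Prop :=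
  exec inp p (empty_memory R) out t.

Definition holds (T : Type) (x0 : T) (f : nat -> T) (a : nat) (xs : seq T) : Prop :=
  forall l, (l < size xs)%N -> f (a + l)%N = nth x0 xs l.

(* Input cells beyond the described ones have unspecified contents. *)
Definition signal_input (R : realType) (n m : nat) (inp : memory R)
    (D : 'M[R]_(n, m)) (k : nat) : Prop :=
  holds 0%N (icell inp) 0 [:: n; m; k] /\
  forall (i : 'I_n) (j : 'I_m), rcell inp (i * m + j)%N = D i j.

(** * Slice partition and partition *)

(* [e] is the value reached from [lo] by increasing by one as long as e < hi and
   [ok (e + 1)]. *)
Definition grows_to (ok : nat -> Prop) (lo hi e : nat) : Prop :=
  [/\ (lo <= e <= hi)%N,
      forall e', (lo <= e' < e)%N -> ok e'.+1 &
      (e < hi)%N -> ~ ok e.+1].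

Definition cols (E : rect) (c e : nat) : rect := (E.1, (c, e)).

(* [slice_loop D tau E c Bs]: started at column c of E, the while loop adds the
   sub-signals Bs. The columns of E keep their indices in D instead of being
   renumbered from 1. *)
Inductive slice_loop (R : realType) : forall n m : nat,
    'M[R]_(n, m) -> R -> rect -> nat -> seq rect -> Prop :=
  | slice_done n m (D : 'M[R]_(n, m)) tau E c :
      (E.2.2 < c)%N -> slice_loop D tau E c [::]
  | slice_column n m (D : 'M[R]_(n, m)) tau E c Bs Bs' :
      (c <= E.2.2)%N -> tau < opt D 1 (cols E c c) ->
      slice_loop D^T tau (tr_rect (cols E c c)) (tr_rect (cols E c c)).2.1 Bs ->
      slice_loop D tau E c.+1 Bs' ->
      slice_loop D tau E c ([seq tr_rect B | B <- Bs] ++ Bs')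
  | slice_merge n m (D : 'M[R]_(n, m)) tau E c e Bs' :
      (c <= E.2.2)%N -> opt D 1 (cols E c c) <= tau ->
      grows_to (fun e' => opt D 1 (cols E c e') <= tau) c E.2.2 e ->
      slice_loop D tau E e.+1 Bs' ->
      slice_loop D tau E c (cols E c e :: Bs').

Definition slice_partition (R : realType) (n m : nat) (D : 'M[R]_(n, m))
    (E : rect) (tau : R) (Bs : seq rect) : Prop :=
  slice_loop D tau E E.2.1 Bs.

Definition rows (m r e : nat) : rect := ((r, e), (0, m.-1))%N.

Inductive partition_loop (R : realType) (n m : nat) (D : 'M[R]_(n, m))
    (gamma sigma : R) : nat -> seq rect -> Prop :=
  | partition_done r : (n <= r)%N -> partition_loop D gamma sigma r [::]
  | partition_step r e B' Bs Bs' :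
      (r < n)%N ->
      slice_partition D (rows m r r) (gamma ^+ 2 * sigma) B' ->
      (if gamma^-1 < (size B')%:R then e = r else
       grows_to
         (fun e' => exists2 B'', slice_partition D (rows m r e') (gamma ^+ 2 * sigma) B''
                               & (size B'')%:R <= gamma^-1)
         r n.-1 e) ->
      slice_partition D (rows m r e) (gamma ^+ 2 * sigma) Bs ->
      partition_loop D gamma sigma e.+1 Bs' ->
      partition_loop D gamma sigma r (Bs ++ Bs').

Definition partition (R : realType) (n m : nat) (D : 'M[R]_(n, m))
    (gamma sigma : R) (Bs : seq rect) : Prop :=
  partition_loop D gamma sigma 0 Bs.

(** * The coreset construction *)

(* A position of the list C with its weight: ((coordinate, label), weight). *)
Definition wpoint (R : realType) : Type := ((nat * nat) * R * R)%type.

Definition corners (B : rect) : 4.-tuple (nat * nat) :=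
  [tuple (B.1.1, B.2.1); (B.1.1, B.2.2); (B.1.2, B.2.1); (B.1.2, B.2.2)].

(* x lists C_B (repetitions allowed) and u its weights. As the order of C_B is
   arbitrary, so is the assignment of the corners to its elements. *)
Definition block_coreset (R : realType) (n m : nat) (D : 'M[R]_(n, m)) (B : rect)
    (CB : seq (wpoint R)) : Prop :=
  exists (x : 'I_4 -> 'I_n * 'I_m) (u : 'I_4 -> R),
    [/\ forall t, in_rect B (x t).1 (x t).2,
        forall t, 0 <= u t,
        [/\ \sum_(t < 4) u t * D (x t).1 (x t).2 =
              \sum_(i < n) \sum_(j < m | in_rect B i j) D i j,
            \sum_(t < 4) u t * D (x t).1 (x t).2 ^+ 2 =
              \sum_(i < n) \sum_(j < m | in_rect B i j) D i j ^+ 2 &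
            \sum_(t < 4) u t =
              \sum_(i < n) \sum_(j < m | in_rect B i j) 1] &
        CB = [seq (tnth (corners B) t, D (x t).1 (x t).2, u t) | t <- enum 'I_4]].

(* The program A leaves alpha and beta in real cells 0 and 1, followed by s in
   row-major order. *)
Definition approx_output (R : realType) (A : cmd) (n m : nat)
    (D : 'M[R]_(n, m)) (k : nat) (inp : memory R) (t : nat) (alpha beta : R)
    (s : 'M[R]_(n, m)) : Prop :=
  exists out : memory R,
    [/\ runs A inp out t, rcell out 0 = alpha, rcell out 1 = beta &
        forall (i : 'I_n) (j : 'I_m), rcell out (2 + (i * m + j))%N = s i j].

(* A computes (alpha, beta)_k-approximations in O(knm) time, with
   alpha in O(k log(nm)) and beta in k^O(1) log^2(nm); ca, (cb, b), ct and N1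
   are the hidden constants. *)
Definition approx_algorithm (R : realType) (A : cmd) (ca cb : R) (b ct N1 : nat)
    : Prop :=
  forall (n m k : nat) (D : 'M[R]_(n, m)) (inp : memory R),
    (0 < n)%N -> (0 < m)%N -> (0 < k)%N -> signal_input inp D k ->
    exists t alpha beta s,
      [/\ approx_output A D k inp t alpha beta s,
          approximation alpha beta k D s &
          (N1 <= n * m)%N ->
          [/\ alpha <= ca * k%:R * ln (n * m)%:R,
              beta <= cb * k%:R ^+ b * ln (n * m)%:R ^+ 2 &
              (t <= ct * (k * (n * m)))%N]].

(* C is a possible output of Signal-Coreset(D, k, eps) with A used in step 1. *)
Definition signal_coreset (R : realType) (A : cmd) (n m : nat)
    (D : 'M[R]_(n, m)) (k : nat) (eps : R) (C : seq (wpoint R)) : Prop :=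
  exists (inp : memory R) (t : nat) (alpha beta : R) (s : 'M[R]_(n, m)),
    [/\ signal_input inp D k, approx_output A D k inp t alpha beta s &
        let gamma := eps ^+ 2 / (beta * k%:R) in
        let sigma := loss D (full_rect n m) s / alpha in
        exists (Bs : seq rect) (CB : rect -> seq (wpoint R)),
          [/\ partition D gamma sigma Bs,
              forall B, B \in Bs -> block_coreset D B (CB B) &
              C = flatten [seq CB B | B <- Bs]]].

(** * Coresets *)

(* A k-segmentation is passed to a program as k pieces with their values: each
   rectangle of the plane meets [n] x [m] in a rect, possibly empty. *)
Definition seg_code (R : realType) (n m k : nat) (s : 'M[R]_(n, m))
    (c : seq (rect * R)) : Prop :=
  size c = k /\
  forall (i : 'I_n) (j : 'I_m),
    count (fun p => in_rect p.1 i j) c = 1%N /\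
    (forall p, p \in c -> in_rect p.1 i j -> s i j = p.2).

Definition points_data (R : realType) (C : seq (wpoint R)) : seq R :=
  flatten [seq [:: p.1.1.1%:R; p.1.1.2%:R; p.1.2; p.2] | p <- C].

Definition code_data (R : realType) (c : seq (rect * R)) : seq R :=
  flatten [seq [:: p.1.1.1%:R; p.1.1.2%:R; p.1.2.1%:R; p.1.2.2%:R; p.2] | p <- c].

(* The procedure L and its time bound T are parameters, so that they can be
   quantified before, hence chosen independently of, the signal. L leaves its
   result in real cell 0. *)
Definition coreset (R : realType) (L : cmd) (T : nat -> nat -> nat) (n m k : nat)
    (eps : R) (D : 'M[R]_(n, m)) (C : seq (wpoint R)) : Prop :=
  (forall p, p \in C -> [/\ (p.1.1.1 < n)%N, (p.1.1.2 < m)%N & 0 <= p.2]) /\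
  forall (s : 'M[R]_(n, m)) (c : seq (rect * R)) (inp : memory R),
    segmentation k s -> seg_code k s c ->
    holds 0%N (icell inp) 0 [:: size C; k] ->
    holds 0 (rcell inp) 0 (points_data C ++ code_data c) ->
    exists (out : memory R) (t : nat),
      [/\ runs L inp out t, (t <= T (size C) k)%N &
          `|loss D (full_rect n m) s - rcell out 0|
            <= eps * loss D (full_rect n m) s].

(* The program P writes C in real cells 0, 1, ... and |C| in integer cell 0; its
   input holds eps right after the entries of D. *)
Definition computes_coreset (R : realType) (P : cmd) (n m : nat)
    (D : 'M[R]_(n, m)) (k : nat) (eps : R) (inp : memory R) (t : nat)
    (C : seq (wpoint R)) : Prop :=
  [/\ signal_input inp D k, rcell inp (n * m)%N = eps &
      exists out : memory R,
        [/\ runs P inp out t, icell out 0 = size C &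
            holds 0 (rcell out) 0 (points_data C)]].

(* Main.v *)
(* Let opt B be the least squared error of a constant on B and tau = gamma^2 sigma, so that
   every block of the partition has opt <= tau. On the blocks where a k-segmentation s is
   constant its loss is determined by the block moments, which the coreset keeps. On the
   other blocks the loss is estimated by opt B plus the squared distance of s from the block
   mean, up to an error controlled by tau and by a small multiple of the loss.
   These other blocks are charged to s itself: a slab on whose columns s is constant
   contains at most k of them; the slabs without this property are at most k in number and
   have at most 1 / gamma blocks each; and a slab which is followed by another one would,
   enlarged by a row, have more than 1 / gamma blocks, so either s changes at its end or s
   has loss of order tau / gamma on the enlarged slab, because a block which is not last in
   its slice cannot be enlarged either. As sigma <= loss s, the total error is at most
   eps * loss s. The same charging with the approximation used by the algorithm in place
   of s bounds the number of all blocks by 6 alpha / gamma^2.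

   For the running time, prefix sums give opt of a rectangle in constant time. While a
   slab grows row by row, the greedy partition of each of its columns is kept up to date
   in constant time, so that testing a slab takes time proportional to the number of
   columns. *)
Require Import Defs.
From HB Require Import structures.
From mathcomp Require Import all_boot all_order all_algebra.
From mathcomp Require Import all_classical all_reals all_analysis.
From mathcomp Require Import zify ring lra.

Set Implicit Arguments.
Unset Strict Implicit.
Unset Printing Implicit Defensive.

Import Order.TTheory GRing.Theory Num.Theory.
Local Open Scope ring_scope.

(** * Sums over rectangles *)

(** The two counts need different accuracy. For the size, a bound by any constant multiple of the
    loss is enough. For the error, each block on which [s] varies costs about [4 / eps] times the
    threshold, so the threshold times their number must be of order [eps^2] times the loss.
    Therefore the charging over slabs is proved once, for an abstract weight [w] with a rate
    [kappa], and used with all blocks at [kappa = 4] and with the nonconstant blocks at [kappa = 0]: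
    a slab without row changes has at most [k] of the latter, whatever its loss. An enlarged block
    or slab overlaps its successor in one column or row. Loss may thus be used twice, and both
    inductions carry a subtracted term that reserves the first column or row for the predecessor.
    The price [theta] of a block is kept apart from the threshold [tau]: if [sigma = 0] the
    threshold vanishes, and blocks can be counted only against a positive price. *)

Definition inside n m (B : rect) : bool :=
  [&& B.1.1 <= B.1.2, B.1.2 < n, B.2.1 <= B.2.2 & B.2.2 < m]%N.

Ltac nlia := intros;
  repeat match goal with
  | H : ?P |- _ => lazymatch P with
      | is_true (leq _ _) => fail
      | is_true (andb _ _) => fail
      | is_true (negb _) => fail
      | is_true (@eq_op _ _ _) => fail
      | is_true (in_rect _ _ _) => fail
      | is_true (inside _ _ _) => fail
      | is_true _ => clear H
      | @eq ?T _ _ =>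
          tryif first [unify T nat | unify T bool] then fail else clear H
      | forall _, _ => clear H
      end
  end; unfold in_rect, inside, cols, tr_rect in *; simpl in *; lia.

Section BlockSums.
Variables (R : realType) (n m : nat).
Implicit Types (f g : 'I_n -> 'I_m -> R) (B : rect).

Definition bsum f B : R := \sum_(i < n) \sum_(j < m | in_rect B i j) f i j.

Lemma bsumE f B : bsum f B = \sum_(i < n) \sum_(j < m) (in_rect B i j)%:R * f i j.
Proof.
apply: eq_bigr => i _; rewrite big_mkcond; apply: eq_bigr => j _.
by case: ifP; rewrite ?mul1r ?mul0r.
Qed.

Lemma eq_bsum f g B : (forall (i : 'I_n) (j : 'I_m), in_rect B i j -> f i j = g i j) -> bsum f B = bsum g B.
Proof. by move=> fg; apply: eq_bigr => i _; apply: eq_bigr => j /fg. Qed.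

(** The indicators are added as naturals, so one equation says both that [B1] and [B2] are disjoint
    and that they fill [B] inside the matrix. *)
Lemma bsum_split f B B1 B2 :
  (forall (i : 'I_n) (j : 'I_m), in_rect B i j = (in_rect B1 i j + in_rect B2 i j)%N :> nat) ->
  bsum f B = bsum f B1 + bsum f B2.
Proof.
move=> BE; rewrite !bsumE -big_split; apply: eq_bigr => i _ /=.
by rewrite -big_split; apply: eq_bigr => j _ /=; rewrite BE natrD mulrDl.
Qed.

Lemma bsum_ge0 f B : (forall i j, 0 <= f i j) -> 0 <= bsum f B.
Proof. by move=> f0; apply: sumr_ge0 => i _; apply: sumr_ge0. Qed.

Lemma ler_bsum f B B' : (forall i j, 0 <= f i j) ->
  (forall (i : 'I_n) (j : 'I_m), in_rect B i j -> in_rect B' i j) -> bsum f B <= bsum f B'.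
Proof.
move=> f0 sBB'; rewrite !bsumE; apply: ler_sum => i _; apply: ler_sum => j _.
apply: ler_wpM2r => //; rewrite ler_nat.
by case: (boolP (in_rect B i j)) => // /sBB' ->.
Qed.

Lemma bsum0 f B : (forall (i : 'I_n) (j : 'I_m), ~~ in_rect B i j) -> bsum f B = 0.
Proof.
move=> B0; apply: big1 => i _; apply: big_pred0 => j; exact: negbTE.
Qed.

Lemma bsumD f g B : bsum (fun i j => f i j + g i j) B = bsum f B + bsum g B.
Proof. by rewrite -big_split; apply: eq_bigr => i _; rewrite -big_split. Qed.

Lemma bsumZ c f B : bsum (fun i j => c * f i j) B = c * bsum f B.
Proof. by rewrite mulr_sumr; apply: eq_bigr => i _; rewrite mulr_sumr. Qed.

(** After exchanging the sums, each cell is weighted by the number of listed rectangles containing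
    it, which is the indicator of [B]. *)
Lemma bsum_cover f (Bs : seq rect) B :
  (forall (i : 'I_n) (j : 'I_m), count (fun B => in_rect B i j) Bs = in_rect B i j) ->
  \sum_(B' <- Bs) bsum f B' = bsum f B.
Proof.
move=> cov; rewrite bsumE.
under eq_bigr do rewrite bsumE.
rewrite exchange_big; apply: eq_bigr => i _; rewrite exchange_big.
apply: eq_bigr => j _; rewrite -mulr_suml -cov; congr (_ * _).
elim: Bs {cov} => [|B' Bs IH]; first by rewrite big_nil.
by rewrite big_cons IH /= natrD.
Qed.

Lemma bsum_full f : bsum f (full_rect n m) = \sum_i \sum_j f i j.
Proof.
apply: eq_bigr => i _; apply: eq_bigl => j; rewrite /in_rect /full_rect /=.
by move: (ltn_ord i) (ltn_ord j); lia.
Qed.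

End BlockSums.

Lemma bsum_tr (R : realType) n m (f : 'I_n -> 'I_m -> R) B :
  bsum (fun j i => f i j) (tr_rect B) = bsum f B.
Proof.
rewrite !bsumE exchange_big; apply: eq_bigr => i _; apply: eq_bigr => j _ /=.
by rewrite /in_rect /tr_rect /= andbC.
Qed.

(** * Least squared error of a constant on a rectangle *)

Definition area (R : realType) n m (B : rect) : R :=
  bsum (fun (_ : 'I_n) (_ : 'I_m) => 1) B.

(** Sum of squared deviations from the mean, written with the three moments because these are what
    prefix sums compute and what the coreset keeps. *)
Definition vari (R : realType) n m (D : 'M[R]_(n, m)) (B : rect) : R :=
  bsum (fun i j => D i j ^+ 2) B
  - bsum (fun i j => D i j) B ^+ 2 / area R n m B.

Lemma inside_tr n m B : inside m n (tr_rect B) = inside n m B.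
Proof. by rewrite /inside /tr_rect /=; lia. Qed.

Section Opt.
Variables (R : realType) (n m : nat).
Implicit Types (D s : 'M[R]_(n, m)) (B : rect).

Lemma lossE D B s : loss D B s = bsum (fun i j => (s i j - D i j) ^+ 2) B.
Proof. by []. Qed.

Lemma loss_ge0 D B s : 0 <= loss D B s.
Proof. by apply: bsum_ge0 => i j; exact: sqr_ge0. Qed.

Lemma area_gt0 B : inside n m B -> 0 < area R n m B.
Proof.
case/and4P=> b1 b2 b3 b4.
have l1 : (B.1.1 < n)%N by lia.
have l2 : (B.2.1 < m)%N by lia.
rewrite /area /bsum (bigD1 (Ordinal l1)) //= (bigD1 (Ordinal l2)) /=; last first.
  by rewrite /in_rect /=; lia.
rewrite -addrA ltr_pwDl //; apply: addr_ge0; first exact: sumr_ge0.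
by apply: sumr_ge0 => i _; exact: sumr_ge0.
Qed.

Lemma area_ge0 B : 0 <= area R n m B.
Proof. by apply: bsum_ge0. Qed.

Lemma loss_affine D B (c : R) :
  bsum (fun i j => (c - D i j) ^+ 2) B =
  bsum (fun i j => D i j ^+ 2) B - 2 * c * bsum (fun i j => D i j) B
  + c ^+ 2 * area R n m B.
Proof.
rewrite /area -mulNr -!bsumZ -!bsumD; apply: eq_bsum => i j _; ring.
Qed.

(** Bias-variance decomposition: completing the square in [c]. *)
Lemma loss_const D B (c : R) : inside n m B ->
  bsum (fun i j => (c - D i j) ^+ 2) B =
  vari D B + area R n m B
     * (c - bsum (fun i j => D i j) B / area R n m B) ^+ 2.
Proof.
move=> /area_gt0 W0; rewrite loss_affine /vari; field; exact: lt0r_neq0.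
Qed.

Lemma vari_le D B (c : R) : inside n m B ->
  vari D B <= bsum (fun i j => (c - D i j) ^+ 2) B.
Proof.
move=> iB; rewrite loss_const // lerDl mulr_ge0 ?sqr_ge0 //; exact: area_ge0.
Qed.

Lemma vari_ge0 D B : inside n m B -> 0 <= vari D B.
Proof.
move=> iB; pose c := bsum (fun i j => D i j) B / area R n m B.
have := loss_const D c iB; rewrite subrr expr0n /= mulr0 addr0 => <-.
by apply: bsum_ge0 => i j; exact: sqr_ge0.
Qed.

Lemma segmentation1 (s : 'M[R]_(n, m)) :
  segmentation 1 s <-> exists c, forall i j, s i j = c.
Proof.
split=> [[f [P [_ _ PT Pc]] sE]|[c sE]].
  exists (f (0, 0)) => i j; rewrite sE.
  have all x : box (P ord0) x.
    have : [set: R * R]%classic x by [].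
    by rewrite -PT => -[l _]; rewrite [l]ord1.
  exact: (Pc ord0).
exists (fun=> c) => //; exists (fun=> (`]-oo, +oo[, `]-oo, +oo[)); split=> //.
- by move=> l; exists (0, 0); split; rewrite /= in_itv.
- by move=> i j _ _ _; rewrite [i]ord1 [j]ord1.
- by apply/seteqP; split=> // x _; exists ord0 => //; split; rewrite /= in_itv.
Qed.

(** The infimum is attained by the constant matrix at the mean, and [vari_le] bounds every other
    constant from below. *)
Lemma opt1E D B : inside n m B -> opt D 1 B = vari D B.
Proof.
move=> iB; apply/eqP; rewrite eq_le /opt; apply/andP; split.
  pose c := bsum (fun i j => D i j) B / area R n m B.
  apply: ge_inf; first by exists 0 => _ [s _ <-]; exact: loss_ge0.
  exists (const_mx c); first by apply/segmentation1; exists c => i j; rewrite mxE.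
  rewrite lossE; under eq_bsum => i j _ do rewrite mxE.
  by rewrite loss_const // subrr expr0n /= mulr0 addr0.
apply: lb_le_inf.
  exists (loss D B (const_mx 0)), (const_mx 0) => //.
  by apply/segmentation1; exists 0 => i j; rewrite mxE.
move=> _ [s /segmentation1 [c sc] <-]; rewrite lossE.
under eq_bsum => i j _ do rewrite sc.
exact: vari_le.
Qed.

Lemma opt_le D k B s : segmentation k s -> opt D k B <= loss D B s.
Proof.
move=> ss; apply: ge_inf; first by exists 0 => _ [s' _ <-]; exact: loss_ge0.
by exists s.
Qed.

Definition constant_on (s : 'M[R]_(n, m)) B : Prop :=
  forall (i i' : 'I_n) (j j' : 'I_m), in_rect B i j -> in_rect B i' j' ->
    s i j = s i' j'.

Lemma constant_onS s B B' : (forall (i : 'I_n) (j : 'I_m), in_rect B i j -> in_rect B' i j) ->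
  constant_on s B' -> constant_on s B.
Proof. by move=> sBB' sc i i' j j' /sBB' ? /sBB' ?; exact: sc. Qed.

Lemma inside_ex B : inside n m B -> exists (i : 'I_n) (j : 'I_m), in_rect B i j.
Proof.
case/and4P=> b1 b2 b3 b4.
have l1 : (B.1.1 < n)%N by lia.
have l2 : (B.2.1 < m)%N by lia.
by exists (Ordinal l1), (Ordinal l2); rewrite /in_rect /=; lia.
Qed.

(** Source of every charge to the loss: a rectangle exceeding the threshold on which [s] is constant
    carries at least that much loss of [s]. *)
Lemma opt_le_constant D s B : inside n m B -> constant_on s B -> opt D 1 B <= loss D B s.
Proof.
move=> iB sc; rewrite opt1E // lossE; have [i0 [j0 B0]] := inside_ex iB.
under eq_bsum => i j hij do rewrite (sc i i0 j j0 hij B0).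
exact: vari_le.
Qed.

(** This stops the recursion of the slicing: a transposed column has a single row, whose cells never
    exceed a nonnegative threshold. *)
Lemma opt_cell D i j : (i < n)%N -> (j < m)%N -> opt D 1 ((i, i), (j, j)) = 0.
Proof.
move=> ilt jlt; have iB : inside n m ((i, i), (j, j)) by rewrite /inside /=; lia.
have cE (i' : 'I_n) (j' : 'I_m) : in_rect ((i, i), (j, j)) i' j' ->
    i' = Ordinal ilt /\ j' = Ordinal jlt.
  by rewrite /in_rect /= => ?; split; apply: val_inj => /=; lia.
apply/eqP; rewrite eq_le opt1E // vari_ge0 // andbT.
apply: (le_trans (vari_le D (D (Ordinal ilt) (Ordinal jlt)) iB)).
rewrite le_eqVlt; apply/orP; left; apply/eqP.
apply: big1 => i' _; apply: big1 => j' /cE[-> ->].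
by rewrite subrr expr0n.
Qed.

Lemma opt_cell_row D E c : inside n m E -> E.1.1 = E.1.2 -> (E.2.1 <= c <= E.2.2)%N ->
  opt D 1 (cols E c c) = 0.
Proof.
case: E => [[r r'] [c1 c2]] iE /= rE hc; rewrite /cols /= -rE; apply: opt_cell; nlia.
Qed.

Lemma loss_rect D s B B1 B2 :
  (forall (i : 'I_n) (j : 'I_m), in_rect B i j = (in_rect B1 i j + in_rect B2 i j)%N :> nat) ->
  loss D B s = loss D B1 s + loss D B2 s.
Proof. by move=> BE; rewrite !lossE (bsum_split _ BE). Qed.

Lemma le_loss D s B B' : (forall (i : 'I_n) (j : 'I_m), in_rect B i j -> in_rect B' i j) ->
  loss D B s <= loss D B' s.
Proof. by move=> sB; apply: ler_bsum => // i j; exact: sqr_ge0. Qed.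

End Opt.

Lemma vari_tr (R : realType) n m (D : 'M[R]_(n, m)) B :
  vari D^T (tr_rect B) = vari D B.
Proof.
by rewrite /vari /area -!(bsum_tr _ B); congr (_ - _ ^+ 2 / _);
  apply: eq_bsum => i j _; rewrite ?mxE.
Qed.

Lemma opt_tr (R : realType) n m (D : 'M[R]_(n, m)) B : inside n m B ->
  opt D^T 1 (tr_rect B) = opt D 1 B.
Proof. by move=> iB; rewrite !opt1E ?inside_tr // vari_tr. Qed.

Lemma loss_tr (R : realType) n m (D s : 'M[R]_(n, m)) B :
  loss D^T (tr_rect B) s^T = loss D B s.
Proof.
by rewrite !lossE -(bsum_tr _ B); apply: eq_bsum => i j _; rewrite !mxE.
Qed.

Lemma constant_on_tr (R : realType) n m (s : 'M[R]_(n, m)) B :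
  constant_on s B -> constant_on s^T (tr_rect B).
Proof.
move=> sc j j' i i'; rewrite /in_rect /= => /andP[Bj Bi] /andP[Bj' Bi']; rewrite !mxE.
by apply: sc; rewrite /in_rect ?Bi ?Bi' ?Bj ?Bj'.
Qed.

(** * Counting the blocks of a slice *)

Lemma grows_to_ex (ok : nat -> Prop) lo hi : (lo <= hi)%N -> exists e, grows_to ok lo hi e.
Proof.
move=> lohi; have [k kE] : exists k, (hi - lo = k)%N by exists (hi - lo)%N.
elim: k lo lohi kE => [|k IH] lo lohi kE.
  by exists lo; split; [lia|move=> e'; lia|lia].
have [okS|nokS] := pselect (ok lo.+1); last first.
  by exists lo; split => //; [lia|move=> e'; lia].
have [||e [e1 e2 e3]] := IH lo.+1; try lia.
exists e; split=> //; first by lia.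
move=> e' /andP[]; rewrite leq_eqVlt => /orP[/eqP<- //|lt1] lt2.
by apply: e2; rewrite lt1.
Qed.

Lemma grows_to_uniq (ok : nat -> Prop) lo hi e e' :
  grows_to ok lo hi e -> grows_to ok lo hi e' -> e = e'.
Proof.
move=> [a1 a2 a3] [b1 b2 b3]; case: (ltngtP e e') => // ltee.
  by case: a3; [lia|apply: b2; lia].
by case: b3; [lia|apply: a2; lia].
Qed.

Lemma tr_rectK : involutive tr_rect.
Proof. by case=> [[? ?] [? ?]]. Qed.

Lemma in_rect_tr B i j : in_rect (tr_rect B) i j = in_rect B j i.
Proof. by rewrite /in_rect /= andbC. Qed.

Lemma inside_cols n m E c e : inside n m E -> (E.2.1 <= c <= e)%N -> (e <= E.2.2)%N ->
  inside n m (cols E c e).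
Proof. by rewrite /inside /cols /=; lia. Qed.

(** The recursion transposes, so the dimensions are indices of [slice_loop]; stating the inversion
    once avoids equalities of dependent pairs in later case analyses. *)
Lemma slice_inv (R : realType) n m (D : 'M[R]_(n, m)) tau E c Bs :
  slice_loop D tau E c Bs ->
  [\/ (E.2.2 < c)%N /\ Bs = [::],
      exists Bs1 Bs2, [/\ (c <= E.2.2)%N, tau < opt D 1 (cols E c c),
        slice_loop D^T tau (tr_rect (cols E c c)) (tr_rect (cols E c c)).2.1 Bs1,
        slice_loop D tau E c.+1 Bs2 & Bs = [seq tr_rect B | B <- Bs1] ++ Bs2] |
      exists e Bs2, [/\ (c <= E.2.2)%N, opt D 1 (cols E c c) <= tau,
        grows_to (fun e' => opt D 1 (cols E c e') <= tau) c E.2.2 e,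
        slice_loop D tau E e.+1 Bs2 & Bs = cols E c e :: Bs2]].
Proof.
case=> {}n {}m {}D {}tau {}E {}c.
- by move=> ?; constructor 1.
- by move=> Bs1 Bs2 *; constructor 2; exists Bs1, Bs2.
- by move=> e Bs2 *; constructor 3; exists e, Bs2.
Qed.

(** Identifies the partitions that the tests of [partition_loop] assert to exist with the partition
    at hand. *)
Lemma slice_det (R : realType) n m (D : 'M[R]_(n, m)) tau E c Bs Bs' :
  slice_loop D tau E c Bs -> slice_loop D tau E c Bs' -> Bs = Bs'.
Proof.
move=> H; elim: H Bs' => {n m D tau E c Bs}.
- move=> n m D tau E c Ec Bs' /slice_inv[[]//|[? [? []]]|[? [? []]]]; lia.
- move=> n m D tau E c Bs1 Bs2 Ec tauo _ IH1 _ IH2 Bs' /slice_inv[[]|[B1 [B2 [_ _ h1 h2 ->]]]|[? [? [_ ]]]].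
  + lia.
  + by rewrite (IH1 _ h1) (IH2 _ h2).
  + by rewrite leNgt tauo.
- move=> n m D tau E c e Bs2 Ec tauo g _ IH Bs' /slice_inv[[]|[B1 [B2 [_]]]|[e' [B2 [_ _ g' h ->]]]].
  + lia.
  + by rewrite ltNge tauo.
  + by have ee' := grows_to_uniq g g'; rewrite -ee' in h *; rewrite (IH _ h).
Qed.

Lemma slice_cover (R : realType) n m (D : 'M[R]_(n, m)) tau E c Bs :
  slice_loop D tau E c Bs -> inside n m E -> (E.2.1 <= c)%N ->
  (forall i j, count (fun B => in_rect B i j) Bs = in_rect (cols E c E.2.2) i j) /\
  (forall B, B \in Bs -> inside n m B /\ opt D 1 B <= tau).
Proof.
elim=> {n m D tau E c Bs}.
- move=> n m D tau E c Ec iE cE; split=> // i j /=; rewrite /in_rect /=; lia.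
- move=> n m D tau E c Bs1 Bs2 Ec tauo _ IH1 _ IH2 iE cE.
  have iE' : inside m n (tr_rect (cols E c c)).
    by rewrite inside_tr; apply: inside_cols => //; lia.
  have [//|cov1 ok1] := IH1 iE' _.
  have [|cov2 ok2] := IH2 iE _; first lia.
  split=> [i j|B].
    rewrite count_cat count_map cov2.
    under eq_count => B do rewrite /= in_rect_tr.
    by rewrite cov1 /in_rect /=; lia.
  rewrite mem_cat => /orP[/mapP[B' /ok1[iB' oB'] ->]|/ok2//].
  have iB : inside n m (tr_rect B') by rewrite inside_tr.
  by split=> //; rewrite -(opt_tr D iB) tr_rectK.
- move=> n m D tau E c e Bs2 Ec tauo [g1 g2 g3] _ IH iE cE.
  have [|cov ok] := IH iE _; first lia.
  split=> [i j|B] /=; first by rewrite cov /in_rect /=; lia.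
  rewrite inE => /orP[/eqP->|/ok//]; split.
    by apply: inside_cols => //; lia.
  (* For [e > c] the block was accepted by the growth test made at [e - 1]. *)
  have [->//|ne] := eqVneq e c; rewrite -(prednK (_ : 0 < e)%N); last by lia.
  by apply: g2; lia.
Qed.

Lemma slice_cover_in (R : realType) n m (D : 'M[R]_(n, m)) tau E c Bs B :
  slice_loop D tau E c Bs -> inside n m E -> (E.2.1 <= c)%N -> B \in Bs ->
  forall i j, in_rect B i j -> in_rect (cols E c E.2.2) i j.
Proof.
move=> sl iE cE BBs i j hB; have [cov _] := slice_cover sl iE cE.
move: (cov i j); case: in_rect => //= /eqP; rewrite -leqn0 leqNgt -has_count.
by case/hasP; exists B.
Qed.

(** In a single row only the merging rule applies, so induction on the remaining columns suffices.
    This is the recursive call needed for [slice_ex]. *)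
Lemma slice_row_ex (R : realType) n m (D : 'M[R]_(n, m)) tau E c :
  0 <= tau -> inside n m E -> (E.2.1 <= c)%N -> E.1.1 = E.1.2 ->
  exists Bs, slice_loop D tau E c Bs.
Proof.
move=> tau0 iE cE rE; have [k] := ubnP (E.2.2.+1 - c)%N.
elim: k c cE => // k IH c cE ck.
have [ltc|lec] := ltnP E.2.2 c; first by exists [::]; constructor.
have [e g] := grows_to_ex (fun e' => opt D 1 (cols E c e') <= tau) lec.
have [e1 _ _] := g.
have [||Bs hBs] := IH e.+1; try lia.
exists (cols E c e :: Bs); apply: slice_merge => //.
by rewrite opt_cell_row //; nlia.
Qed.

Lemma slice_ex (R : realType) n m (D : 'M[R]_(n, m)) tau E c :
  0 <= tau -> inside n m E -> (E.2.1 <= c)%N ->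
  exists Bs, slice_loop D tau E c Bs.
Proof.
move=> tau0 iE cE; have [k] := ubnP (E.2.2.+1 - c)%N.
elim: k c cE => // k IH c cE ck.
have [ltc|lec] := ltnP E.2.2 c; first by exists [::]; constructor.
have [ole|ogt] := leP (opt D 1 (cols E c c)) tau; last first.
  have [||Bs2 h2] := IH c.+1; try lia.
  have [||||Bs1 h1] :=
      @slice_row_ex R m n D^T tau (tr_rect (cols E c c)) (tr_rect (cols E c c)).2.1 => //.
    by rewrite inside_tr; apply: inside_cols => //; lia.
  by exists ([seq tr_rect B | B <- Bs1] ++ Bs2); apply: slice_column.
have [e g] := grows_to_ex (fun e' => opt D 1 (cols E c e') <= tau) lec.
have [e1 _ _] := g.
have [||Bs hBs] := IH e.+1; try lia.
by exists (cols E c e :: Bs); apply: slice_merge.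
Qed.

Lemma count_iota_split (p : pred nat) c e h : (c <= e <= h)%N ->
  count p (iota c (h - c)) = (count p (iota c (e - c)) + count p (iota e (h - e)))%N.
Proof.
move=> hc; rewrite -count_cat; have {2}-> : e = (c + (e - c))%N by lia.
by rewrite -iotaD; congr (count _ (iota _ _)); lia.
Qed.

Lemma count_iota0 (p : pred nat) c e : (c <= e)%N -> count p (iota c (e - c)) = 0%N ->
  forall j, (c <= j < e)%N -> ~~ p j.
Proof.
move=> ce /eqP; rewrite -leqn0 leqNgt -has_count => /hasPn h j hj.
by apply: h; rewrite mem_iota; lia.
Qed.

(** [chg j] stands for a possible change of [s] between columns [j] and [j + 1]. It is kept abstract
    so that the transposed call on a column where [s] is constant can take it empty. *)
Section Witness.
Variables (R : realType) (n m : nat) (D s : 'M[R]_(n, m)) (tau theta : R).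
Hypotheses (tau_ge0 : 0 <= tau) (theta_ge0 : 0 <= theta).
Hypothesis theta_le : forall B, tau < loss D B s -> theta <= loss D B s.
Variables (E : rect) (chg : pred nat).
Hypothesis inE : inside n m E.
Hypothesis chgP : forall c e, (E.2.1 <= c <= e)%N -> (e <= E.2.2)%N ->
  (forall j, (c <= j < e)%N -> ~~ chg j) -> constant_on s (cols E c e).

Lemma loss_cols c e e' : (c <= e <= e')%N ->
  loss D (cols E c e') s = loss D (cols E c e) s + loss D (cols E e.+1 e') s.
Proof. by move=> h; apply: loss_rect => i j; rewrite /in_rect /=; nlia. Qed.

Lemma le_loss_cols c e c' e' : (c' <= c)%N -> (e <= e')%N ->
  loss D (cols E c e) s <= loss D (cols E c' e') s.
Proof. by move=> h h'; apply: le_loss => i j; rewrite /in_rect /=; nlia. Qed.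

(* A block that is not the last one of its row of blocks cannot be enlarged, so
   either s changes next to it or the loss of s on the enlarged block exceeds
   tau. The subtracted term remembers that the next column may be used twice. *)
Lemma slice_size_gen (kappa : R) c Bs : 2 <= kappa ->
  (forall c Bs, (E.2.1 <= c <= E.2.2)%N -> tau < opt D 1 (cols E c c) ->
     slice_loop D^T tau (tr_rect (cols E c c)) (tr_rect (cols E c c)).2.1 Bs ->
     theta * (size Bs)%:R <= (kappa - 1) * loss D (cols E c c) s) ->
  slice_loop D tau E c Bs -> (E.2.1 <= c)%N ->
  theta * (size Bs)%:R <=
    kappa * loss D (cols E c E.2.2) s - loss D (cols E c (minn c E.2.2)) s
    + theta * ((count chg (iota c (E.2.2 - c)))%:R + 1).
Proof.
move=> kappa2 hcol; have [k] := ubnP (E.2.2.+1 - c)%N.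
elim: k c Bs => // k IH c Bs ck /slice_inv[[ltc ->] cE|[Bs1 [Bs2 [cle tauo h1 h2 ->]]] cE
  |[e [Bs2 [cle ole [g1 g2 g3] h2 ->]]] cE].
- rewrite mulr0; have -> : minn c E.2.2 = E.2.2 by nlia.
  have -> : loss D (cols E c E.2.2) s = 0.
    by apply: bsum0 => i j; rewrite /in_rect /=; nlia.
  by rewrite mulr0 subrr add0r mulr_ge0 // addr_ge0 // ler0n.
- rewrite size_cat size_map natrD mulrDr.
  (* The blocks of column [c] use [kappa - 1] copies of its loss; the last copy is the one reserved
     for the preceding block. *)
  have Bs2le := IH _ _ _ h2; have := hcol c Bs1 _ tauo h1.
  have -> : minn c E.2.2 = c by nlia.
  have : (count chg (iota c.+1 (E.2.2 - c.+1)) <= count chg (iota c (E.2.2 - c)))%N.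
    have [->|ne] := eqVneq c E.2.2; first by rewrite subnn subnS subnn.
    by rewrite (@count_iota_split chg c c.+1 E.2.2); nlia.
  rewrite -(ler_nat R) => /(ler_wpM2l theta_ge0) cle'.
  rewrite (@loss_cols c c E.2.2); last by nlia.
  have := loss_ge0 D (cols E c.+1 (minn c.+1 E.2.2)) s.
  move=> l0 H1; have {}H1 := H1 ltac:(nlia).
  have {}Bs2le := Bs2le ltac:(nlia) ltac:(nlia); lra.
- have -> : minn c E.2.2 = c by nlia.
  rewrite /= -natr1 mulrDr mulr1.
  (* The block reaching the last column is paid by the summand 1 next to the number of changes. *)
  have [ehi|ne] := eqVneq e E.2.2.
    have [[_ ->]|[? [? [? _ _ _ _]]]|[? [? [? _ _ _ _]]]] := slice_inv h2; [|nlia|nlia].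
    rewrite mulr0 add0r -[X in X <= _]add0r mulrDr mulr1 addrA lerD2r.
    rewrite addr_ge0 ?mulr_ge0 ?ler0n // subr_ge0.
    apply: (le_trans (le_loss_cols (leqnn c) cle)).
    by rewrite ler_peMl ?loss_ge0 //; lra.
  have {}h2 := IH e.+1 Bs2 _ h2 _.
  have {h2} h2 := h2 ltac:(nlia) ltac:(nlia).
  (* Growth stopped before the last column, so the block with column [e + 1] added exceeds the
     threshold. *)
  have tauo : tau < opt D 1 (cols E c e.+1).
    by rewrite ltNge; apply/negP/g3; nlia.
  have cov := @loss_cols c e E.2.2.
  rewrite cov; last by nlia.
  have lec : loss D (cols E c c) s <= loss D (cols E c e) s by apply: le_loss_cols; nlia.
  (* One copy of this loss pays for the block, the other covers its first column, which is reserved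
     for the predecessor. *)
  have kle : 2 * loss D (cols E c e) s <= kappa * loss D (cols E c e) s.
    by rewrite ler_wpM2r ?loss_ge0.
  have l00 := loss_ge0 D (cols E c c) s.
  have mE : minn e.+1 E.2.2 = e.+1 by nlia.
  rewrite mE in h2.
  have l1 := loss_ge0 D (cols E e.+1 e.+1) s.
  rewrite (@count_iota_split chg c e.+1 E.2.2); last by nlia.
  have [z|pos] := posnP (count chg (iota c (e.+1 - c))).
    have cst : constant_on s (cols E c e.+1).
      by apply: chgP; [nlia|nlia|apply: count_iota0 => //; nlia].
    have iB : inside n m (cols E c e.+1) by apply: inside_cols => //; nlia.
    have := theta_le (lt_le_trans tauo (opt_le_constant D iB cst)).
    rewrite (@loss_cols c e e.+1) ?z ?add0n; last by nlia.
    move=> th; lra.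
  have p1 : 1 <= (count chg (iota c (e.+1 - c)))%:R :> R by rewrite ler1n.
  have := ler_wpM2l theta_ge0 p1; rewrite natrD; lra.
Qed.

(** No cell of a single row is split, so the assumption on split columns is vacuous and the smallest
    rate, 2, is allowed. *)
Lemma slice_size_row c Bs : E.1.1 = E.1.2 ->
  slice_loop D tau E c Bs -> (E.2.1 <= c)%N ->
  theta * (size Bs)%:R <=
    2 * loss D (cols E c E.2.2) s + theta * ((count chg (iota c (E.2.2 - c)))%:R + 1).
Proof.
move=> rE sl cE; apply: (le_trans (@slice_size_gen 2 c Bs _ _ sl cE)) => //.
  by move=> c' Bs' hc'; rewrite opt_cell_row // ltNge tau_ge0.
by rewrite lerD2r gerBl loss_ge0.
Qed.

(** A merged block on which [s] varies contains a change between two of its columns, and merged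
    blocks are disjoint. The pieces of a split column lie in one column, where [s] is constant. *)
Lemma nonconstant_blocks c Bs :
  slice_loop D tau E c Bs -> (E.2.1 <= c)%N ->
  (count (fun B => `[< ~ constant_on s B >]) Bs <= count chg (iota c (E.2.2 - c)))%N.
Proof.
have [k] := ubnP (E.2.2.+1 - c)%N.
elim: k c Bs => // k IH c Bs ck /slice_inv[[ltc ->] cE //|[Bs1 [Bs2 [cle tauo h1 h2 ->]]] cE
  |[e [Bs2 [cle ole [g1 g2 g3] h2 ->]]] cE].
- rewrite count_cat; have z : count (fun B => `[< ~ constant_on s B >]) [seq tr_rect B | B <- Bs1] = 0%N.
    apply/eqP; rewrite -leqn0 leqNgt -has_count; apply/hasPn => _ /mapP[B BBs1 ->].
    apply/negP => /asboolP; apply.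
    have cst : constant_on s (cols E c c) by apply: chgP; [nlia|nlia|move=> j; nlia].
    apply: constant_onS cst => i j; rewrite in_rect_tr => hB.
    have iE' : inside m n (tr_rect (cols E c c)).
      by rewrite inside_tr; apply: inside_cols => //; nlia.
    by have := slice_cover_in h1 iE' (leqnn _) BBs1 hB; rewrite /in_rect /=; nlia.
  rewrite z add0n; apply: leq_trans (IH _ _ _ h2 _) _; try nlia.
  have [->|ne] := eqVneq c E.2.2; first by rewrite subnn subnS subnn.
  by rewrite (@count_iota_split chg c c.+1 E.2.2); nlia.
- have /= h := IH e.+1 Bs2 _ h2 _; have {}h := h ltac:(nlia) ltac:(nlia).
  have h' : (count chg (iota e.+1 (E.2.2 - e.+1)) <= count chg (iota e (E.2.2 - e)))%N.
    have [->|ne] := eqVneq e E.2.2; first by rewrite subnn subnS subnn.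
    by rewrite (@count_iota_split chg e e.+1 E.2.2); nlia.
  rewrite (@count_iota_split chg c e E.2.2); last by nlia.
  case: asboolP => [nc|_] /=; last by nlia.
  have [z|pos] := posnP (count chg (iota c (e - c))); last by nlia.
  by case: nc; apply: chgP; [nlia|nlia|apply: count_iota0 => //; nlia].
Qed.

End Witness.

(** A split column costs twice its loss plus [theta] by the one-row bound for its transpose, and
    [theta] is at most its loss since its optimum exceeds the threshold. Hence [kappa - 1 = 3]. *)
Lemma slice_size (R : realType) n m (D s : 'M[R]_(n, m)) (tau theta : R)
    (E : rect) (chg : pred nat) c Bs :
  0 <= tau -> 0 <= theta ->
  (forall B, tau < loss D B s -> theta <= loss D B s) ->
  inside n m E ->
  (forall c e, (E.2.1 <= c <= e)%N -> (e <= E.2.2)%N ->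
    (forall j, (c <= j < e)%N -> ~~ chg j) -> constant_on s (cols E c e)) ->
  slice_loop D tau E c Bs -> (E.2.1 <= c)%N ->
  theta * (size Bs)%:R <=
    4 * loss D (cols E c E.2.2) s
    + theta * ((count chg (iota c (E.2.2 - c)))%:R + 1).
Proof.
move=> tau0 theta0 thetale iE chgP sl cE.
have := @slice_size_gen R n m D s tau theta theta0 thetale E chg iE chgP 4 c Bs _ _ sl cE.
move=> H; apply: (le_trans (H _ _)).
  by rewrite ler_nat.
  move=> c' Bs' hc' tauo sl'.
  have iC : inside n m (cols E c' c') by apply: inside_cols => //; nlia.
  have cst : constant_on s (cols E c' c') by apply: chgP; [nlia|nlia|move=> j; nlia].
  have th := thetale _ (lt_le_trans tauo (opt_le_constant D iC cst)).
  have := @slice_size_row R m n D^T s^T tau theta tau0 theta0 _ (tr_rect (cols E c' c')) pred0 _ _ _ Bs' erefl sl' (leqnn _).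
  rewrite /= count_pred0 => Hr; apply: le_trans (Hr _ _ _) _.
  - by move=> B; rewrite -{1 2}(tr_rectK B) !loss_tr; exact: thetale.
  - by rewrite inside_tr.
  - move=> c1 e1 h1 h2 _; apply: constant_onS (constant_on_tr cst) => i j.
    by rewrite /in_rect /=; move: h1 h2 => /=; nlia.
  - have -> : cols (tr_rect (cols E c' c')) (tr_rect (cols E c' c')).2.1 E.1.2 = tr_rect (cols E c' c').
      by rewrite /cols /tr_rect /=; case: (E.1).
    by rewrite loss_tr; lra.
by rewrite lerD2r gerBl loss_ge0.
Qed.

(** * Counting the blocks of a partition *)

Definition convex_pred (I : pred nat) : Prop :=
  forall a b c, (a <= b <= c)%N -> I a -> I c -> I b.

(** Trace of a partition of the plane on the indices: each piece is a product of order-convex sets,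
    so that transposition merely exchanges the two families. *)
Definition grid_segmentation (R : realType) n m k (s : 'M[R]_(n, m)) : Prop :=
  exists I J : 'I_k -> pred nat,
    [/\ forall l, convex_pred (I l), forall l, convex_pred (J l),
        forall (i : 'I_n) (j : 'I_m), exists l, I l i && J l j &
        forall l (i i' : 'I_n) (j j' : 'I_m), I l i && J l j -> I l i' && J l j' ->
          s i j = s i' j'].

Lemma grid_segmentation_tr (R : realType) n m k (s : 'M[R]_(n, m)) :
  grid_segmentation k s -> grid_segmentation k s^T.
Proof.
case=> I [J [cI cJ cov cst]]; exists J, I; split=> // [j i|l j j' i i' h h'].
  by have [l hl] := cov i j; exists l; rewrite andbC.
by rewrite !mxE; apply: (cst l); rewrite andbC.
Qed.

Lemma segmentation_grid (R : realType) n m k (s : 'M[R]_(n, m)) :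
  segmentation k s -> grid_segmentation k s.
Proof.
case=> f [P [_ _ cov cst]] sE.
have cvx (Q : interval R) : convex_pred (fun i => i.+1%:R \in Q).
  move=> a b c /andP[ab bc] ha hc.
  apply: (@interval_is_interval R Q _ _ ha hc).
  by rewrite /= !ler_nat !ltnS ab bc.
exists (fun l i => i.+1%:R \in (P l).1), (fun l j => j.+1%:R \in (P l).2).
split=> // [i j|l i i' j j' /andP[h1 h2] /andP[h3 h4]].
  have : [set: R * R]%classic (i.+1%:R, j.+1%:R) by [].
  by rewrite -cov => -[l _ [/= h1 h2]]; exists l; apply/andP.
by rewrite !sE; apply: (cst l).
Qed.

Definition row_change (R : realType) n m (s : 'M[R]_(n, m)) (i : nat) : bool :=
  `[< exists (i0 i1 : 'I_n) (j : 'I_m),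
        [/\ i0 = i :> nat, i1 = i.+1 :> nat & s i0 j <> s i1 j] >].

(* The piece of s just below a change starts there, so no piece serves two changes. *)
Lemma row_changes (R : realType) n m k (s : 'M[R]_(n, m)) a b :
  grid_segmentation k s -> (count (row_change s) (iota a b) <= k)%N.
Proof.
case=> I [J [cI cJ cov cst]].
have start i : row_change s i -> exists l : 'I_k, I l i.+1 && ~~ I l i.
  case/asboolP=> i0 [i1 [j [e0 e1 ne]]]; have [l /andP[hI hJ]] := cov i1 j.
  exists l; rewrite -e1 hI /=; apply/negP => hI0; apply: ne.
  by apply: (cst l); rewrite ?hI ?hJ // e0 hI0.
rewrite -size_filter; set S := [seq x <- _ | _].
have uS : uniq S by rewrite filter_uniq // iota_uniq.
case: k I J cI cJ cov cst start => [|k] I J cI cJ cov cst start.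
  rewrite leqn0 size_filter -leqn0 leqNgt -has_count; apply/hasPn => i _.
  by apply/negP => /start[[]].
have start' i : exists l : 'I_k.+1, row_change s i -> I l i.+1 && ~~ I l i.
  have [/start[l hl]|/negP nh] := boolP (row_change s i); first by exists l.
  by exists ord0 => h; case: nh.
have [F FP] := choice start'.
rewrite -(size_map F) -[leqRHS]card_ord; apply/card_geqP; exists (map F S); split=> //.
rewrite map_inj_in_uniq // => i i'; rewrite !mem_filter => /andP[/FP/andP[h1 h2] _].
move=> /andP[/FP/andP[h3 h4] _] FE; apply/eqP; rewrite eqn_leq; apply/andP; split.
  by rewrite leqNgt; apply/negP => lt; move/negP: h2; apply; apply: (cI (F i) i'.+1 i i.+1) => //;
    [nlia|rewrite FE].
by rewrite leqNgt; apply/negP => lt; move/negP: h4; apply; apply: (cI (F i') i.+1 i' i'.+1) => //;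
    [nlia|rewrite -FE].
Qed.

Lemma no_row_change (R : realType) n m (s : 'M[R]_(n, m)) a b :
  (forall i, (a <= i < b)%N -> ~~ row_change s i) ->
  forall (i i' : 'I_n) (j : 'I_m), (a <= i <= b)%N -> (a <= i' <= b)%N -> s i j = s i' j.
Proof.
move=> nc; suff up d (i i' : 'I_n) (j : 'I_m) :
    (i' = i + d :> nat)%N -> (a <= i)%N -> (i' <= b)%N -> s i j = s i' j.
  move=> i i' j hi hi'; case: (leqP i i') => h; first by apply: (up (i' - i)%N); nlia.
  by apply/esym; apply: (up (i - i')%N); nlia.
elim: d i' => [|d IH] i' ii' ai ib; first by congr (s _ _); apply: val_inj => /=; nlia.
have lt : (i + d < n)%N by move: (ltn_ord i'); nlia.
rewrite (IH (Ordinal lt)) //=; last by nlia.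
have := nc (i + d)%N ltac:(nlia); move=> /asboolPn h.
by apply: contrapT => ne; apply: h; exists (Ordinal lt), i', j; split=> //=; nlia.
Qed.

(** Two cells are joined by a vertical move in column [j] and a horizontal move in row [i']. *)
Lemma no_change_constant (R : realType) n m (s : 'M[R]_(n, m)) (B : rect) :
  (forall i, (B.1.1 <= i < B.1.2)%N -> ~~ row_change s i) ->
  (forall j, (B.2.1 <= j < B.2.2)%N -> ~~ row_change s^T j) -> constant_on s B.
Proof.
move=> nr nc i i' j j' /andP[h1 h2] /andP[h3 h4].
rewrite (no_row_change nr j h1 h3).
by have := no_row_change nc i' h2 h4; rewrite !mxE.
Qed.

Section Partition.
Variables (R : realType) (n m : nat) (D : 'M[R]_(n, m)) (gamma sigma : R).
Hypotheses (n_gt0 : (0 < n)%N) (m_gt0 : (0 < m)%N).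
Hypotheses (gamma_gt0 : 0 < gamma) (sigma_ge0 : 0 <= sigma).

Let tau := gamma ^+ 2 * sigma.

Lemma tau_ge0 : 0 <= tau.
Proof. by rewrite mulr_ge0 // exprn_ge0 // ltW. Qed.

Lemma inside_rows r e : (r <= e < n)%N -> inside n m (rows m r e).
Proof. by rewrite /inside /rows /=; nlia. Qed.

(** Common outcome of both branches of a step. The row [e'] witnessing too many blocks is [e + 1]
    after a growth, and [e] itself when the first row alone is already too complex. *)
Lemma partition_row_end r e B' Bs : (r < n)%N ->
  slice_partition D (rows m r r) tau B' ->
  (if gamma^-1 < (size B')%:R then e = r else
   grows_to
     (fun e' => exists2 B'', slice_partition D (rows m r e') tau B''
                           & (size B'')%:R <= gamma^-1)
     r n.-1 e) ->
  slice_partition D (rows m r e) tau Bs ->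
  [/\ (r <= e < n)%N, ((r < e)%N -> (size Bs)%:R <= gamma^-1) &
    (e < n.-1)%N -> exists e' B'', [/\ (e <= e' <= e.+1)%N,
       slice_partition D (rows m r e') tau B'' & gamma^-1 < (size B'')%:R]].
Proof.
move=> rn sl1; case: ltP => [gt -> sl2|le [g1 g2 g3] sl2].
  split; [nlia|by rewrite ltnn|].
  by move=> _; exists r, B'; split=> //; nlia.
split; [nlia| |].
  move=> re; have [|B'' sl3 le3] := g2 e.-1; first by nlia.
  have E1 : e.-1.+1 = e by nlia.
  by rewrite E1 in sl3; rewrite (slice_det sl2 sl3).
move=> ltn; have [|//|B'' sl3] := @slice_ex R n m D tau (rows m r e.+1) 0%N tau_ge0.
  by apply: inside_rows; nlia.
exists e.+1, B''; split=> //; first by nlia.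
by rewrite ltNge; apply/negP => le3; apply: (g3 ltn); exists B''.
Qed.

Lemma partition_done_inv r Bs : (n <= r)%N -> partition_loop D gamma sigma r Bs -> Bs = [::].
Proof. by move=> nr hp; case: hp nr => // *; nlia. Qed.

Lemma partition_cover r Bs : partition_loop D gamma sigma r Bs ->
  (forall i j, count (fun B => in_rect B i j) Bs = in_rect (rows m r n.-1) i j) /\
  (forall B, B \in Bs -> inside n m B /\ opt D 1 B <= tau).
Proof.
elim=> {r Bs} [r nr|r e B' Bs Bs' rn sl1 hif sl2 _ [cov ok]].
  by split=> // i j /=; rewrite /in_rect /=; nlia.
have [e1 _ _] := partition_row_end rn sl1 hif sl2.
have [cov' ok'] := slice_cover sl2 (inside_rows e1) (leq0n _).
split=> [i j|B]; last by rewrite mem_cat => /orP[/ok'|/ok].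
by rewrite count_cat cov cov' /in_rect /=; nlia.
Qed.

Variables (s : 'M[R]_(n, m)) (k : nat) (theta : R).
Hypothesis grid_s : grid_segmentation k s.
Hypothesis theta_ge0 : 0 <= theta.
Hypothesis theta_le : forall B, tau < loss D B s -> theta <= loss D B s.

Lemma slice_rows_change r e c c' :
  (forall i, (r <= i < e)%N -> ~~ row_change s i) ->
  (forall j, (c <= j < c')%N -> ~~ row_change s^T j) ->
  constant_on s (cols (rows m r e) c c').
Proof. by move=> nr nc; apply: no_change_constant. Qed.

(** When no row change occurs inside the slab, only changes between columns matter, and these are at
    most [k] by [row_changes] for the transpose. *)
Lemma slice_rows_size r e Bs : (r <= e < n)%N ->
  (forall i, (r <= i < e)%N -> ~~ row_change s i) ->
  slice_partition D (rows m r e) tau Bs ->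
  theta * (size Bs)%:R <= 4 * loss D (rows m r e) s + theta * k.+1%:R.
Proof.
move=> re nr sl.
have H := @slice_size R n m D s tau theta (rows m r e) (row_change s^T) 0 Bs tau_ge0 theta_ge0
  theta_le (inside_rows re) _ sl (leqnn _).
apply: (le_trans (H _)) => [c e' _ _ nc|]; first exact: slice_rows_change.
rewrite lerD2l ler_wpM2l // natr1 ler_nat ltnS.
by apply: row_changes; exact: grid_segmentation_tr.
Qed.

Lemma slice_rows_nonconstant r e Bs : (r <= e < n)%N ->
  (forall i, (r <= i < e)%N -> ~~ row_change s i) ->
  slice_partition D (rows m r e) tau Bs ->
  (count (fun B => `[< ~ constant_on s B >]) Bs <= k)%N.
Proof.
move=> re nr sl.
apply: leq_trans (@nonconstant_blocks R n m D s tau (rows m r e) (row_change s^T)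
  (inside_rows re) _ 0%N Bs sl (leqnn _)) _.
  by move=> c e' _ _ nc; exact: slice_rows_change.
by apply: row_changes; exact: grid_segmentation_tr.
Qed.

Hypothesis gamma_k : 2 * k.+1%:R <= gamma^-1.

(** Since [2 (k + 1) <= 1 / gamma], changes of [s] pay for at most half of [1 / gamma] blocks. The
    other half is paid by the loss at rate 4, whence the factor 8. *)
Lemma many_slices_loss r e Bs : (r <= e < n)%N ->
  (forall i, (r <= i < e)%N -> ~~ row_change s i) ->
  slice_partition D (rows m r e) tau Bs -> gamma^-1 < (size Bs)%:R ->
  theta <= 8 * gamma * loss D (rows m r e) s.
Proof.
move=> re nr sl gt; have := slice_rows_size re nr sl.
set L := loss _ _ _ => h.
have h1 : theta * gamma^-1 <= theta * (size Bs)%:R by rewrite ler_wpM2l // ltW.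
have h2 : theta * (2 * k.+1%:R) <= theta * gamma^-1 by rewrite ler_wpM2l.
have h3 : theta * gamma^-1 <= 8 * L by lra.
have := ler_wpM2r (ltW gamma_gt0) h3.
rewrite divfK ?lt0r_neq0 // => h4; lra.
Qed.

Lemma loss_rows r e e' : (r <= e <= e')%N ->
  loss D (rows m r e') s = loss D (rows m r e) s + loss D (rows m e.+1 e') s.
Proof. by move=> h; apply: loss_rect => i j; rewrite /in_rect /=; nlia. Qed.

Variables (w : seq rect -> nat) (kappa : R).
Hypothesis kappa_ge0 : 0 <= kappa.
Hypothesis w_nil : w [::] = 0%N.
Hypothesis w_cat : forall Bs Bs', w (Bs ++ Bs') = (w Bs + w Bs')%N.
Hypothesis w_size : forall Bs, (w Bs <= size Bs)%N.
Hypothesis w_rows : forall r e Bs, (r <= e < n)%N ->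
  (forall i, (r <= i < e)%N -> ~~ row_change s i) ->
  slice_partition D (rows m r e) tau Bs ->
  theta * (w Bs)%:R <= kappa * loss D (rows m r e) s + theta * k.+1%:R.

(* A slab on which s varies from row to row uses up a row change of s; every other
   slab but the last one either precedes a row change or, enlarged by one row,
   carries loss of s. *)
Lemma partition_weight_gen r Bs : partition_loop D gamma sigma r Bs -> (r <= n)%N ->
  theta * (w Bs)%:R <=
    theta / gamma * (count (row_change s) (iota r (n - r)))%:R
    + kappa * loss D (rows m r n.-1) s
    + theta * k.+1%:R * (1 + (count (row_change s) (iota r (n - r)))%:R)
    + 8 * gamma * k.+1%:R *
        (2 * loss D (rows m r n.-1) s - loss D (rows m r (minn r n.-1)) s).
Proof.
have g0 := ltW gamma_gt0; have gV0 : 0 <= gamma^-1 by rewrite invr_ge0.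
have tg0 : 0 <= theta / gamma by rewrite mulr_ge0.
have tk0 : 0 <= theta * k.+1%:R by rewrite mulr_ge0.
have gk0 : 0 <= 8 * gamma * k.+1%:R by rewrite !mulr_ge0.
elim=> {r Bs} [r nr rn|r e B' Bs Bs' rn sl1 hif sl2 hp IH _].
  rewrite w_nil mulr0; have -> : minn r n.-1 = n.-1 by nlia.
  have -> : loss D (rows m r n.-1) s = 0.
    by apply: bsum0 => i j; rewrite /in_rect /=; nlia.
  by rewrite !mulr0 subr0 mulr0 !addr0 addr_ge0 // mulr_ge0 // addr_ge0.
have [e1 e2 e3] := partition_row_end rn sl1 hif sl2.
have -> : minn r n.-1 = r by nlia.
rewrite w_cat natrD mulrDr.
have lrow : loss D (rows m r r) s <= loss D (rows m r e) s.
  by apply: le_loss => i j; rewrite /in_rect /=; nlia.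
have l00 := loss_ge0 D (rows m r r) s.
have rc1 := @count_iota_split (row_change s) r e n ltac:(nlia).
have slab : theta * (w Bs)%:R <=
    theta / gamma * (count (row_change s) (iota r (e - r)))%:R
    + kappa * loss D (rows m r e) s + theta * k.+1%:R.
  have kl0 : 0 <= kappa * loss D (rows m r e) s by rewrite mulr_ge0 ?loss_ge0.
  have [z|pos] := posnP (count (row_change s) (iota r (e - r))).
    rewrite z mulr0 add0r; apply: (w_rows _ _ sl2) => // i hi.
      by apply: (count_iota0 _ z hi); nlia.
  (* A change inside the slab needs two rows, and a slab of several rows has at most [1 / gamma]
     blocks. *)
  have re : (r < e)%N.
    by rewrite ltnNge; apply/negP => h; move: pos; have -> : (e - r = 0)%N by nlia.
  have p1 : 1 <= (count (row_change s) (iota r (e - r)))%:R :> R by rewrite ler1n.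
  have := ler_wpM2l tg0 p1; rewrite mulr1 => h1.
  have h2 : theta * (w Bs)%:R <= theta * gamma^-1.
    rewrite ler_wpM2l //; apply: (le_trans _ (e2 re)); by rewrite ler_nat.
  lra.
(* The last slab has no successor; its share [theta (k + 1)] is the summand 1 next to the number of
   changes. *)
have [ltn|nlt] := ltnP e n.-1; last first.
  have en : e = n.-1 by nlia.
  have hp' : Bs' = [::] by apply: (partition_done_inv _ hp); nlia.
  rewrite hp' w_nil mulr0 addr0; move: slab rc1 lrow; rewrite en => slab -> lrow.
  rewrite natrD.
  have p2 : 0 <= (count (row_change s) (iota n.-1 (n - n.-1)))%:R :> R by [].
  have p3 := mulr_ge0 tg0 p2; have p4 := mulr_ge0 tk0 p2.
  have p1 : 0 <= (count (row_change s) (iota r (n.-1 - r)))%:R :> R by [].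
  have p5 := mulr_ge0 tk0 p1.
  have p6 : 0 <= 8 * gamma * k.+1%:R *
      (2 * loss D (rows m r n.-1) s - loss D (rows m r r) s).
    by rewrite mulr_ge0 //; lra.
  lra.
have {}IH := IH ltac:(nlia).
move: IH; have -> : minn e.+1 n.-1 = e.+1 by nlia.
rewrite (@loss_rows r e n.-1); last by nlia.
have rc2 := @count_iota_split (row_change s) r e.+1 n ltac:(nlia).
rewrite rc2 natrD; set c1 := (count _ (iota r _))%:R; set c2 := (count _ (iota e.+1 _))%:R.
set L1 := loss D (rows m r e) s; set L2 := loss D (rows m e.+1 n.-1) s.
set L0 := loss D (rows m r r) s; set L3 := loss D (rows m e.+1 e.+1) s => IH.
have c10 : 0 <= c1 by [].
have cle : (count (row_change s) (iota r (e - r)))%:R <= c1 :> R.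
  rewrite ler_nat; have -> : (e.+1 - r = (e - r) + 1)%N by nlia.
  by rewrite iotaD count_cat leq_addr.
have := ler_wpM2l tg0 cle => h1.
(* The share of this slab is paid by a change among rows [r] to [e + 1], or else by the loss on
   these rows. Here [L3] is the first row of the next slab, reserved in the induction hypothesis. *)
have h2 : theta * k.+1%:R <= theta * k.+1%:R * c1 + 8 * gamma * k.+1%:R * (L1 + L3).
  have l10 : 0 <= L1 + L3 by rewrite addr_ge0 ?loss_ge0.
  have [z|pos] := posnP (count (row_change s) (iota r (e.+1 - r))); last first.
    have : 1 <= c1 by rewrite ler1n.
    move/(ler_wpM2l tk0); have := mulr_ge0 gk0 l10; lra.
  have [e' [B'' [he' sl3 gt]]] := e3 ltn.
  have th : theta <= 8 * gamma * loss D (rows m r e') s.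
    apply: (many_slices_loss _ _ sl3 gt); first by nlia.
    by move=> i hi; apply: (count_iota0 _ z); nlia.
  have le' : loss D (rows m r e') s <= L1 + L3.
    rewrite /L1 /L3 -loss_rows; last by nlia.
    by apply: le_loss => i j; rewrite /in_rect /=; nlia.
  have g8 : 0 <= 8 * gamma by rewrite mulr_ge0.
  have := le_trans th (ler_wpM2l g8 le') => th'.
  have k0 : 0 <= k.+1%:R :> R by [].
  have := ler_wpM2r k0 th'; have := mulr_ge0 tk0 c10; lra.
have h3 : 8 * gamma * k.+1%:R * L0 <= 8 * gamma * k.+1%:R * L1 by rewrite ler_wpM2l.
rewrite -/L1 in slab; lra.
Qed.

(** At most [k] row changes occur in all; 16 is 8 times the two possible uses of each row. *)
Lemma partition_weight Bs : Defs.partition D gamma sigma Bs ->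
  theta * (w Bs)%:R <=
    theta / gamma * k%:R + kappa * loss D (full_rect n m) s
    + theta * k.+1%:R ^+ 2 + 16 * gamma * k.+1%:R * loss D (full_rect n m) s.
Proof.
move=> /partition_weight_gen-/(_ (leq0n _)); rewrite subn0.
have -> : rows m 0 n.-1 = full_rect n m by [].
set L := loss D (full_rect n m) s; set c := count _ _ => H.
have ck : c%:R <= k%:R :> R by rewrite ler_nat; exact: row_changes.
have tg0 : 0 <= theta / gamma by rewrite mulr_ge0 // invr_ge0 ltW.
have tk0 : 0 <= theta * k.+1%:R by rewrite mulr_ge0.
have := ler_wpM2l tg0 ck; have := ler_wpM2l tk0 ck.
have gk0 : 0 <= 8 * gamma * k.+1%:R by rewrite !mulr_ge0 // ltW.
have := mulr_ge0 gk0 (loss_ge0 D (rows m 0 (minn 0 n.-1)) s).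
move: H; rewrite -natr1; lra.
Qed.

End Partition.

(** * Estimating the loss of a segmentation *)

Lemma sum_interval n a b :
  (\sum_(i < n) (a <= i <= b)%N = minn n b.+1 - a)%N.
Proof.
elim: n => [|n IH]; first by rewrite big_ord0; lia.
by rewrite big_ord_recr /= IH; lia.
Qed.

Lemma areaE (R : realType) n m (B : rect) : (B.1.2 < n)%N -> (B.2.2 < m)%N ->
  area R n m B = ((B.1.2.+1 - B.1.1) * (B.2.2.+1 - B.2.1))%:R.
Proof.
move=> h1 h2; have -> : (B.1.2.+1 - B.1.1 = \sum_(i < n) (B.1.1 <= i <= B.1.2))%N.
  by rewrite sum_interval; congr (_ - _)%N; lia.
have -> : (B.2.2.+1 - B.2.1 = \sum_(j < m) (B.2.1 <= j <= B.2.2))%N.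
  by rewrite sum_interval; congr (_ - _)%N; lia.
rewrite /area bsumE big_distrl natr_sum; apply: eq_bigr => i _ /=.
rewrite big_distrr natr_sum; apply: eq_bigr => j _ /=.
by rewrite mulr1 /in_rect mulnb.
Qed.

Definition mean (R : realType) n m (D : 'M[R]_(n, m)) B : R :=
  bsum (fun i j => D i j) B / area R n m B.

(** The loss without the cross terms [2 (s - mean) (mean - D)]. It depends on the labels through the
    moments of the block only. *)
Definition estimate (R : realType) n m (D s : 'M[R]_(n, m)) B : R :=
  vari D B + bsum (fun i j => (s i j - mean D B) ^+ 2) B.

Section Estimate.
Variables (R : realType) (n m : nat).
Implicit Types (D s : 'M[R]_(n, m)) (B : rect).

(** For a constant the cross terms cancel, as deviations from the mean add up to 0. *)
Lemma estimate_constant D s B : inside n m B -> constant_on s B ->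
  estimate D s B = loss D B s.
Proof.
move=> iB sc; have [i0 [j0 B0]] := inside_ex iB.
rewrite /estimate lossE.
under [X in _ + X]eq_bsum => i j hij do rewrite (sc i i0 j j0 hij B0) -[_ ^+ 2]mulr1.
under [RHS]eq_bsum => i j hij do rewrite (sc i i0 j j0 hij B0).
by rewrite loss_const // bsumZ mulrC.
Qed.

Lemma vari_mean D B : inside n m B ->
  vari D B = bsum (fun i j => (mean D B - D i j) ^+ 2) B.
Proof. by move=> iB; rewrite loss_const // subrr expr0n mulr0 addr0. Qed.

(** Young's inequality with parameter [lam] bounds each cross term; then [(s - mean)^2 <= 2 (s -
    D)^2 + 2 (mean - D)^2] brings back the loss itself. *)
Lemma estimate_error D s B (lam : R) : inside n m B -> 0 < lam ->
  `|loss D B s - estimate D s B| <=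
    2 * lam * loss D B s + (2 * lam + lam^-1) * vari D B.
Proof.
move=> iB lam0; rewrite /estimate vari_mean // lossE.
set mu := mean D B.
have -> : bsum (fun i j => (s i j - D i j) ^+ 2) B
    - (bsum (fun i j => (mu - D i j) ^+ 2) B + bsum (fun i j => (s i j - mu) ^+ 2) B)
    = bsum (fun i j => 2 * ((s i j - mu) * (mu - D i j))) B.
  rewrite -bsumD; apply/eqP; rewrite subr_eq; apply/eqP; rewrite -bsumD.
  by apply: eq_bsum => i j _; ring.
rewrite -!bsumZ -bsumD.
apply: le_trans (ler_norm_sum _ _ _) _; apply: ler_sum => i _.
apply: le_trans (ler_norm_sum _ _ _) _; apply: ler_sum => j _.
set a := s i j; set d := D i j.
have h (x y : R) : `|2 * (x * y)| <= lam * x ^+ 2 + lam^-1 * y ^+ 2.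
  have E : lam * x ^+ 2 + lam^-1 * y ^+ 2 - 2 * (x * y) = lam * (x - lam^-1 * y) ^+ 2.
    by field; exact: lt0r_neq0.
  have E' : lam * x ^+ 2 + lam^-1 * y ^+ 2 + 2 * (x * y) = lam * (x + lam^-1 * y) ^+ 2.
    by field; exact: lt0r_neq0.
  have l0 := ltW lam0.
  rewrite ler_norml -subr_ge0 opprK [X in 0 <= X]addrC E' mulr_ge0 ?sqr_ge0 //=.
  by rewrite -subr_ge0 E mulr_ge0 ?sqr_ge0.
apply: le_trans (h _ _) _.
have : (a - mu) ^+ 2 <= 2 * (a - d) ^+ 2 + 2 * (mu - d) ^+ 2.
  have : 0 <= (a - d - (d - mu)) ^+ 2 by exact: sqr_ge0.
  by rewrite -subr_ge0 => h0; rewrite -subr_ge0; move: h0; rewrite !expr2; lra.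
by move=> /(ler_wpM2l (ltW lam0)); lra.
Qed.

End Estimate.

Section Guarantees.
Variables (R : realType) (n m k : nat) (D : 'M[R]_(n, m)).
Variables (eps Delta alpha beta gamma sigma : R) (s0 : 'M[R]_(n, m)).
Hypotheses (n_gt0 : (0 < n)%N) (m_gt0 : (0 < m)%N) (k_gt0 : (0 < k)%N).
Hypotheses (eps_gt0 : 0 < eps) (eps_lt : eps < 4%:R^-1) (Delta_ge : 18 <= Delta).
Hypothesis approx : Defs.approximation alpha beta k D s0.
Hypothesis gammaE : gamma = (eps / Delta) ^+ 2 / (beta * k%:R).
Hypothesis sigmaE : sigma = loss D (full_rect n m) s0 / alpha.

Lemma betak_ge1 : 1 <= beta * k%:R.
Proof.
have [_ h _ _] := approx; have k1 : 1 <= k%:R :> R by rewrite ler1n.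
by apply: (le_trans k1); rewrite ler_peMl // ltW.
Qed.

Lemma Delta_gt0 : 0 < Delta.
Proof. by apply: lt_le_trans Delta_ge. Qed.

Lemma gamma_gt0 : 0 < gamma.
Proof.
rewrite gammaE divr_gt0 ?exprn_gt0 ?divr_gt0 ?Delta_gt0 //.
exact: lt_le_trans betak_ge1.
Qed.

Lemma gamma_betak : gamma * (beta * k%:R) = (eps / Delta) ^+ 2.
Proof. by rewrite gammaE divfK // lt0r_neq0 //; apply: lt_le_trans betak_ge1. Qed.

(** Here [324 = 18^2], from the lower bound on [Delta]. *)
Lemma eps_Delta : (eps / Delta) ^+ 2 * 324 <= eps ^+ 2.
Proof.
rewrite expr_div_n mulrAC ler_pdivrMr ?exprn_gt0 ?Delta_gt0 //.
rewrite ler_wpM2l ?sqr_ge0 //.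
have D0 := ltW Delta_gt0.
have : 18 ^+ 2 <= Delta ^+ 2 by rewrite ler_sqr ?nnegrE.
by rewrite -natrX.
Qed.

Lemma eps_Delta_small : (eps / Delta) ^+ 2 * 1000 <= 1.
Proof.
have e2 : eps ^+ 2 <= (4%:R^-1) ^+ 2 by rewrite ler_sqr ?nnegrE ?invr_ge0 // ltW.
have := eps_Delta; move: e2; rewrite exprVn -natrX; lra.
Qed.

Lemma sigma_ge0 : 0 <= sigma.
Proof.
by case: approx => a1 _ _ _; rewrite sigmaE divr_ge0 ?loss_ge0 // ltW // (lt_trans _ a1).
Qed.

(** Dividing the loss of [s0] by its approximation factor gives a lower bound for the optimum. *)
Lemma sigma_le_loss s : segmentation k s -> sigma <= loss D (full_rect n m) s.
Proof.
move=> ss; case: (approx) => a1 _ _ le; have a0 : 0 < alpha by exact: lt_trans a1.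
rewrite sigmaE ler_pdivrMr //.
apply: (le_trans le); rewrite mulrC ler_wpM2r ?opt_le //; exact: ltW.
Qed.

Lemma sqr_gamma_ge0 x : 0 <= x -> 0 <= gamma ^+ 2 * x.
Proof. by move=> x0; rewrite mulr_ge0 ?sqr_ge0. Qed.

Lemma gamma_small K : gamma * (2 * K) <= 1 -> 2 * K <= gamma^-1.
Proof. by move=> h; rewrite -div1r ler_pdivlMr ?gamma_gt0 // mulrC. Qed.

Variables (Bs : seq rect).
Hypothesis part : Defs.partition D gamma sigma Bs.

(** Charging to [s0], which has [k' <= beta k] pieces, with every block counted. The four terms of
    [partition_weight] are at most 1/500, 4, 1 and 16/500 times [alpha sigma']. *)
Lemma partition_size : gamma ^+ 2 * (size Bs)%:R <= 6 * alpha.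
Proof.
have [a1 b1 seg0 _] := approx.
set k' := Num.truncn (beta * k%:R) in seg0.
have [L LE] : {L | L = loss D (full_rect n m) s0} by eexists.
have a0 : alpha != 0 by rewrite lt0r_neq0 //; lra.
(* When sigma = 0 any positive number can stand for it: s0 has loss 0, so no
   block has loss exceeding the threshold. *)
have [sigma' [s'0 Lle th]] : exists sigma' : R, [/\ 0 < sigma', L <= alpha * sigma' &
    forall B, gamma ^+ 2 * sigma < loss D B s0 -> gamma ^+ 2 * sigma' <= loss D B s0].
  have := sigma_ge0; rewrite le_eqVlt => /orP[/eqP s00|sp]; last first.
    exists sigma; split=> // [|B]; last exact: ltW.
    by rewrite sigmaE mulrC divfK // LE.
  have L0 : L = 0.
    by move/esym/eqP: s00; rewrite sigmaE -LE mulf_eq0 invr_eq0 (negbTE a0) orbF => /eqP.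
  exists 1; split=> // [|B]; first by rewrite L0; lra.
  have : loss D B s0 <= L.
    rewrite LE; apply: le_loss => i j _.
    by move: (ltn_ord i) (ltn_ord j); rewrite /in_rect /=; lia.
  by rewrite L0 -s00 mulr0; lra.
have g0 := gamma_gt0.
have k'le : k'.+1%:R <= 2 * (beta * k%:R).
  rewrite -natr1; have := betak_ge1 => bk.
  have : k'%:R <= beta * k%:R by rewrite truncn_le //; lra.
  by lra.
(* By [k' + 1 <= 2 beta k], the left factor is at most [2 (eps / Delta)^2], hence at most 2/1000. *)
have gK : gamma * k'.+1%:R * 500 <= 1.
  have := ler_wpM2l (ltW g0) k'le; have := gamma_betak; have := eps_Delta_small; lra.
have gK0 : 0 <= gamma * k'.+1%:R by rewrite mulr_ge0 // ltW.
have th0 : 0 <= gamma ^+ 2 * sigma' by rewrite sqr_gamma_ge0 ?ltW.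
have gk : 2 * k'.+1%:R <= gamma^-1 by apply: gamma_small; lra.
have H := @partition_weight R n m D gamma sigma n_gt0 m_gt0 g0 sigma_ge0 s0 k'
  (gamma ^+ 2 * sigma') (segmentation_grid seg0) th0 th gk size 4
  (ler0n _ _) erefl (@size_cat _) (fun=> leqnn _)
  (fun r e Bs' re nr sl => @slice_rows_size R n m D gamma sigma n_gt0 m_gt0 g0 sigma_ge0 s0 k'
     (gamma ^+ 2 * sigma') (segmentation_grid seg0) th0 th r e Bs' re nr sl)
  Bs part.
move: H; have -> : gamma ^+ 2 * sigma' / gamma = gamma * sigma' by field; exact: lt0r_neq0.
rewrite -LE => H.
have L0 : 0 <= L by rewrite LE loss_ge0.
have h1 : gamma * k'%:R <= gamma * k'.+1%:R by rewrite ler_wpM2l ?ler_nat ?ltW.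
have h2 : (gamma * k'.+1%:R) ^+ 2 <= 1.
  by rewrite expr_le1 //; lra.
have h3 : gamma * k'.+1%:R * 500 * L <= 1 * L by rewrite ler_wpM2r.
have h4 : sigma' * (gamma ^+ 2 * (size Bs)%:R) <= sigma' * (6 * alpha).
  have h5 := ler_wpM2l (ltW s'0) h1.
  have h6 := ler_wpM2l (ltW s'0) h2.
  have h7 : sigma' * 1 <= sigma' * alpha by rewrite ler_wpM2l // ltW.
  have h8 := ler_wpM2l (ltW s'0) gK.
  move: H h6; rewrite !exprMn; lra.
by rewrite -(ler_pM2l s'0).
Qed.

(** Only blocks on which [s] varies are counted, so [kappa = 0]. As
    [gamma (k + 1) <= 2 (eps / Delta)^2] and [sigma] is at most the loss, the remaining terms
    contribute 2, 2 and 32 to the constant. *)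
Lemma nonconstant_size s : segmentation k s ->
  gamma ^+ 2 * sigma * (count (fun B => `[< ~ constant_on s B >]) Bs)%:R
    <= 36 * (eps / Delta) ^+ 2 * loss D (full_rect n m) s.
Proof.
move=> ss; have [a1 b1 _ _] := approx.
have g0 := gamma_gt0.
have k1 : 1 <= k%:R :> R by rewrite ler1n.
have k'le : k.+1%:R <= 2 * (beta * k%:R).
  have : 1 * k%:R <= beta * k%:R by rewrite ler_wpM2r // ltW.
  rewrite -natr1; lra.
have gK : gamma * k.+1%:R <= 2 * (eps / Delta) ^+ 2.
  by have := ler_wpM2l (ltW g0) k'le; have := gamma_betak; lra.
have gK' : gamma * k.+1%:R * 500 <= 1 by have := eps_Delta_small; lra.
have gK0 : 0 <= gamma * k.+1%:R by rewrite mulr_ge0 // ltW.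
have th0 : 0 <= gamma ^+ 2 * sigma by rewrite sqr_gamma_ge0 ?sigma_ge0.
have gk : 2 * k.+1%:R <= gamma^-1 by apply: gamma_small; lra.
have th B : gamma ^+ 2 * sigma < loss D B s -> gamma ^+ 2 * sigma <= loss D B s by exact: ltW.
have H := @partition_weight R n m D gamma sigma n_gt0 m_gt0 g0 sigma_ge0 s k
  (gamma ^+ 2 * sigma) (segmentation_grid ss) th0 th gk
  (count (fun B => `[< ~ constant_on s B >])) 0 (lexx _) erefl (count_cat _) (count_size _) _ Bs part.
have {H} := H _.
have -> : gamma ^+ 2 * sigma / gamma = gamma * sigma by field; exact: lt0r_neq0.
have [L LE] : {L | L = loss D (full_rect n m) s} by eexists.
rewrite -LE => H.
have L0 : 0 <= L by rewrite LE loss_ge0.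
have sL : sigma <= L by rewrite LE sigma_le_loss.
have h1 : gamma * k%:R <= gamma * k.+1%:R by rewrite ler_wpM2l ?ler_nat ?ltW.
have h2 : (gamma * k.+1%:R) ^+ 2 <= gamma * k.+1%:R.
  by rewrite expr2 -[leRHS]mulr1 ler_wpM2l //; lra.
have s0' := sigma_ge0.
have h3 := ler_wpM2l s0' h1; have h4 := ler_wpM2l s0' h2.
have h5 := ler_wpM2r L0 gK; have h6 := ler_wpM2l gK0 sL.
move: h4 H; rewrite exprMn => h4 H; apply: (le_trans (H _)); last by lra.
move=> r e Bs' re nr sl; rewrite mul0r add0r ler_wpM2l // ler_nat.
apply: leqW; exact: (slice_rows_nonconstant n_gt0 m_gt0 (segmentation_grid ss) re nr sl).
Qed.

(** Taking [lam = eps / 4] makes the relative part of the error [eps / 2]. The threshold part has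
    the coefficient [C], with [C eps^2 <= 9 eps / 2], and [36 / 324 = 1 / 9] reduces it to [eps / 2]
    as well; this is where 18 comes from. *)
Lemma estimate_sum s : segmentation k s ->
  `|loss D (full_rect n m) s - \sum_(B <- Bs) estimate D s B|
    <= eps * loss D (full_rect n m) s.
Proof.
move=> ss; have [cov ok] := partition_cover n_gt0 m_gt0 gamma_gt0 sigma_ge0 part.
have lossE : loss D (full_rect n m) s = \sum_(B <- Bs) loss D B s.
  by rewrite lossE -(bsum_cover _ (Bs := Bs)) // => i j; exact: cov.
have lam0 : 0 < eps / 4 by rewrite divr_gt0.
pose C := 2 * (eps / 4) + (eps / 4)^-1.
have C0 : 0 <= C by rewrite addr_ge0 ?mulr_ge0 ?invr_ge0 ?ltW.
have t0 : 0 <= gamma ^+ 2 * sigma by rewrite sqr_gamma_ge0 ?sigma_ge0.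
have blk B : B \in Bs -> `|loss D B s - estimate D s B| <=
    eps / 2 * loss D B s + C * (gamma ^+ 2 * sigma * `[< ~ constant_on s B >]%:R).
  move=> /ok[iB oB]; case: asboolP => [nc|/contrapT c]; last first.
    rewrite estimate_constant // subrr normr0 mulr0 mulr0 addr0.
    by rewrite mulr_ge0 ?loss_ge0 // ltW // divr_gt0.
  apply: le_trans (estimate_error _ _ iB lam0) _.
  rewrite opt1E // in oB; have := ler_wpM2l C0 oB; rewrite /C mulr1; lra.
rewrite lossE -sumrB; apply: le_trans (ler_norm_sum _ _ _) _.
apply: (@le_trans _ _ (\sum_(B <- Bs) (eps / 2 * loss D B s
    + C * (gamma ^+ 2 * sigma * `[< ~ constant_on s B >]%:R)))).
  by rewrite big_seq [leRHS]big_seq; apply: ler_sum.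
have cntE : \sum_(B <- Bs) `[< ~ constant_on s B >]%:R
    = (count (fun B => `[< ~ constant_on s B >]) Bs)%:R :> R.
  elim: (Bs) => [|B Bs' IH]; first by rewrite big_nil.
  by rewrite big_cons /= natrD IH.
rewrite big_split /= -!mulr_sumr -lossE cntE.
have [L LE] : {L | L = loss D (full_rect n m) s} by eexists.
have L0 : 0 <= L by rewrite LE loss_ge0.
have := nonconstant_size ss; rewrite -LE => h.
have h1 := ler_wpM2l C0 h.
have e0 := lt0r_neq0 eps_gt0.
have CE : C * eps ^+ 2 = eps * (eps ^+ 2 / 2 + 4) by rewrite /C; field.
have e1 : C * (eps / Delta) ^+ 2 * 324 <= C * eps ^+ 2.
  by rewrite -mulrA ler_wpM2l // eps_Delta.
have e2 : eps ^+ 2 / 2 + 4 <= 9 / 2.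
  have : eps ^+ 2 <= 1 by rewrite expr_le1 //; have := eps_lt; lra.
  lra.
have e3 := ler_wpM2l (ltW eps_gt0) e2.
have e4 : C * (eps / Delta) ^+ 2 * 36 <= eps / 2 by rewrite CE in e1; lra.
have e5 := ler_wpM2r L0 e4; lra.
Qed.

End Guarantees.

(** * Running times of programs *)

Lemma exec_det (R : realType) (inp : memory R) p st st1 st2 t1 t2 :
  exec inp p st st1 t1 -> exec inp p st st2 t2 -> st1 = st2 /\ t1 = t2.
Proof.
move=> h; elim: h st2 t2 => {p st st1 t1}.
- by move=> st st2 t2 h; inversion h.
- by move=> a e st st2 t2 h; inversion h.
- by move=> a e st st2 t2 h; inversion h.
- move=> p q st st1 st2 t1 t2 _ IH1 _ IH2 st' t' h; inversion h; subst.
  by case: (IH1 _ _ H1) => ? ?; subst; case: (IH2 _ _ H5) => -> ->.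
- move=> b p q st st1 t hb _ IH st' t' h; inversion h; subst.
    by case: (IH _ _ H6) => -> ->.
  by rewrite hb in H5.
- move=> b p q st st1 t hb _ IH st' t' h; inversion h; subst.
    by rewrite H5 in hb.
  by case: (IH _ _ H6) => -> ->.
- move=> b p st st1 st2 t1 t2 hb _ IH1 _ IH2 st' t' h; inversion h; subst.
    match goal with h1 : exec _ p _ _ _, h2 : exec _ (While b p) _ _ _ |- _ =>
      case: (IH1 _ _ h1) => ? ?; subst; first [case: (IH2 _ _ h2) => -> -> //] end.
  by match goal with h1 : is_true (~~ beval _ _ _) |- _ => rewrite hb in h1 end.
- move=> b p st hb st' t' h; inversion h; subst => //.
  by match goal with h1 : is_true (beval _ _ _) |- _ => rewrite h1 in hb end.
Qed.

(** Weakest precondition for total correctness. The exact cost is an argument of the postcondition,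
    so that time bounds are proved together with the results. *)
Definition wp (R : realType) (inp : memory R) (p : cmd) (st : memory R)
    (Q : memory R -> nat -> Prop) : Prop :=
  exists st' t, exec inp p st st' t /\ Q st' t.

Fixpoint loop_free (p : cmd) : bool :=
  match p with
  | Seq p q | If _ p q => loop_free p && loop_free q
  | While _ _ => false
  | _ => true
  end.

(** The value on loops is a placeholder: [exec_loop_free] relates [den] to execution for loop-free
    programs. *)
Fixpoint den (R : realType) (inp : memory R) (p : cmd) (st : memory R) : memory R :=
  match p with
  | IStore a e =>
      Memory (update (icell st) (ieval inp st a) (ieval inp st e)) (rcell st)
  | RStore a e =>
      Memory (icell st) (update (rcell st) (ieval inp st a) (reval inp st e))
  | Seq p q => den inp q (den inp p st)
  | If b p q => if beval inp st b then den inp p st else den inp q st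
  | _ => st
  end.

Fixpoint max_cost (p : cmd) : nat :=
  match p with
  | Skip => 1
  | IStore a e => (icost a + icost e).+1
  | RStore a e => (icost a + rcost e).+1
  | Seq p q => (max_cost p + max_cost q).+1
  | If b p q => (bcost b + (max_cost p + max_cost q)).+1
  | While _ _ => 0
  end.

Section Wp.
Variables (R : realType) (inp : memory R).
Implicit Types (p q : cmd) (st : memory R) (Q : memory R -> nat -> Prop).

Lemma exec_loop_free p st : loop_free p ->
  exists t, exec inp p st (den inp p st) t /\ (t <= max_cost p)%N.
Proof.
elim: p st => //=.
- by move=> st _; exists 1%N; split=> //; constructor.
- by move=> a e st _; eexists; split; [exact: exec_IStore|].
- by move=> a e st _; eexists; split; [exact: exec_RStore|].
- move=> p IHp q IHq st /andP[/(IHp st)[t [h le]] /(IHq (den inp p st))[t' [h' le']]].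
  by exists (t + t').+1; split; [exact: exec_Seq h h'|lia].
- move=> b p IHp q IHq st /andP[/(IHp st)[t [h le]] /(IHq st)[t' [h' le']]].
  case: ifP => hb.
    by exists (bcost b + t).+1; split; [exact: exec_IfTrue|lia].
  by exists (bcost b + t').+1; split; [apply: exec_IfFalse => //; rewrite hb|lia].
Qed.

Lemma wp_loop_free p st Q : loop_free p ->
  (forall t, (t <= max_cost p)%N -> Q (den inp p st) t) -> wp inp p st Q.
Proof.
by move=> /(exec_loop_free st)[t [h le]] hQ; exists (den inp p st), t; split; auto.
Qed.

Lemma wp_conseq p st Q Q' : wp inp p st Q -> (forall st' t, Q st' t -> Q' st' t) ->
  wp inp p st Q'.
Proof. by move=> [st' [t [h hQ]]] QQ'; exists st', t; split; auto. Qed.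

Lemma wp_seq p q st Q :
  wp inp p st (fun st1 t1 => wp inp q st1 (fun st2 t2 => Q st2 (t1 + t2).+1)) ->
  wp inp (Seq p q) st Q.
Proof.
move=> [st1 [t1 [h1 [st2 [t2 [h2 hQ]]]]]].
by exists st2, (t1 + t2).+1; split=> //; exact: exec_Seq h1 h2.
Qed.

Lemma wp_if b p q st Q :
  (beval inp st b -> wp inp p st (fun st' t => Q st' (bcost b + t).+1)) ->
  (~~ beval inp st b -> wp inp q st (fun st' t => Q st' (bcost b + t).+1)) ->
  wp inp (If b p q) st Q.
Proof.
move=> hp hq; have [hb|hb] := boolP (beval inp st b).
  have [st' [t [h hQ]]] := hp hb; exists st', (bcost b + t).+1.
  by split=> //; exact: exec_IfTrue.
have [st' [t [h hQ]]] := hq hb; exists st', (bcost b + t).+1.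
by split=> //; exact: exec_IfFalse.
Qed.

(** Potential method: [Phi] pays for each guard and body, and the strict inequality pays the unit
    charged for an iteration. Its decrease also gives termination. *)
Lemma wp_while b p (Inv : memory R -> Prop) (Phi : memory R -> nat) st Q :
  Inv st ->
  (forall st, Inv st -> beval inp st b ->
     wp inp p st (fun st' t => Inv st' /\ (bcost b + t + Phi st' < Phi st)%N)) ->
  (forall st' t, Inv st' -> ~~ beval inp st' b ->
     (t + Phi st' <= Phi st + (bcost b).+1)%N -> Q st' t) ->
  wp inp (While b p) st Q.
Proof.
move=> h0 hb hQ; have [k] := ubnP (Phi st).
elim: k st Q h0 hQ => // k IH st Q h0 hQ hk.
have [b1|b0] := boolP (beval inp st b); last first.
  by exists st, (bcost b).+1; split; [exact: exec_WhileFalse|apply: hQ => //; lia].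
have [st1 [t1 [e1 [h1 lt1]]]] := hb st h0 b1.
have [| |st2 [t2 [e2 hQ2]]] := IH st1 (fun st2 t2 => Q st2 (bcost b + t1 + t2).+1) h1.
- by move=> st' t i' nb le; apply: hQ => //; lia.
- by lia.
- by exists st2, (bcost b + t1 + t2).+1; split; first exact: exec_WhileTrue e1 e2.
Qed.

End Wp.

#[global] Arguments update [T] f a v x : simpl nomatch.

#[global] Arguments max_cost : simpl never.
#[global] Arguments bcost : simpl never.

Lemma update_eq T (f : nat -> T) a v : update f a v a = v.
Proof. by rewrite /update eqxx. Qed.

Lemma update_neq T (f : nat -> T) a v x : x <> a -> update f a v x = f x.
Proof. by rewrite /update; case: eqP. Qed.

(** An advancing counter frees at least one [K], even if it jumps beyond [X]. *)
Lemma potential_step X b b' K : (b < b')%N -> (b < X)%N ->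
  (K + (X - b') * K <= (X - b) * K)%N.
Proof. by move=> h1 h2; rewrite -mulSn leq_mul2r; apply/orP; right; lia. Qed.

(** * Abbreviations for programs and their symbolic execution *)

Definition ir c := ILoad (IConst c).
Definition rr c := RLoad (IConst c).
Definition iset c e := IStore (IConst c) e.
Definition rset c e := RStore (IConst c) e.
Fixpoint seqs (ps : seq cmd) : cmd :=
  match ps with
  | [::] => Skip
  | [:: p] => p
  | p :: ps => Seq p (seqs ps)
  end.
Definition BLtI e1 e2 := BLeI (IAdd e1 (IConst 1)) e2.

Definition rmin c e := If (BLeR (rr c) e) Skip (rset c e).
Definition rmax c e := If (BLeR e (rr c)) Skip (rset c e).

Lemma update_id T (f : nat -> T) a : update f a (f a) = f.
Proof. by apply/funext => x; rewrite /update; case: eqP => // ->. Qed.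

Lemma den_rmin (R : realType) (inp : memory R) f g c e :
  den inp (rmin c e) (Memory f g)
  = Memory f (update g c (Num.min (g c) (reval inp (Memory f g) e))).
Proof. by rewrite /=; case: leP => // _; rewrite update_id. Qed.

Lemma den_rmax (R : realType) (inp : memory R) f g c e :
  den inp (rmax c e) (Memory f g)
  = Memory f (update g c (Num.max (g c) (reval inp (Memory f g) e))).
Proof. by rewrite /= maxC; case: leP => // _; rewrite update_id. Qed.

(* Symbolic execution of straight-line programs: every stored value gets a name, as
   substituting the values makes terms exponentially large. *)
Ltac den_run E :=
  lazymatch type of E with
  | context [den ?inp ?p (@Memory ?R ?f ?g)] =>
    lazymatch p with
    | rmin ?c ?e =>
        let w := eval simpl in (Num.min (g c) (reval inp (Memory f g) e)) in
        let v := fresh "v" in pose v : R := w;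
        rewrite den_rmin in E;
        change (Num.min (g c) (reval inp (Memory f g) e)) with v in E; den_run E
    | rmax ?c ?e =>
        let w := eval simpl in (Num.max (g c) (reval inp (Memory f g) e)) in
        let v := fresh "v" in pose v : R := w;
        rewrite den_rmax in E;
        change (Num.max (g c) (reval inp (Memory f g) e)) with v in E; den_run E
    | _ =>
    lazymatch eval hnf in p with
    | Skip => change (den inp p (Memory f g)) with (Memory f g) in E; den_run E
    | Seq ?a ?b =>
        change (den inp p (Memory f g)) with (den inp b (den inp a (Memory f g))) in E;
        den_run E
    | IStore ?a ?e =>
        let k := eval simpl in (ieval inp (Memory f g) a) in
        let w := eval simpl in (ieval inp (Memory f g) e) in
        let v := fresh "v" in pose v : nat := w;
        change (den inp p (Memory f g)) with (Memory (update f k v) g) in E; den_run E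
    | RStore ?a ?e =>
        let k := eval simpl in (ieval inp (Memory f g) a) in
        let w := eval simpl in (reval inp (Memory f g) e) in
        let v := fresh "v" in pose v : R := w;
        change (den inp p (Memory f g)) with (Memory f (update g k v)) in E; den_run E
    | _ => idtac
    end end
  | _ => idtac
  end.

(** * Evaluation of a segmentation on a coreset *)

Lemma nth_flatten_uniform (T : Type) (x0 : T) (ss : seq (seq T)) d q u :
  all (fun s => size s == d) ss -> (q < size ss)%N -> (u < d)%N ->
  nth x0 (flatten ss) (q * d + u) = nth x0 (nth [::] ss q) u.
Proof.
elim: ss q => // s ss IH q /= /andP[/eqP sd ssd] hq hu; rewrite nth_cat sd.
case: q hq => [|q] hq /=; first by rewrite mul0n add0n hu.
rewrite ifF; last by rewrite mulSn; lia.
by rewrite mulSn -IH //; congr nth; lia.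
Qed.

Lemma size_flatten_uniform (T : Type) (ss : seq (seq T)) d :
  all (fun s => size s == d) ss -> size (flatten ss) = (size ss * d)%N.
Proof.
by elim: ss => //= s ss IH /andP[/eqP sd /IH]; rewrite size_cat sd mulSn => ->.
Qed.

Definition inter (B B' : rect) : rect :=
  ((maxn B.1.1 B'.1.1, minn B.1.2 B'.1.2), (maxn B.2.1 B'.2.1, minn B.2.2 B'.2.2)).

Lemma in_inter B B' i j : in_rect (inter B B') i j = in_rect B i j && in_rect B' i j.
Proof. by rewrite /in_rect /inter /=; lia. Qed.

(** Each cell lies in exactly one piece, so the indicators of the pieces add up to 1; inserting this
    sum and exchanging groups the cells by pieces. *)
Lemma seg_code_bsum (R : realType) n m k (s : 'M[R]_(n, m)) c (g : R -> R) B :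
  seg_code k s c ->
  bsum (fun i j => g (s i j)) B = \sum_(p <- c) area R n m (inter B p.1) * g p.2.
Proof.
case=> _ hc; transitivity (\sum_(p <- c) \sum_(i < n) \sum_(j < m)
    (in_rect (inter B p.1) i j)%:R * g p.2); last first.
  apply: eq_bigr => p _; rewrite /area bsumE mulr_suml; apply: eq_bigr => i _.
  by rewrite mulr_suml; apply: eq_bigr => j _; rewrite mulr1.
rewrite exchange_big bsumE; apply: eq_bigr => i _.
rewrite exchange_big; apply: eq_bigr => j _.
have [cnt val] := hc i j.
transitivity (\sum_(p <- c) (in_rect B i j)%:R * g (s i j) * (in_rect p.1 i j)%:R).
  rewrite -mulr_sumr; have -> : \sum_(p <- c) (in_rect p.1 i j)%:R = 1 :> R.
    rewrite -natr_sum -[RHS]/(1%:R) -cnt; congr _%:R.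
    by elim: (c) => [|p c' IH]; rewrite ?big_nil // big_cons IH.
  by rewrite mulr1.
rewrite big_seq [RHS]big_seq; apply: eq_bigr => p pc; rewrite in_inter.
have := val p pc; case: (in_rect p.1 i j) => [/(_ isT) ->|_].
  by rewrite andbT mulr1.
by rewrite andbF mulr0 mul0r.
Qed.

Definition inp_at r d := RInput (IAdd (ir r) (IConst d)).

(* The integer registers 0 and 1 point to the data of a block and of a piece. *)
Definition piece_step : cmd := seqs [::
  rset 5 (inp_at 0 12); rmin 5 (inp_at 1 1);
  rset 6 (inp_at 0 0); rmax 6 (inp_at 1 0);
  rset 5 (RSub (RAdd (rr 5) (ROfInt (IConst 1))) (rr 6)); rmax 5 (ROfInt (IConst 0));
  rset 7 (inp_at 0 13); rmin 7 (inp_at 1 3);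
  rset 6 (inp_at 0 1); rmax 6 (inp_at 1 2);
  rset 7 (RSub (RAdd (rr 7) (ROfInt (IConst 1))) (rr 6)); rmax 7 (ROfInt (IConst 0));
  rset 6 (RSub (inp_at 1 4) (rr 4));
  rset 0 (RAdd (rr 0) (RMul (RMul (rr 5) (rr 7)) (RMul (rr 6) (rr 6))));
  iset 1 (IAdd (ir 1) (IConst 5))].

(** An encoded point has four cells, so 0, 4, 8 and 12 are the offsets of the points of a block;
    label and weight sit at 2 and 3 beyond them. *)
Definition moment (f : nat -> rexp) :=
  RAdd (RAdd (f 0%N) (f 4%N)) (RAdd (f 8%N) (f 12%N)).

Definition block_init : cmd := seqs [::
  rset 1 (moment (fun d => inp_at 0 (d + 3)));
  rset 2 (moment (fun d => RMul (inp_at 0 (d + 3)) (inp_at 0 (d + 2))));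
  rset 3 (moment (fun d => RMul (inp_at 0 (d + 3)) (RMul (inp_at 0 (d + 2)) (inp_at 0 (d + 2)))));
  rset 4 (RDiv (rr 2) (rr 1));
  rset 0 (RAdd (rr 0) (RSub (rr 3) (RDiv (RMul (rr 2) (rr 2)) (rr 1))));
  iset 1 (IMul (IConst 4) (IInput (IConst 0)))].

Definition piece_guard := BLtI (ir 1)
  (IAdd (IMul (IConst 4) (IInput (IConst 0))) (IMul (IConst 5) (IInput (IConst 1)))).
Definition block_guard := BLtI (ir 0) (IMul (IConst 4) (IInput (IConst 0))).

Definition fitting_loss : cmd :=
  While block_guard (Seq block_init (Seq (While piece_guard piece_step)
    (iset 0 (IAdd (ir 0) (IConst 16))))).

(** Length of the intersection of two integer intervals, in real arithmetic because coordinates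
    arrive in real cells. The maximum with 0 covers disjoint intervals and empty pieces. *)
Definition overlap (R : realType) (a b a' b' : R) : R :=
  Num.max (Num.min b b' + 1 - Num.max a a') 0.

Lemma natr_overlap (R : realType) (a b a' b' : nat) :
  overlap a%:R b%:R a'%:R b'%:R = ((minn b b').+1 - maxn a a')%:R :> R.
Proof.
rewrite /overlap.
have -> : Num.min b%:R b'%:R = (minn b b')%:R :> R.
  by rewrite /minn; case: ltnP => h; [rewrite min_l // ler_nat ltnW|rewrite min_r // ler_nat].
have -> : Num.max a%:R a'%:R = (maxn a a')%:R :> R.
  by rewrite /maxn; case: ltnP => h; [rewrite max_r // ler_nat ltnW|rewrite max_l // ler_nat].
rewrite natr1; case: (leqP (maxn a a') (minn b b').+1) => h.
  by rewrite natrB // max_l // subr_ge0 ler_nat.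
rewrite max_r; last by rewrite subr_le0 ler_nat ltnW.
by move/ltnW: h; rewrite -subn_eq0 => /eqP ->.
Qed.

Lemma den_piece_step (R : realType) (inp st : memory R) :
  let b := icell st 0 in let x := icell st 1 in let I := rcell inp in
  let st' := den inp piece_step st in
  [/\ icell st' 0 = b, icell st' 1 = (x + 5)%N, rcell st' 4 = rcell st 4 &
    rcell st' 0 = rcell st 0 + overlap (I (b + 0)%N) (I (b + 12)%N) (I (x + 0)%N) (I (x + 1)%N)
      * overlap (I (b + 1)%N) (I (b + 13)%N) (I (x + 2)%N) (I (x + 3)%N)
      * ((I (x + 4)%N - rcell st 4) * (I (x + 4)%N - rcell st 4))].
Proof.
case: st => f g b x I st'; have [st1 E] : {s | s = st'} by exists st'.
by rewrite -E; rewrite /st' in E; den_run E; rewrite E /=; split.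
Qed.

Lemma den_block_init (R : realType) (inp st : memory R) :
  let b := icell st 0 in let I := rcell inp in
  let u t := I (b + (4 * t + 3))%N in let y t := I (b + (4 * t + 2))%N in
  let M0 := u 0 + u 1 + (u 2 + u 3) in
  let M1 := u 0 * y 0 + u 1 * y 1 + (u 2 * y 2 + u 3 * y 3) in
  let M2 := u 0 * (y 0 * y 0) + u 1 * (y 1 * y 1) + (u 2 * (y 2 * y 2) + u 3 * (y 3 * y 3)) in
  let st' := den inp block_init st in
  [/\ icell st' 0 = b, icell st' 1 = (4 * icell inp 0)%N, rcell st' 4 = M1 / M0 &
    rcell st' 0 = rcell st 0 + (M2 - M1 * M1 / M0)].
Proof.
case: st => f g b I u y M0 M1 M2 st'; have [st1 E] : {s | s = st'} by exists st'.
by rewrite -E; rewrite /st' in E; den_run E; rewrite E /=; split.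
Qed.

(** In this storage order the first corner holds the lower bounds of [B] and the last corner the
    upper bounds, which is how [piece_step] recovers the rectangle from offsets 0, 1, 12 and 13. *)
Lemma block_coreset_points (R : realType) n m (D : 'M[R]_(n, m)) B P :
  block_coreset D B P -> exists y0 y1 y2 y3 u0 u1 u2 u3 : R,
  [/\ P = [:: (B.1.1, B.2.1, y0, u0); (B.1.1, B.2.2, y1, u1);
              (B.1.2, B.2.1, y2, u2); (B.1.2, B.2.2, y3, u3)],
      u0 + u1 + (u2 + u3) = area R n m B,
      u0 * y0 + u1 * y1 + (u2 * y2 + u3 * y3) = bsum (fun i j => D i j) B &
      u0 * (y0 * y0) + u1 * (y1 * y1) + (u2 * (y2 * y2) + u3 * (y3 * y3))
        = bsum (fun i j => D i j ^+ 2) B].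
Proof.
case=> x [u [_ _ [m1 m2 m0] ->]]; pose t1 : 'I_4 := lift ord0 ord0.
pose t2 : 'I_4 := lift ord0 (lift ord0 ord0).
pose t3 : 'I_4 := lift ord0 (lift ord0 (lift ord0 ord0)).
pose y t := D (x t).1 (x t).2.
exists (y ord0), (y t1), (y t2), (y t3), (u ord0), (u t1), (u t2), (u t3).
have sum4 (F : 'I_4 -> R) : \sum_(t < 4) F t = F ord0 + F t1 + (F t2 + F t3).
  by rewrite !big_ord_recl big_ord0 addr0 !addrA.
split; [|by rewrite -sum4 m0|by rewrite -[RHS]m1 sum4|].
  have -> : enum 'I_4 = [:: ord0; t1; t2; t3].
    by apply: (inj_map val_inj); rewrite val_enum_ord.
  by rewrite /= !(tnth_nth (0%N, 0%N)).
by rewrite -[RHS]m2 sum4 !expr2.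
Qed.

(** The block pointer runs through [4 N] cells in steps of 16. Each step needs one [Kb], so [4 N]
    copies are ample; likewise 5 cells per piece. *)
Definition fitting_loss_time (N k : nat) : nat :=
  let Kp := (bcost piece_guard + max_cost piece_step).+1 in
  let Kb := (bcost block_guard + max_cost block_init + bcost piece_guard + 20 + 5 * k * Kp)%N in
  (4 * N * Kb + (bcost block_guard).+1)%N.

Section FittingLoss.
Variables (R : realType) (n m k : nat) (D s : 'M[R]_(n, m)).
Variables (Bs : seq rect) (CB : rect -> seq (wpoint R)) (c : seq (rect * R)).
Variable inp : memory R.
Let C := flatten [seq CB B | B <- Bs].
Hypothesis Bs_inside : forall B, B \in Bs -> inside n m B.
Hypothesis Bs_coreset : forall B, B \in Bs -> block_coreset D B (CB B).
Hypothesis c_code : seg_code k s c.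
Hypothesis inp_int : holds 0%N (icell inp) 0 [:: size C; k].
Hypothesis inp_real : holds 0 (rcell inp) 0 (points_data C ++ code_data c).

Lemma size_block_coreset B : B \in Bs -> size (CB B) = 4%N.
Proof. by move=> /Bs_coreset[x [u [_ _ _ ->]]]; rewrite size_map size_enum_ord. Qed.

Lemma size_coreset_list : size C = (size Bs * 4)%N.
Proof.
rewrite /C (@size_flatten_uniform _ _ 4) ?size_map //.
by apply/allP => _ /mapP[B hB ->]; rewrite size_block_coreset.
Qed.

Lemma points_dataE : points_data C = flatten [seq points_data (CB B) | B <- Bs].
Proof.
rewrite /C; elim: (Bs) => //= B Bs' IH.
by rewrite -IH /points_data map_cat flatten_cat.
Qed.

Lemma size_points_data (P : seq (wpoint R)) : size (points_data P) = (4 * size P)%N.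
Proof.
rewrite /points_data (@size_flatten_uniform _ _ 4); first by rewrite size_map mulnC.
by apply/allP => _ /mapP[p _ ->].
Qed.

Lemma size_code : size c = k.
Proof. by case: c_code. Qed.

Lemma size_code_data : size (code_data c) = (5 * k)%N.
Proof.
case: c_code => <- _; rewrite /code_data (@size_flatten_uniform _ _ 5).
  by rewrite size_map mulnC.
by apply/allP => _ /mapP[p _ ->].
Qed.

Lemma input_point q t B0 : (q < size Bs)%N -> (t < 16)%N ->
  rcell inp (16 * q + t) = nth 0 (points_data (CB (nth B0 Bs q))) t.
Proof.
move=> hq ht; have := inp_real (l := (16 * q + t)%N); rewrite add0n => ->; last first.
  by rewrite size_cat size_points_data size_coreset_list; lia.
rewrite nth_cat size_points_data size_coreset_list ifT; last by lia.
rewrite points_dataE mulnC nth_flatten_uniform ?size_map //.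
  by rewrite (nth_map B0).
by apply/allP => _ /mapP[B hB ->]; rewrite size_points_data size_block_coreset.
Qed.

Lemma input_piece l t p0 : (l < k)%N -> (t < 5)%N ->
  rcell inp (4 * size C + 5 * l + t)
  = nth 0 (let p := nth p0 c l in
      [:: p.1.1.1%:R; p.1.1.2%:R; p.1.2.1%:R; p.1.2.2%:R; p.2]) t.
Proof.
move=> hl ht; have [sc _] := c_code.
have := inp_real (l := (4 * size C + 5 * l + t)%N); rewrite add0n => ->; last first.
  by rewrite size_cat size_points_data size_code_data; lia.
rewrite nth_cat size_points_data ifF; last by lia.
have -> : (4 * size C + 5 * l + t - 4 * size C = l * 5 + t)%N by lia.
rewrite /code_data nth_flatten_uniform ?size_map ?sc //.
  by rewrite (nth_map p0) ?sc.
by apply/allP => _ /mapP[p _ ->].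
Qed.

Definition piece_term B (mu : R) (p : rect * R) : R :=
  area R n m (inter B p.1) * (p.2 - mu) ^+ 2.

(** The outer loop adds the variation of a block, the inner one the area of its intersection with
    each piece times the squared distance from the mean. The same formula serves all blocks, being
    exact where [s] is constant. *)
Lemma fitting_loss_wp :
  wp inp fitting_loss (empty_memory R) (fun out t =>
    rcell out 0 = \sum_(B <- Bs) estimate D s B /\ (t <= fitting_loss_time (size C) k)%N).
Proof.
have sC := size_coreset_list.
have i0 : icell inp 0 = size C by exact: (inp_int (l := 0%N)).
have i1 : icell inp 1 = k by exact: (inp_int (l := 1%N)).
pose B0 : rect := ((0, 0), (0, 0))%N.
pose Kp := (bcost piece_guard + max_cost piece_step).+1.
pose Kb := (bcost block_guard + max_cost block_init + bcost piece_guard + 20 + 5 * k * Kp)%N.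
apply: (wp_while (Inv := fun st => exists2 q, (q <= size Bs)%N &
    icell st 0 = (16 * q)%N /\ rcell st 0 = \sum_(B <- take q Bs) estimate D s B)
  (Phi := fun st => ((4 * size C - icell st 0) * Kb)%N)).
- by exists 0%N => //; split; rewrite // take0 big_nil.
- move=> st [q qle [st0 st1]] guard.
  have hq : (q < size Bs)%N by move: guard; rewrite /= i0 st0 sC; lia.
  have BBs : nth B0 Bs q \in Bs by rewrite mem_nth.
  set B := nth B0 Bs q in BBs.
  have iB := Bs_inside BBs.
  have [y0 [y1 [y2 [y3 [u0 [u1 [u2 [u3 [CBE m0 m1 m2]]]]]]]]] :=
    block_coreset_points (Bs_coreset BBs).
  have dat t : (t < 16)%N -> rcell inp (16 * q + t) = nth 0 (points_data (CB B)) t.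
    by move=> ht; rewrite (input_point B0).
  apply: wp_seq; apply: wp_loop_free => // t1 ht1.
  have := den_block_init inp st; case: (den inp block_init st) => f g /=.
  rewrite st0 !dat // CBE /= i0 m0 m1 m2 => -[f0 f1 g4 g0].
  apply: wp_seq.
  pose mu := mean D B.
  pose p0 : rect * R := (B0, 0).
  apply: (wp_while (Inv := fun st => exists2 l, (l <= k)%N &
    [/\ icell st 0 = (16 * q)%N, icell st 1 = (4 * size C + 5 * l)%N, rcell st 4 = mu &
      rcell st 0 = \sum_(B <- take q Bs) estimate D s B + vari D B
                   + \sum_(p <- take l c) piece_term B mu p])
    (Phi := fun st => ((4 * size C + 5 * k - icell st 1) * Kp)%N)).
  + exists 0%N => //; split=> //=; first by rewrite f1; lia.
    rewrite g0 st1 take0 big_nil addr0; congr (_ + _).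
  + move=> st' [l lle [a0 a1 a4 b0]] guard'.
    have hl : (l < k)%N by move: guard'; rewrite /= i0 i1 a1; lia.
    apply: wp_loop_free => // t ht.
    have := den_piece_step inp st'; case: (den inp piece_step st') => f2 g2 /=.
    rewrite a0 a1 a4 b0 !dat // !(input_piece p0) // CBE /= => -[c0 c1 c4 d0].
    split; last first.
      have := @potential_step (4 * size C + 5 * k) (4 * size C + 5 * l)
        (4 * size C + 5 * l + 5) Kp ltac:(lia) ltac:(lia).
      by move: ht; rewrite c1 {1}/Kp; lia.
    exists l.+1 => //; split=> //; first by rewrite c1; lia.
    rewrite d0 (take_nth p0); last by case: c_code => ->.
    rewrite -cats1 big_cat big_seq1 [RHS]addrA; congr (_ + _).
    rewrite !natr_overlap /piece_term areaE; last 2 first.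
    * by move: iB; rewrite /inside /inter /=; lia.
    * by move: iB; rewrite /inside /inter /=; lia.
    by rewrite natrM expr2.
  + move=> st' t [l lle [a0 a1 a4 b0]] guard' ht.
    have lk : l = k by move: guard'; rewrite /= i0 i1 a1; lia.
    apply: wp_loop_free => // t' ht' /=; rewrite a0; split; last first.
      have := @potential_step (4 * size C) (16 * q) (16 * q + 16) Kb ltac:(lia) ltac:(lia).
      move: ht ht'; rewrite /max_cost /= f1 a1 lk subnn mul0n addn0 addKn {1}/Kb update_eq; lia.
    exists q.+1 => //; split; first by rewrite update_eq; lia.
    rewrite b0 lk -{1}size_code take_size (take_nth B0) // -cats1 big_cat big_seq1 /=.
    rewrite -addrA /estimate; congr (_ + (_ + _)).
    by rewrite (seg_code_bsum (fun v => (v - mean D B) ^+ 2) B c_code).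
- move=> st t [q qle [st0 st1]] guard ht.
  have qE : q = size Bs by move: guard; rewrite /= i0 st0 sC; lia.
  rewrite st1 qE take_size; split=> //.
  by apply: leq_trans (leq_trans (leq_addr _ _) ht) _; rewrite subn0.
Qed.
End FittingLoss.

(** * Partition in linear time *)

Section PrefixSums.
Variables (R : realType) (n m : nat) (f : 'I_n -> 'I_m -> R).

(** The comparisons are strict, so that row 0 and column 0 of the table form a border of zeros. *)
Definition pref (i j : nat) : R :=
  \sum_(i' < n) \sum_(j' < m) ((i' < i) && (j' < j))%N%:R * f i' j'.

Lemma pref0l j : pref 0 j = 0.
Proof. by rewrite /pref big1 // => i' _; rewrite big1 // => j' _; rewrite mul0r. Qed.

Lemma pref0r i : pref i 0 = 0.
Proof.
by rewrite /pref big1 // => i' _; rewrite big1 // => j' _; rewrite andbF mul0r.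
Qed.

(** Inclusion-exclusion on indicators: that of a half-open interval is a difference of two initial
    ones, and the product of two such differences has four terms. *)
Lemma bsum_pref r e c c' : (r <= e.+1)%N -> (c <= c'.+1)%N ->
  bsum f ((r, e), (c, c')) = pref e.+1 c'.+1 - pref r c'.+1 - pref e.+1 c + pref r c.
Proof.
move=> re cc; rewrite bsumE /pref -!sumrB -big_split; apply: eq_bigr => i _ /=.
rewrite -!sumrB -big_split; apply: eq_bigr => j _ /=.
have ind (a b x : nat) : (a <= b)%N -> ((a <= x) && (x < b))%N%:R = (x < b)%N%:R - (x < a)%N%:R :> R.
  by move=> ab; case: (ltnP x a) (ltnP x b) => h [] h' //=; rewrite ?subrr ?subr0 //; lia.
have -> : in_rect (r, e, (c, c')) i j = (r <= i < e.+1)%N && (c <= j < c'.+1)%N.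
  by rewrite /in_rect /=; lia.
have nb (a b : bool) : (a && b)%:R = a%:R * b%:R :> R by rewrite -natrM mulnb.
by rewrite (nb (r <= i < e.+1)%N) !ind // !nb; ring.
Qed.

Lemma bsum_cell (i : 'I_n) (j : 'I_m) : bsum f ((i : nat, i : nat), (j : nat, j : nat)) = f i j.
Proof.
rewrite /bsum (bigD1 i) //= [X in _ + X]big1 => [|i' ni]; last first.
  apply: big_pred0 => j'; rewrite /in_rect /=; apply/negP => h; case/negP: ni.
  by apply/eqP/val_inj => /=; lia.
rewrite addr0 (bigD1 j) /=; last by rewrite /in_rect /=; lia.
rewrite big1 ?addr0 // => j' /andP[h nj]; case/negP: nj.
by apply/eqP/val_inj => /=; move: h; rewrite /in_rect /=; lia.
Qed.

Lemma prefS (i : 'I_n) (j : 'I_m) :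
  pref i.+1 j.+1 = pref i j.+1 + pref i.+1 j - pref i j + f i j.
Proof.
rewrite -bsum_cell bsum_pref //; ring.
Qed.

End PrefixSums.

(* Memory layout. Real cells: registers below 16, with the threshold gamma^2 sigma in 0
   and 1 / gamma in 1 while the partition is computed; prefix sums of D and D^2 from 16;
   then the points of the coreset. Integer cells: registers below 32; the pair 32 + 2 j,
   33 + 2 j describes column j of the current slab; the rectangles of the partition
   follow from 32 + 2 m. *)
Definition nI := IInput (IConst 0).
Definition mI := IInput (IConst 1).
(** The tables of [D] and of its squares are interleaved, and each row includes the border entry. *)
Definition tab_index (m i j : nat) : nat := (16 + 2 * (i * m.+1 + j))%N.
Definition tab_addr i j :=
  IAdd (IConst 16) (IMul (IConst 2) (IAdd (IMul i (IAdd mI (IConst 1))) j)).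
Definition tab1 i j := RLoad (tab_addr i j).
Definition tab2 i j := RLoad (IAdd (tab_addr i j) (IConst 1)).
Definition isucc e := IAdd e (IConst 1).
Definition rect_sum (T : iexp -> iexp -> rexp) r e c f :=
  RAdd (RSub (RSub (T (isucc e) (isucc f)) (T r (isucc f))) (T (isucc e) c)) (T r c).
Definition rect_area r e c f := ROfInt (IMul (ISub (isucc e) r) (ISub (isucc f) c)).
Definition rect_vari r e c f :=
  RSub (rect_sum tab2 r e c f)
    (RDiv (RMul (rect_sum tab1 r e c f) (rect_sum tab1 r e c f)) (rect_area r e c f)).
Definition fits r e c f := BLeR (rect_vari r e c f) (rr 0).

Definition tables (R : realType) n m (D : 'M[R]_(n, m)) (g : nat -> R) : Prop :=
  forall i j, (i <= n)%N -> (j <= m)%N ->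
    g (tab_index m i j) = pref (fun i j => D i j) i j /\
    g (tab_index m i j).+1 = pref (fun i j => D i j ^+ 2) i j.

Section Tables.
Variables (R : realType) (n m : nat) (D : 'M[R]_(n, m)) (inp : memory R).
Hypothesis inp_m : icell inp 1 = m.

Lemma ieval_tab_addr st i j :
  ieval inp st (tab_addr i j) = tab_index m (ieval inp st i) (ieval inp st j).
Proof. by rewrite /= inp_m addn1. Qed.

Lemma reval_rect_sum st r e c f : tables D (rcell st) ->
  inside n m ((ieval inp st r, ieval inp st e), (ieval inp st c, ieval inp st f)) ->
  let B := ((ieval inp st r, ieval inp st e), (ieval inp st c, ieval inp st f)) in
  reval inp st (rect_sum tab1 r e c f) = bsum (fun i j => D i j) B /\
  reval inp st (rect_sum tab2 r e c f) = bsum (fun i j => D i j ^+ 2) B.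
Proof.
move=> T iB B; rewrite /B !bsum_pref; try by move: iB; rewrite /inside /=; lia.
have t1 i j : (ieval inp st i <= n)%N -> (ieval inp st j <= m)%N ->
    reval inp st (tab1 i j) = pref (fun i j => D i j) (ieval inp st i) (ieval inp st j).
  by move=> hi hj; have [<- _] := T _ _ hi hj; rewrite -ieval_tab_addr.
have t2 i j : (ieval inp st i <= n)%N -> (ieval inp st j <= m)%N ->
    reval inp st (tab2 i j) = pref (fun i j => D i j ^+ 2) (ieval inp st i) (ieval inp st j).
  by move=> hi hj; have [_ <-] := T _ _ hi hj; rewrite -ieval_tab_addr /= addn1.
have E x : ieval inp st (isucc x) = (ieval inp st x).+1 by rewrite /= addn1.
have [h1 h2 h3 h4] : [/\ (ieval inp st e < n)%N, (ieval inp st f < m)%N,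
    (ieval inp st r <= n)%N & (ieval inp st c <= m)%N].
  by split; move: iB; rewrite /inside /=; lia.
have S U : reval inp st (rect_sum U r e c f) = reval inp st (U (isucc e) (isucc f))
    - reval inp st (U r (isucc f)) - reval inp st (U (isucc e) c) + reval inp st (U r c).
  by [].
by split; rewrite S ?t1 ?t2 ?E // ltnW.
Qed.

Lemma reval_rect_area st r e c f :
  inside n m ((ieval inp st r, ieval inp st e), (ieval inp st c, ieval inp st f)) ->
  reval inp st (rect_area r e c f)
  = area R n m ((ieval inp st r, ieval inp st e), (ieval inp st c, ieval inp st f)).
Proof.
move=> iB; rewrite areaE; try by move: iB; rewrite /inside /=; lia.
by rewrite /= !addn1.
Qed.

Lemma beval_fits st r e c f : tables D (rcell st) ->
  inside n m ((ieval inp st r, ieval inp st e), (ieval inp st c, ieval inp st f)) ->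
  beval inp st (fits r e c f)
  = (opt D 1 ((ieval inp st r, ieval inp st e), (ieval inp st c, ieval inp st f))
     <= rcell st 0).
Proof.
move=> T iB; rewrite opt1E //; have [s1 s2] := reval_rect_sum T iB.
rewrite /fits /rect_vari; set S1 := rect_sum tab1 _ _ _ _ in s1 *.
set S2 := rect_sum _ _ _ _ _ in s2 *; set A := rect_area _ _ _ _.
transitivity (reval inp st S2 - reval inp st S1 * reval inp st S1 / reval inp st A <= rcell st 0).
  by [].
by rewrite s1 s2 (reval_rect_area iB) -expr2.
Qed.

Lemma fitsE (tau : R) st r e c f vr ve vc vf : tables D (rcell st) -> rcell st 0 = tau ->
  ieval inp st r = vr -> ieval inp st e = ve -> ieval inp st c = vc -> ieval inp st f = vf ->
  inside n m ((vr, ve), (vc, vf)) ->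
  beval inp st (fits r e c f) = (opt D 1 ((vr, ve), (vc, vf)) <= tau).
Proof. by move=> T <- <- <- <- <- iB; exact: beval_fits. Qed.

End Tables.

#[global] Arguments fits : simpl never.

Definition grow fr hi test := While
  (BAnd (BLeI (isucc (ir fr)) hi) test) (iset fr (isucc (ir fr))).
(** Register 0 stands for any register, as the cost of an expression does not depend on its
    constants. *)
Definition grow_cost hi test :=
  ((bcost (BAnd (BLeI (isucc (ir 0)) hi) test)) + 10)%N.

(** The time is bounded by the distance actually covered, not by the distance to [H]; successive
    growths therefore amortise over one pass. *)
Lemma grow_wp (R : realType) (inp : memory R) fr hi test (f : nat -> nat) (g : nat -> R)
    (ok : nat -> Prop) lo H (Q : memory R -> nat -> Prop) :
  f fr = lo -> (lo <= H)%N ->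
  (forall x, (lo <= x <= H)%N -> ieval inp (Memory (update f fr x) g) hi = H) ->
  (forall x, (lo <= x < H)%N ->
     beval inp (Memory (update f fr x) g) test <-> ok x.+1) ->
  (forall x t, grows_to ok lo H x -> (t <= (x - lo).+1 * grow_cost hi test)%N ->
     Q (Memory (update f fr x) g) t) ->
  wp inp (grow fr hi test) (Memory f g) Q.
Proof.
move=> f0 loH hiE testE hQ.
apply: (wp_while (Inv := fun st => exists2 x, (lo <= x <= H)%N &
    st = Memory (update f fr x) g /\ forall y, (lo <= y < x)%N -> ok y.+1)
  (Phi := fun st => ((H - icell st fr) * grow_cost hi test)%N)).
- exists lo; first by rewrite leqnn.
  by rewrite -f0 update_id; split=> // y; lia.
- move=> _ [x hx [-> okx]] /=; rewrite -/(beval _ _ _) -/(ieval _ _ _) update_eq hiE //.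
  move=> /andP[xH ht]; apply: wp_loop_free => // t ht' /=.
  have lt : (lo <= x < H)%N by lia.
  rewrite !update_eq; split; last first.
    have := @potential_step H x (x + 1) (grow_cost hi test) ltac:(lia) ltac:(lia).
    by move: ht'; rewrite /max_cost /= /grow_cost /bcost /=; lia.
  exists x.+1; first by lia.
  split.
    by congr Memory; apply/funext => y; rewrite /update; case: eqP => //; lia.
  move=> y hy; have [->|ne] := eqVneq y x; first exact/(testE x lt).
  by apply: okx; lia.
- move=> _ t [x hx [-> okx]] /=; rewrite -/(beval _ _ _) -/(ieval _ _ _) !update_eq hiE // f0.
  move=> nb le; apply: hQ; last first.
    move: le; rewrite {2 3}/grow_cost /bcost /= -/bcost.
    have -> : (H - lo = (x - lo) + (H - x))%N by lia.
    by rewrite mulnDl mulSn /grow_cost /bcost /=; lia.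
  split=> // xH okS; move/negP: nb; apply; apply/andP; split; first by lia.
  by apply/(testE x); [lia|].
Qed.

Definition pass_test := fits (ir 0) (ir 6) (ir 4) (ir 4).
Definition pass_grow_test := fits (ir 0) (ir 6) (ir 4) (isucc (ir 5)).
Definition pass_grow := grow 5 (ISub mI (IConst 1)) pass_grow_test.
Definition pass_strip strip :=
  Seq (iset 5 (ir 4)) (Seq pass_grow (Seq strip (iset 4 (isucc (ir 5))))).
(** One scan serves both for counting and for writing blocks: [strip] handles merged columns,
    delimited by registers 4 and 5, and [col] a column that must be split. *)
Definition slice_pass strip col :=
  Seq (iset 4 (IConst 0)) (While (BLtI (ir 4) mI)
    (If pass_test (pass_strip strip) (Seq col (iset 4 (isucc (ir 4)))))).

Definition pass_cost (Ks Kc : nat) : nat :=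
  (grow_cost (ISub mI (IConst 1)) pass_grow_test + bcost pass_test
   + bcost (BLtI (ir 4) mI) + Ks + Kc + 50)%N.

Section SlicePass.
Variables (R : realType) (n m : nat) (D : 'M[R]_(n, m)) (inp : memory R).
Variables (tau : R) (g : nat -> R) (r e : nat).
Hypotheses (inp_m : icell inp 1 = m) (m_gt0 : (0 < m)%N) (re : (r <= e < n)%N).
Hypotheses (tau_ge0 : 0 <= tau) (g_tables : tables D g) (g_tau : g 0%N = tau).
Variables (A : memory R -> seq rect -> Prop) (strip col : cmd) (Ks Kc : nat).
Hypothesis A_real : forall st Bs, A st Bs -> rcell st = g.
Hypothesis A_rows : forall st Bs, A st Bs -> icell st 0 = r /\ icell st 6 = e.
Hypothesis A_upd : forall f h Bs a v, (a = 4%N \/ a = 5%N) ->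
  A (Memory f h) Bs -> A (Memory (update f a v) h) Bs.
Let E := rows m r e.
Hypothesis strip_wp : forall st Bs c f, A st Bs -> icell st 4 = c -> icell st 5 = f ->
  (c <= f < m)%N -> wp inp strip st (fun st' t =>
    [/\ A st' (rcons Bs (cols E c f)), icell st' 4 = c, icell st' 5 = f & (t <= Ks)%N]).
Hypothesis col_wp : forall st Bs c vs, A st Bs -> icell st 4 = c -> (c < m)%N ->
  slice_loop D^T tau (tr_rect (cols E c c)) (tr_rect (cols E c c)).2.1 vs ->
  wp inp col st (fun st' t =>
    [/\ A st' (Bs ++ [seq tr_rect B | B <- vs]), icell st' 4 = c & (t <= Kc)%N]).

(** [A] relates the memory to the blocks treated so far and survives changes of the scanning
    registers. The potential is the number of columns left; a growth is paid by the columns it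
    merges. *)
Lemma slice_pass_wp st Bs Q : slice_partition D E tau Bs -> A st [::] ->
  (forall st' t, A st' Bs -> (t <= m.+1 * pass_cost Ks Kc)%N -> Q st' t) ->
  wp inp (slice_pass strip col) st Q.
Proof.
move=> sl A0 hQ; apply: wp_seq; apply: wp_loop_free => // t0 ht0.
apply: (wp_while (Inv := fun st => exists done rest,
    [/\ Bs = done ++ rest, slice_loop D tau E (icell st 4) rest,
        (icell st 4 <= m)%N & A st done])
  (Phi := fun st => ((m - icell st 4) * pass_cost Ks Kc)%N)).
- exists [::], Bs; split=> //=.
  by case: (st) A0 => f h /= A0; apply: A_upd => //; left.
- case=> f h [bs [rest [BsE sl' cm A1]]] /= guard.
  have [c cE] : {c | c = f 4%N} by eexists.
  have c4 : icell (Memory f h) 4 = c by [].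
  have hE := A_real A1; rewrite /= in hE.
  have [f0 f6] := A_rows A1; rewrite /= in f0 f6.
  rewrite c4 in sl' cm; rewrite -cE.
  have ltc : (c < m)%N by move: guard; rewrite inp_m -cE; lia.
  have iE x : (c <= x < m)%N -> inside n m ((r, e), (c, x)).
    by move=> hx; rewrite /inside /=; lia.
  have tE : beval inp (Memory f h) pass_test = (opt D 1 (cols E c c) <= tau).
    by apply: (fitsE inp_m); rewrite /= ?hE -?cE //; apply: iE; lia.
  apply: wp_if; rewrite tE => test.
    have [[]|[? [? [_]]]|[x [rest' [_ _ gr sl2 restE]]]] := slice_inv sl'.
    + by rewrite /=; lia.
    + by rewrite ltNge test.
    apply: wp_seq; apply: wp_loop_free => // t1 ht1 /=.
    apply: wp_seq; rewrite /pass_grow.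
    have upd5 y v : update (update f 5 (f 4%N)) 5 v y = if y == 5 then v else f y.
      by rewrite /update; case: eqP.
    apply: (grow_wp (ok := fun e' => opt D 1 (cols E c e') <= tau) (lo := c) (H := m.-1)).
    + by rewrite update_eq.
    + by lia.
    + by move=> y hy; rewrite /= inp_m; lia.
    + move=> y hy; rewrite (@fitsE R n m D inp inp_m tau _ _ _ _ _ r e c y.+1) //=;
        rewrite ?upd5 ?hE //=; [by rewrite addn1|by apply: iE; lia].
    move=> y t2 gr' ht2; have xy := grows_to_uniq gr gr'; rewrite -xy in ht2 gr' *.
    have [cx _ _] := gr'.
    apply: wp_seq.
    have A2 : A (Memory (update (update f 5 (f 4%N)) 5 x) h) bs.
      by apply: A_upd; [right|apply: A_upd => //; right].
    apply: wp_conseq (strip_wp A2 _ _ _) _; rewrite /= ?upd5 //=.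
      by lia.
    move=> [f' h'] t3 [A3 c3 x3 ht3]; rewrite /= in c3 x3.
    apply: wp_loop_free => // t4 ht4; split.
      exists (rcons bs (cols E c x)), rest'; split=> /=.
      + by rewrite BsE restE cat_rcons cE.
      + by rewrite update_eq x3 addn1.
      + by rewrite update_eq x3; lia.
      by apply: A_upd; [left|rewrite cE].
    rewrite /= update_eq x3.
    have P := @potential_step m x (x + 1) (pass_cost Ks Kc) ltac:(lia) ltac:(lia).
    have P' : ((m - c) * pass_cost Ks Kc = (x - c) * pass_cost Ks Kc + (m - x) * pass_cost Ks Kc)%N.
      by rewrite -mulnDl; congr (_ * _)%N; lia.
    rewrite P'; apply: leq_trans (leq_add (leqnn _) P).
    have G : ((x - c) * grow_cost (ISub mI (IConst 1)) pass_grow_test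
        <= (x - c) * pass_cost Ks Kc)%N.
      by rewrite leq_mul2l /pass_cost; apply/orP; right; lia.
    move: ht1 ht2 ht3 ht4 G; rewrite mulSn /max_cost /= /pass_cost; lia.
  have [[]|[vs [rest' [_ _ slv sl2 restE]]]|[? [? [_]]]] := slice_inv sl'.
  + by rewrite /=; lia.
  + apply: wp_seq; apply: wp_conseq (col_wp A1 c4 ltc slv) _.
    move=> [f' h'] t1 [A2 c3 ht1]; rewrite /= in c3.
    apply: wp_loop_free => // t2 ht2 /=; rewrite update_eq c3 addn1; split.
      exists (bs ++ [seq tr_rect B | B <- vs]), rest'; split=> //.
      + by rewrite BsE restE catA.
      by apply: A_upd => //; left.
    have P := @potential_step m c c.+1 (pass_cost Ks Kc) ltac:(lia) ltac:(lia).
    apply: leq_trans P; move: ht1 ht2; rewrite {2}/pass_cost /max_cost /=; lia.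
  + by rewrite (negbTE test).
- move=> st' t [bs [rest [BsE sl' cm A1]]] guard ht.
  have cE : icell st' 4 = m by move: guard; rewrite /= inp_m; lia.
  have [[_ r0]|[? [? [h1 _ _ _ _]]]|[? [? [h1 _ _ _ _]]]] := slice_inv sl'.
  + apply: hQ; first by rewrite BsE r0 cats0.
    have big : (bcost (BLtI (ir 4) mI) + 50 <= pass_cost Ks Kc)%N.
      by rewrite /pass_cost; lia.
    by move: ht ht0; rewrite /= cE subnn mul0n addn0 mulSn /max_cost /= update_eq subn0; lia.
  + by move: h1; rewrite cE /=; lia.
  + by move: h1; rewrite cE /=; lia.
Qed.
End SlicePass.

(* The greedy partition of the cells of column j in the rows r, ..., e has pc
   blocks, and the last one starts at row top. *)
Definition column_state (R : realType) n m (D : 'M[R]_(n, m)) (tau : R) j r e top pc :=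
  (r <= top <= e)%N /\ exists2 vs : seq rect, pc = (size vs).+1 &
    (forall hi rest, (e <= hi < n)%N -> slice_loop D^T tau ((j, j), (r, hi)) top rest ->
       slice_loop D^T tau ((j, j), (r, hi)) r (vs ++ rest)) /\
    forall e', (top <= e' < e)%N -> opt D 1 ((top, e'.+1), (j, j)) <= tau.

Section ColumnState.
Variables (R : realType) (n m : nat) (D : 'M[R]_(n, m)) (tau : R) (j r : nat).
Hypotheses (tau_ge0 : 0 <= tau) (j_lt : (j < m)%N).

Let opt_col a b : (a <= b < n)%N ->
  opt D^T 1 ((j, j), (a, b)) = opt D 1 ((a, b), (j, j)).
Proof.
move=> h; have iB : inside n m ((a, b), (j, j)) by rewrite /inside /=; lia.
exact: (opt_tr D iB).
Qed.

Let merge e top x rest : (r <= top <= x)%N -> (x <= e < n)%N ->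
  (forall e', (top <= e' < x)%N -> opt D 1 ((top, e'.+1), (j, j)) <= tau) ->
  ((x < e)%N -> tau < opt D 1 ((top, x.+1), (j, j))) ->
  slice_loop D^T tau ((j, j), (r, e)) x.+1 rest ->
  slice_loop D^T tau ((j, j), (r, e)) top (((j, j), (top, x)) :: rest).
Proof.
move=> h1 h2 ok nok sl; apply: (@slice_merge _ _ _ D^T tau ((j, j), (r, e)) top x) => //=.
- by lia.
- by rewrite /cols /= opt_col ?opt_cell //; lia.
- split; first by lia.
    by move=> e' he'; rewrite /cols /= opt_col; [exact: ok|lia].
  by move=> xe; rewrite /cols /= opt_col; [apply/negP; rewrite -ltNge; exact: nok|lia].
Qed.

Lemma column_state_init : (r < n)%N -> column_state D tau j r r r 1.
Proof.
move=> rn; split; first by rewrite leqnn.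
by exists [::] => //; split=> // e'; lia.
Qed.

Lemma column_state_keep e top pc : (e.+1 < n)%N -> column_state D tau j r e top pc ->
  opt D 1 ((top, e.+1), (j, j)) <= tau -> column_state D tau j r e.+1 top pc.
Proof.
move=> en [te [vs pcE [H ok]]] le; split; first by lia.
exists vs => //; split; first by move=> hi rest h; apply: H; lia.
move=> e' he'; have [->//|ne] := eqVneq e' e.
by apply: ok; lia.
Qed.

(** The open block is refused row [e + 1], whatever rows are appended later, so closing it at [e] is
    final. This makes the greedy partition computable row by row. *)
Lemma column_state_new e top pc : (e.+1 < n)%N -> column_state D tau j r e top pc ->
  tau < opt D 1 ((top, e.+1), (j, j)) -> column_state D tau j r e.+1 e.+1 pc.+1.
Proof.
move=> en [te [vs pcE [H ok]]] gt; split; first by lia.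
exists (rcons vs ((j, j), (top, e))); first by rewrite size_rcons pcE.
split; last by move=> e'; lia.
move=> hi rest h sl; rewrite cat_rcons; apply: H; first by lia.
by apply: merge => //; lia.
Qed.

(** If the column is cut at row [e], the open block becomes the last one; [slice_det] does the
    rest. *)
Lemma column_state_size e top pc vs : (e < n)%N -> column_state D tau j r e top pc ->
  slice_loop D^T tau ((j, j), (r, e)) r vs -> size vs = pc.
Proof.
move=> en [te [vs' pcE [H ok]]] sl.
have sl' : slice_loop D^T tau ((j, j), (r, e)) r (vs' ++ [:: ((j, j), (top, e))]).
  apply: H; first by lia.
  apply: merge => //; try lia.
  by apply: slice_done => /=.
by rewrite (slice_det sl sl') size_cat /= pcE addn1.
Qed.

End ColumnState.

(** * Counting the blocks of a slab in time linear in the number of columns *)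

Definition top_addr e := IAdd (IConst 32) (IMul (IConst 2) e).
Definition pc_addr e := IAdd (IConst 33) (IMul (IConst 2) e).
Definition count_strip := iset 3 (isucc (ir 3)).
Definition count_col := iset 3 (IAdd (ir 3) (ILoad (pc_addr (ir 4)))).
Definition count_pass := Seq (iset 3 (IConst 0)) (slice_pass count_strip count_col).

Definition count_cost := pass_cost (max_cost count_strip) (max_cost count_col).

(** Register 1 is the new row and register 0 the first row of the slab; when they agree, the
    descriptions left by the previous slab are replaced. *)
Definition array_step := If (BLeI (ir 1) (ir 0))
  (Seq (IStore (top_addr (ir 10)) (ir 1)) (IStore (pc_addr (ir 10)) (IConst 1)))
  (If (fits (ILoad (top_addr (ir 10))) (ir 1) (ir 10) (ir 10)) Skip
    (Seq (IStore (top_addr (ir 10)) (ir 1))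
      (IStore (pc_addr (ir 10)) (isucc (ILoad (pc_addr (ir 10))))))).
Definition arrays_loop := While (BLtI (ir 10) mI) (Seq array_step (iset 10 (isucc (ir 10)))).
Definition arrays_update := Seq (iset 10 (IConst 0)) arrays_loop.
Definition arrays_cost := (max_cost array_step + bcost (BLtI (ir 10) mI) + 20)%N.

Section Count.
Variables (R : realType) (n m : nat) (D : 'M[R]_(n, m)) (inp : memory R).
Variables (tau : R) (g : nat -> R) (r : nat).
Hypotheses (inp_m : icell inp 1 = m) (m_gt0 : (0 < m)%N).
Hypotheses (tau_ge0 : 0 <= tau) (g_tables : tables D g) (g_tau : g 0%N = tau).

Definition arrays (e : nat) (f : nat -> nat) : Prop :=
  forall j, (j < m)%N -> column_state D tau j r e (f (32 + 2 * j)%N) (f (33 + 2 * j)%N).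

(** A split column contributes its stored number of blocks, in constant time, instead of being
    partitioned again. *)
Lemma count_pass_wp (f : nat -> nat) e Bs Q : (r <= e < n)%N ->
  f 0%N = r -> f 6%N = e -> arrays e f ->
  slice_partition D (rows m r e) tau Bs ->
  (forall f' t, f' 3%N = size Bs -> (forall a, a \notin [:: 3; 4; 5]%N -> f' a = f a) ->
     (t <= m.+2 * count_cost)%N -> Q (Memory f' g) t) ->
  wp inp count_pass (Memory f g) Q.
Proof.
move=> re f0 f6 arr sl hQ; apply: wp_seq; apply: wp_loop_free => // t0 ht0 /=.
pose A (st : memory R) (Bs : seq rect) := [/\ rcell st = g, icell st 3 = size Bs &
  forall a, a \notin [:: 3; 4; 5]%N -> icell st a = f a].
apply: (@slice_pass_wp R n m D inp tau g r e inp_m m_gt0 re tau_ge0 g_tables g_tau A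
  count_strip count_col (max_cost count_strip) (max_cost count_col) _ _ _ _ _ _ Bs) => //.
- by move=> st Bs' [].
- by move=> st Bs' [_ _ fr]; rewrite !fr.
- move=> f1 h Bs' a v ha [/= h1 h2 h3]; split=> //=.
    by rewrite update_neq //; case: ha => ->.
  by move=> b hb; rewrite update_neq ?h3 // => ba; move: hb; rewrite ba; case: ha => ->.
- move=> [f1 h] Bs' c x [/= h1 h2 h3] h4 h5 hx; apply: wp_loop_free => // t ht /=.
  rewrite !update_neq //; split=> //; split=> //=.
    by rewrite update_eq h2 size_rcons addn1.
  move=> b hb; rewrite update_neq ?h3 // => ba; by move: hb; rewrite ba.
- move=> [f1 h] Bs' c vs [/= h1 h2 h3] h4 hc slv; apply: wp_loop_free => // t ht /=.
  rewrite update_neq //; split=> //; split=> //=.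
    rewrite update_eq h2 h4 h3; last by rewrite !inE; lia.
    rewrite size_cat size_map; congr (_ + _)%N; apply/esym.
    by apply: column_state_size (arr _ hc) slv => //; lia.
  move=> b hb; rewrite update_neq ?h3 // => ba; by move: hb; rewrite ba.
- split=> //= b hb; rewrite update_neq // => ba; by move: hb; rewrite ba.
- move=> [f' h] t [/= -> h2 h3] ht; apply: hQ => //.
  have big : (50 <= count_cost)%N by rewrite /count_cost /pass_cost; lia.
  have {}ht0 : (t0 <= 10)%N by exact: leq_trans ht0 _.
  by rewrite mulSn; move: ht; rewrite -/count_cost; lia.
Qed.

Lemma arrays_update_wp (f : nat -> nat) x Q : (r <= x < n)%N ->
  f 0%N = r -> f 1%N = x -> ((r < x)%N -> arrays x.-1 f) ->
  (forall f' t, arrays x f' ->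
     (forall a, (a < 32)%N || (32 + 2 * m <= a)%N -> a != 10 -> f' a = f a) ->
     (t <= m.+1 * arrays_cost)%N -> Q (Memory f' g) t) ->
  wp inp arrays_update (Memory f g) Q.
Proof.
move=> rx f0 f1 arr hQ; apply: wp_seq; apply: wp_loop_free => // t0 ht0.
pose Inv (st : memory R) := exists f', [/\ st = Memory f' g,
  forall a, (a < 32)%N || (32 + 2 * m <= a)%N -> a != 10 -> f' a = f a,
  (f' 10 <= m)%N,
  forall j, (j < f' 10)%N -> column_state D tau j r x (f' (32 + 2 * j)%N) (f' (33 + 2 * j)%N) &
  forall j, (f' 10 <= j < m)%N -> f' (32 + 2 * j)%N = f (32 + 2 * j)%N /\
                                  f' (33 + 2 * j)%N = f (33 + 2 * j)%N].
apply: (wp_while (Inv := Inv) (Phi := fun st => ((m - icell st 10) * arrays_cost)%N)).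
- eexists; split; first by [].
  + by move=> a ha /eqP na; rewrite update_neq.
  + by [].
  + by move=> j.
  + by move=> j hj; rewrite /= !update_neq //; lia.
- move=> _ [f' [-> fr jm done todo]] guard.
  have ltj : (f' 10 < m)%N by move: guard; rewrite /= inp_m; lia.
  have [j jE] : {j | j = f' 10%N} by eexists.
  apply: wp_loop_free => // t ht.
  have f'0 : f' 0%N = r by rewrite fr.
  have f'1 : f' 1%N = x by rewrite fr.
  have [t1 t2] := todo (f' 10%N) ltac:(lia).
  have stepE : exists top pc, column_state D tau j r x top pc /\
      den inp array_step (Memory f' g)
      = Memory (update (update f' (32 + 2 * j) top) (33 + 2 * j) pc) g.
    rewrite /array_step; cbn [den]; case: ifP => xr.
      have xE : x = r by move: xr; rewrite /= f'0 f'1; lia.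
      exists r, 1%N; rewrite {1}xE; split; first by apply: column_state_init; lia.
      by rewrite /= f'1 xE -jE update_neq -?jE //; lia.
    have rltx : (r < x)%N by move: xr; rewrite /= f'0 f'1; lia.
    have := arr rltx j ltac:(lia); rewrite jE -t1 -t2 -jE => cs.
    have top_le := cs.1.
    have xE : x.-1.+1 = x by lia.
    have jm' : (j < m)%N by lia.
    have xn : (x.-1.+1 < n)%N by lia.
    have fE : beval inp (Memory f' g) (fits (ILoad (top_addr (ir 10))) (ir 1) (ir 10) (ir 10))
        = (opt D 1 ((f' (32 + 2 * j)%N, x), (j, j)) <= tau).
      by apply: (fitsE inp_m) => //=; rewrite -?jE //; rewrite /inside /=; lia.
    rewrite fE; case: ifP => le.
      exists (f' (32 + 2 * j)%N), (f' (33 + 2 * j)%N); split.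
        by have H := column_state_keep tau_ge0 jm' xn cs; rewrite xE in H; exact: H.
      congr Memory; apply/funext => a; rewrite /update.
      by case: eqP => [->|_]; last case: eqP => [->|_].
    exists x, (f' (33 + 2 * j)%N).+1; split.
      by have H := column_state_new tau_ge0 jm' xn cs; rewrite xE in H; apply: H; rewrite ltNge le.
    cbn [den ieval]; rewrite /top_addr /pc_addr /= f'1.
    by rewrite !update_neq -?jE ?addn1 //; lia.
  have [top [pc [cs stE]]] := stepE; cbn [den]; rewrite stE /=.
  have rd a : update (update (update f' (32 + 2 * j) top) (33 + 2 * j) pc) 10
      (update (update f' (32 + 2 * j) top) (33 + 2 * j) pc 10 + 1) a
    = if a == 10 then j.+1 else if a == (33 + 2 * j)%N then pc
      else if a == (32 + 2 * j)%N then top else f' a.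
    rewrite {1}/update; case: eqP => // _.
    by rewrite !update_neq ?addn1 -?jE //; lia.
  rewrite rd /=; split; last first.
    have P := @potential_step m j j.+1 arrays_cost ltac:(lia) ltac:(lia).
    by move: ht; rewrite -jE; move: P; rewrite {1}/arrays_cost /max_cost /=; lia.
  eexists; split; first by []; rewrite ?rd /=.
  + move=> a ha na; rewrite rd (negbTE na); have := ltj; rewrite -jE => ltj'.
    by do 2 (case: eqP => [ea|_]; first lia); exact: fr.
  + by lia.
  + move=> j'; rewrite rd /= => hj'; rewrite !rd.
    have [->|ne] := eqVneq j' j.
      have e1 : (32 + 2 * j == 33 + 2 * j)%N = false by lia.
      have e2 : (33 + 2 * j == 10)%N = false by lia.
      by rewrite !eqxx e1 e2.
    by rewrite !ifF; [apply: done; lia|lia..].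
  + move=> j' hj'; rewrite !rd.
    by rewrite !ifF; [apply: todo; lia|lia..].
- move=> _ t [f' [-> fr jm done todo]] guard ht.
  have jE : f' 10%N = m by move: guard; rewrite /= inp_m; lia.
  apply: hQ => //; first by move=> j hj; apply: done; lia.
  move: ht ht0; rewrite /= jE subnn mul0n addn0 update_eq subn0 mulSn {2}/arrays_cost /max_cost /=.
  by lia.
Qed.

End Count.

(** * Growing a slab row by row *)

Definition slab_body_end := If (BLeR (ROfInt (ir 3)) (rr 1)) (iset 1 (isucc (ir 1))) (iset 2 (IConst 0)).
Definition slab_body := Seq arrays_update (Seq (iset 6 (ir 1)) (Seq count_pass slab_body_end)).
Definition slab_guard := BAnd (BLeI (IConst 1) (ir 2)) (BLtI (ir 1) nI).
(** Register 1 is the first refused row, or [n]. The slab ends just before it, but always keeps its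
    first row. *)
Definition slab_end := If (BLeI (ir 1) (ir 0)) (iset 6 (ir 0)) (iset 6 (ISub (ir 1) (IConst 1))).
Definition slab_init := Seq (iset 1 (ir 0)) (iset 2 (IConst 1)).
Definition slab_grow := Seq slab_init (Seq (While slab_guard slab_body) slab_end).
Definition slab_cost := (arrays_cost + count_cost + bcost slab_guard + max_cost slab_body_end
  + max_cost slab_end + max_cost slab_init + 50)%N.

Section Slab.
Variables (R : realType) (n m : nat) (D : 'M[R]_(n, m)) (inp : memory R).
Variables (tau ginv : R) (g : nat -> R) (r : nat).
Hypotheses (inp_n : icell inp 0 = n) (inp_m : icell inp 1 = m) (m_gt0 : (0 < m)%N).
Hypotheses (r_lt : (r < n)%N).
Hypotheses (tau_ge0 : 0 <= tau) (g_tables : tables D g) (g_tau : g 0%N = tau).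
Hypothesis (g_ginv : g 1%N = ginv).

Let few e := exists2 Bs, slice_partition D (rows m r e) tau Bs & (size Bs)%:R <= ginv.

Lemma few_not e Bs : slice_partition D (rows m r e) tau Bs -> ginv < (size Bs)%:R -> ~ few e.
Proof. by move=> sl gt [Bs' sl' le]; move: gt; rewrite (slice_det sl sl') ltNge le. Qed.

(** The factor [e + 2 - r] allows for the rows of the slab and one refused row. *)
Lemma slab_grow_wp (f : nat -> nat) Q : f 0%N = r ->
  (forall f' e B' t, f' 6%N = e -> (r <= e < n)%N ->
     slice_partition D (rows m r r) tau B' ->
     (if ginv < (size B')%:R then e = r else grows_to few r n.-1 e) ->
     (forall a, [|| a == 0, a == 9 | 32 + 2 * m <= a]%N -> f' a = f a) ->
     (t <= (e.+2 - r) * (m.+2 * slab_cost) + slab_cost)%N -> Q (Memory f' g) t) ->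
  wp inp slab_grow (Memory f g) Q.
Proof.
move=> f0 hQ; have iE x : (r <= x < n)%N -> inside n m (rows m r x).
  by move=> hx; rewrite /inside /=; lia.
have slx x : (r <= x < n)%N -> exists Bs, slice_partition D (rows m r x) tau Bs.
  by move=> /iE hx; apply: slice_ex.
apply: wp_seq; apply: wp_loop_free => // t0 ht0 /=; rewrite f0; apply: wp_seq.
set f1 := update _ 2 1%N.
have f11 : f1 1%N = r by rewrite /f1 update_neq // update_eq.
have f12 : f1 2%N = 1%N by rewrite /f1 update_eq.
(* Register 2 is 1 until a row is refused; until then the arrays describe the columns up to the row
   before register 1. *)
pose Inv (st : memory R) := exists f', [/\ st = Memory f' g,
  forall a, [|| a == 0, a == 9 | 32 + 2 * m <= a]%N -> f' a = f a,
  (r <= f' 1%N <= n)%N /\ (f' 2%N <= 1)%N,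
  forall e, (r <= e < f' 1%N)%N -> few e &
  if f' 2%N == 1%N then (r < f' 1%N)%N -> arrays D tau r (f' 1%N).-1 f'
  else (f' 1%N < n)%N /\ ~ few (f' 1%N)].
apply: (wp_while (Inv := Inv)
  (Phi := fun st => ((n - icell st 1 + icell st 2) * (m.+2 * slab_cost))%N)).
- exists f1; split=> //.
  + move=> a ha; rewrite /f1 !update_neq //; move: ha; lia.
  + by rewrite f11 f12; split; lia.
  + by move=> e; rewrite f11; lia.
  + by rewrite f11 f12 ltnn.
- move=> _ [f' [-> fr [hx h2] fw arr]] guard.
  have [xE go] : (f' 1%N < n)%N /\ f' 2%N = 1%N.
    by move: guard; rewrite /= inp_n; lia.
  have [x xx] : {x | x = f' 1%N} by eexists.
  rewrite go eqxx -xx in arr; rewrite -xx in hx fw xE.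
  have f'0 : f' 0%N = r by rewrite fr.
  apply: wp_seq; apply: (arrays_update_wp (r := r) inp_m m_gt0 tau_ge0 g_tables g_tau (x := x)) => //.
    by lia.
  move=> f2 t1 arr2 fr2 ht1; apply: wp_seq; apply: wp_loop_free => // t2 ht2 /=.
  apply: wp_seq; have [Bs sl] := slx x ltac:(lia).
  have f21 : f2 1%N = x by rewrite fr2.
  have f20 : f2 0%N = r by rewrite fr2.
  have f22 : f2 2%N = 1%N by rewrite fr2.
  apply: (count_pass_wp inp_m m_gt0 tau_ge0 g_tables g_tau (e := x) (r := r) (Bs := Bs)) => //.
    by lia.
  move=> f3 t3 cnt fr3 ht3.
  have arr3 : arrays D tau r x f3.
    move=> j hj; rewrite !fr3; try by rewrite !inE; lia.
    by rewrite !update_neq; [exact: arr2|lia|lia].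
  have fr4 a : [|| a == 0, a == 9 | 32 + 2 * m <= a]%N -> f3 a = f a.
    move=> ha; rewrite fr3; last by rewrite !inE; lia.
    rewrite update_neq; last by lia.
    by rewrite fr2 ?fr //; lia.
  have f31 : f3 1%N = x by rewrite fr3.
  have f32 : f3 2%N = 1%N by rewrite fr3.
  apply: wp_loop_free => // t4 ht4; rewrite /slab_body_end; cbn [den].
  have cost y : (y < n - x + 1)%N -> (bcost slab_guard + (t1 + (t2 + (t3 + t4).+1).+1).+1
      + y * (m.+2 * slab_cost) < (n - x + 1) * (m.+2 * slab_cost))%N.
    move=> hy; apply: leq_trans (_ : (y.+1 * (m.+2 * slab_cost) <= _)%N); last first.
      by rewrite leq_mul2r hy orbT.
    rewrite [leqRHS]mulSn ltn_add2r.
    have e1 : (t1 <= m.+2 * arrays_cost)%N by apply: leq_trans ht1 _; rewrite leq_mul2r; lia.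
    have e2 : (t2 <= 10)%N by exact: leq_trans ht2 _.
    have e3 : (m.+2 * slab_cost = m.+2 * arrays_cost + m.+2 * count_cost
       + m.+2 * (bcost slab_guard + max_cost slab_body_end
         + max_cost slab_end + max_cost slab_init + 50))%N.
      by rewrite -!mulnDr; congr (_ * _)%N; rewrite /slab_cost; lia.
    rewrite e3; move: ht4 e2 e1 ht3; rewrite !mulSn; lia.
  have leE : beval inp (Memory f3 g) (BLeR (ROfInt (ir 3)) (rr 1)) = ((size Bs)%:R <= ginv).
    by rewrite /= cnt g_ginv.
  rewrite leE; case: ifP => le /=.
    split; last by rewrite update_eq update_neq // ?f31 ?f32 -xx go; apply: cost; lia.
    eexists; split; first by [].
    + move=> a ha; rewrite update_neq ?fr4 //; lia.
    + by rewrite update_eq update_neq // f31 f32; split; lia.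
    + move=> e he; have [->|ne] := eqVneq e x; first by exists Bs.
      by apply: fw; move: he; rewrite update_eq f31; lia.
    + rewrite update_neq // f32 eqxx => _ j hj; rewrite update_eq f31 addn1 /=.
      by rewrite !update_neq; [exact: arr3|lia|lia].
  split; last by rewrite update_eq update_neq // ?f31 ?f32 -xx go; apply: cost; lia.
  eexists; split; first by [].
  + move=> a ha; rewrite update_neq ?fr4 //; lia.
  + by rewrite update_eq update_neq // f31; split; lia.
  + by move=> e he; apply: fw; move: he; rewrite update_neq // f31; lia.
  + rewrite update_eq /= update_neq // f31; split=> //; apply: few_not sl _.
    by rewrite ltNge le.
- move=> _ t1 [f' [-> fr [hx h2] fw arr]] guard ht1.
  apply: wp_loop_free => // t2 ht2.
  have [x xx] : {x | x = f' 1%N} by eexists.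
  rewrite -!xx in arr; rewrite -xx in hx fw.
  have f'0 : f' 0%N = r by rewrite fr.
  have [B' slr] := slx r ltac:(lia).
  have stop : (x < n)%N -> ~ few x.
    move=> xn; move: arr; case: eqP => [go|_ []//].
    by move: guard; rewrite /= go inp_n -xx; lia.
  pose e := if (x <= r)%N then r else x.-1.
  have he : (r <= e < n)%N by rewrite /e; case: ifP; lia.
  have stE : den inp slab_end (Memory f' g) = Memory (update f' 6 e) g.
    by rewrite /slab_end /= f'0 -xx /e; case: ifP => _ //=; rewrite subn1.
  rewrite stE; apply: (hQ _ e B') => //.
  + case: ltP => [gt|le].
      rewrite /e; case: leqP => // rx; have [B2 sl2 le2] := fw r ltac:(lia).
      by move: gt; rewrite (slice_det slr sl2) ltNge le2.
    have rx : (r < x)%N.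
      rewrite ltnNge; apply/negP => xr; have xE : x = r by lia.
      by apply: (stop ltac:(lia)); rewrite xE; exists B'.
    have eE : e = x.-1 by rewrite /e leqNgt rx.
    rewrite eE; split; first by lia.
      by move=> e' he'; apply: fw; lia.
    move=> xn; have xE : x.-1.+1 = x by lia.
    by rewrite xE; apply: stop; lia.
  + by move=> a ha; rewrite update_neq ?fr //; lia.
  have xe : (x <= e.+1)%N by rewrite /e; case: ifP; lia.
  move: ht1; rewrite /= f11 f12 -xx.
  have -> : (n - r + 1 = (n - x + f' 2) + (x - r + 1 - f' 2))%N by lia.
  have : ((x - r + 1 - f' 2) * (m.+2 * slab_cost) <= (e.+2 - r) * (m.+2 * slab_cost))%N.
    by rewrite leq_mul2r; apply/orP; right; lia.
  rewrite [((_ + _) * (_ * _))%N]mulnDl => le1 ht1.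
  have : (t0 + t2 + bcost slab_guard + 3 <= slab_cost)%N.
    by move: ht0 ht2; rewrite /slab_cost; lia.
  by move: ht1 le1; lia.
Qed.
End Slab.

(** * Writing the blocks of a slab *)

Definition list_addr t :=
  IAdd (IConst (32 + t)) (IAdd (IMul (IConst 2) mI) (IMul (IConst 4) (ir 9))).
Definition emit a b c d := Seq (IStore (list_addr 0) (ir a)) (Seq (IStore (list_addr 1) (ir b))
  (Seq (IStore (list_addr 2) (ir c)) (Seq (IStore (list_addr 3) (ir d))
    (iset 9 (isucc (ir 9)))))).
Definition emit_cost := max_cost (emit 0 0 0 0).

Definition list_index m t q := (32 + t + (2 * m + 4 * q))%N.

Definition stored (m : nat) (f : nat -> nat) (Bs : seq rect) : Prop :=
  forall q, (q < size Bs)%N ->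
    let B := nth ((0, 0), (0, 0))%N Bs q in
    [/\ f (list_index m 0 q) = B.1.1, f (list_index m 1 q) = B.1.2,
        f (list_index m 2 q) = B.2.1 & f (list_index m 3 q) = B.2.2].

Lemma stored_frame m f f' Bs : (forall a, (32 + 2 * m <= a)%N -> f' a = f a) ->
  stored m f Bs -> stored m f' Bs.
Proof.
move=> fr st q hq; have [h1 h2 h3 h4] := st q hq.
by split; rewrite fr // /list_index; lia.
Qed.

Lemma emit_wp (R : realType) (inp : memory R) m (f : nat -> nat) g Bs a b c d Q :
  icell inp 1 = m -> (a < 32)%N -> (b < 32)%N -> (c < 32)%N -> (d < 32)%N ->
  f 9%N = size Bs -> stored m f Bs ->
  (forall f' t, f' 9%N = (size Bs).+1 -> stored m f' (rcons Bs ((f a, f b), (f c, f d))) ->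
     (forall x, (x < 32 + 2 * m)%N -> x != 9%N -> f' x = f x) -> (t <= emit_cost)%N ->
     Q (Memory f' g) t) ->
  wp inp (emit a b c d) (Memory f g) Q.
Proof.
move=> inp_m ha hb hc hd f9 st hQ; apply: wp_loop_free => // t ht.
have [s sE] : {s | s = size Bs} by eexists.
have stE : den inp (emit a b c d) (Memory f g) = Memory (update (update (update (update
    (update f (list_index m 0 s) (f a)) (list_index m 1 s) (f b))
    (list_index m 2 s) (f c)) (list_index m 3 s) (f d)) 9 s.+1) g.
  have r9 k v h : h 9%N = s -> update h (list_index m k s) v 9%N = s.
    by move=> hs; rewrite update_neq // /list_index; lia.
  rewrite /emit; cbn [den]; congr Memory; cbn [icell rcell ieval list_addr ir isucc mI].
  rewrite inp_m f9 -sE -!/(list_index _ _ _).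
  have rk (h : nat -> nat) k v x : (x < 32)%N -> update h (list_index m k s) v x = h x.
    by move=> hx; rewrite update_neq // /list_index; lia.
  have f9s : f 9%N = s by rewrite f9.
  by rewrite !(rk _ _ _ 9%N, f9s) // !rk // addn1.
rewrite stE; apply: hQ => //.
- by rewrite update_eq sE.
- move=> q; rewrite size_rcons ltnS leq_eqVlt nth_rcons => /orP[/eqP->|hq].
    rewrite ltnn eqxx /= -sE; split;
      repeat first [by rewrite update_eq | rewrite update_neq; [|by rewrite /list_index; lia]].
  rewrite hq; have := st q hq => /= -[<- <- <- <-].
  by split; rewrite !update_neq //; rewrite /list_index; lia.
- by move=> x hx /eqP nx; rewrite !update_neq //; rewrite /list_index; lia.
Qed.

Definition emit_strip := emit 0 6 4 5.
Definition col_test := fits (ir 7) (isucc (ir 8)) (ir 4) (ir 4).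
Definition col_step := Seq (iset 8 (ir 7)) (Seq (grow 8 (ir 6) col_test)
  (Seq (emit 7 8 4 4) (iset 7 (isucc (ir 8))))).
Definition col_guard := BLeI (ir 7) (ir 6).
(** The column is partitioned afresh, since the arrays keep only its last block and a number. This
    takes time linear in the height, but happens once per slab. *)
Definition emit_col := Seq (iset 7 (ir 0)) (While col_guard col_step).
Definition col_cost := (grow_cost (ir 6) col_test + emit_cost + bcost col_guard + 50)%N.

Section Emission.
Variables (R : realType) (n m : nat) (D : 'M[R]_(n, m)) (inp : memory R).
Variables (tau : R) (g : nat -> R) (r e : nat).
Hypotheses (inp_m : icell inp 1 = m) (m_gt0 : (0 < m)%N) (re : (r <= e < n)%N).
Hypotheses (tau_ge0 : 0 <= tau) (g_tables : tables D g) (g_tau : g 0%N = tau).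

Definition emitted (f0 : nat -> nat) (st : memory R) (Bs : seq rect) : Prop :=
  [/\ rcell st = g, icell st 9 = size Bs, stored m (icell st) Bs &
    forall a, (a < 32 + 2 * m)%N -> a \notin [:: 4; 5; 7; 8; 9]%N -> icell st a = f0 a].

Lemma emit_col_wp f0 st Bs c vs Q : f0 0%N = r -> f0 6%N = e ->
  emitted f0 st Bs -> icell st 4 = c -> (c < m)%N ->
  slice_loop D^T tau ((c, c), (r, e)) r vs ->
  (forall st' t, emitted f0 st' (Bs ++ [seq tr_rect B | B <- vs]) -> icell st' 4 = c ->
     (t <= (e.+1 - r).+1 * col_cost)%N -> Q st' t) ->
  wp inp emit_col st Q.
Proof.
move=> f00 f06 em st4 cm sl hQ; apply: wp_seq; apply: wp_loop_free => // t0 ht0.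
apply: (wp_while (Inv := fun st => exists done rest, [/\ vs = done ++ rest,
    slice_loop D^T tau ((c, c), (r, e)) (icell st 7) rest, (r <= icell st 7 <= e.+1)%N,
    icell st 4 = c & emitted f0 st (Bs ++ [seq tr_rect B | B <- done])])
  (Phi := fun st => ((e.+1 - icell st 7) * col_cost)%N)).
- exists [::], vs; case: st em st4 => f h [/= hE f9 stf fr] f4.
  have f00' : f 0%N = r by rewrite fr.
  split=> //=; first by rewrite f00'.
    by rewrite update_eq f00'; lia.
  rewrite cats0; split=> //=.
  move=> a ha na; rewrite update_neq ?fr // => a7; by move: na; rewrite a7.
- case=> f h [bs [rest [vsE sl' ht f4 em1]]] guard.
  have [/= hE f9 stf fr] := em1; rewrite /= in sl' ht f4.
  have f0' : f 0%N = r by rewrite fr.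
  have f6' : f 6%N = e by rewrite fr.
  have te : (f 7 <= e)%N by move: guard; rewrite /= f6'.
  have [t tE] : {t | t = f 7%N} by eexists.
  rewrite -tE in sl' ht te.
  have iC : inside m n ((c, c), (r, e)) by rewrite /inside /=; lia.
  have [[]|[? [? [_]]]|[x [rest' [_ _ gr sl2 restE]]]] := slice_inv sl'.
  + by rewrite /=; lia.
  + by rewrite opt_cell_row ?ltNge ?tau_ge0 //=; lia.
  apply: wp_seq; apply: wp_loop_free => // t1 ht1 /=.
  apply: wp_seq.
  pose ok e' := opt D^T 1 (cols ((c, c), (r, e)) t e') <= tau.
  have upd8 y v : update (update f 8 (f 7%N)) 8 v y = if y == 8 then v else f y.
    by rewrite /update; case: eqP.
  apply: (grow_wp (ok := ok) (lo := t) (H := e)).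
  + by rewrite update_eq.
  + by [].
  + by move=> y hy; rewrite /= upd8.
  + move=> y hy; have iB : inside n m ((t, y.+1), (c, c)) by rewrite /inside /=; lia.
    rewrite (@fitsE R n m D inp inp_m tau _ _ _ _ _ t y.+1 c c) //=; rewrite ?upd8 ?hE //=.
      by rewrite /ok -(opt_tr D iB).
    by rewrite addn1.
  move=> y t2 gr' ht2; have xy := grows_to_uniq gr gr'; rewrite -xy in ht2 gr' *.
  have [cx _ _] := gr'; rewrite /= in cx.
  apply: wp_seq; apply: (emit_wp (m := m) (Bs := Bs ++ [seq tr_rect B | B <- bs])) => //.
  move=> f1 t3 f19 stf1 fr1 ht3; apply: wp_loop_free => // t4 ht4.
  rewrite !upd8 /= -tE f4 in stf1.
  have f14 : f1 4%N = c by rewrite fr1 // upd8.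
  have f18 : f1 8 = x by rewrite fr1 ?upd8 //; lia.
  split.
    exists (rcons bs ((c, c), (t, x))), rest'; split=> /=.
    + by rewrite vsE restE cat_rcons.
    + by rewrite update_eq f18 addn1.
    + by rewrite update_eq f18; lia.
    + by rewrite update_neq.
    rewrite map_rcons -rcons_cat; split=> //=.
    + by rewrite update_neq // f19 size_rcons.
    + move=> a ha na; rewrite update_neq; last by move=> a7; move: na; rewrite a7.
      rewrite fr1 //; last by apply/negP => /eqP a9; move: na; rewrite a9.
      by rewrite upd8 ifF ?fr //; apply/negP => /eqP a9; move: na; rewrite a9.
  rewrite /= update_eq f18 -tE.
  have P := @potential_step e.+1 x (x + 1) col_cost ltac:(lia) ltac:(lia).
  have P' : ((e.+1 - t) * col_cost = (x - t) * col_cost + (e.+1 - x) * col_cost)%N.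
    by rewrite -mulnDl; congr (_ * _)%N; lia.
  rewrite P'; apply: leq_trans (leq_add (leqnn _) P).
  have G : ((x - t) * grow_cost (ir 6) col_test <= (x - t) * col_cost)%N.
    by rewrite leq_mul2l /col_cost; apply/orP; right; lia.
  have {}ht1 : (t1 <= 10)%N by exact: leq_trans ht1 _.
  have {}ht4 : (t4 <= 10)%N by exact: leq_trans ht4 _.
  have cE : col_cost = (grow_cost (ir 6) col_test + emit_cost + bcost col_guard + 50)%N by [].
  move: ht2 ht3 G; rewrite mulSn; lia.
- move=> st' t [bs [rest [vsE sl' ht f4 em1]]] guard ht1.
  have [hE f9 stf fr] := em1.
  have te : icell st' 7 = e.+1 by move: guard; rewrite /= (fr 6%N) ?f06 //; lia.
  have rest0 : rest = [::].
    by have [[_ ->//]|[? [? [h1 _ _ _ _]]]|[? [? [h1 _ _ _ _]]]] := slice_inv sl';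
      move: h1; rewrite te /=; lia.
  apply: hQ => //; first by rewrite vsE rest0 cats0.
  have {}ht0 : (t0 <= 10)%N by exact: leq_trans ht0 _.
  have st0 : icell st 0 = r by case: em => _ _ _ ->.
  move: ht1; rewrite te subnn mul0n addn0 /= update_eq st0 mulSn.
  have cE : col_cost = (grow_cost (ir 6) col_test + emit_cost + bcost col_guard + 50)%N by [].
  lia.
Qed.

Lemma emission_wp f h Bs0 Bs Q : f 0%N = r -> f 6%N = e -> h = g ->
  f 9%N = size Bs0 -> stored m f Bs0 ->
  slice_partition D (rows m r e) tau Bs ->
  (forall f' t, f' 9%N = size (Bs0 ++ Bs) -> stored m f' (Bs0 ++ Bs) ->
     f' 6%N = e ->
     (t <= m.+1 * pass_cost emit_cost ((e.+1 - r).+1 * col_cost))%N -> Q (Memory f' g) t) ->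
  wp inp (slice_pass emit_strip emit_col) (Memory f h) Q.
Proof.
move=> f00 f06 -> f9 stf sl hQ.
apply: (@slice_pass_wp R n m D inp tau g r e inp_m m_gt0 re tau_ge0 g_tables g_tau
  (fun st Bs => emitted f st (Bs0 ++ Bs)) emit_strip emit_col emit_cost
  ((e.+1 - r).+1 * col_cost)%N _ _ _ _ _ _ Bs) => //.
- by move=> st Bs' [].
- by move=> st Bs' [_ _ _ fr]; rewrite !fr //; lia.
- move=> f1 h1 Bs' a v ha [/= h2 h3 h4 h5]; split=> //=.
  + by rewrite update_neq //; case: ha => ->.
  + by apply: stored_frame h4 => b hb; rewrite update_neq //; lia.
  + move=> b hb nb; rewrite update_neq ?h5 // => ba; move: nb; rewrite ba.
    by case: ha => ->.
- move=> [f1 h1] Bs' c x [/= h2 h3 h4 h5] f4 f5 hx; rewrite h2.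
  apply: (emit_wp (m := m) (Bs := Bs0 ++ Bs')) => // f2 t f29 stf2 fr2 ht.
  have f10 : f1 0%N = r by rewrite h5.
  have f16 : f1 6%N = e by rewrite h5.
  split=> //=; try by rewrite fr2 //; lia.
  rewrite f10 f16 f4 f5 in stf2; rewrite -rcons_cat; split=> //=.
  + by rewrite f29 size_rcons.
  + move=> a ha na; rewrite fr2 ?h5 //; by apply/negP => /eqP a9; move: na; rewrite a9.
- move=> st Bs' c vs em st4 cm slv; apply: (emit_col_wp f00 f06 em st4 cm slv).
  by move=> st' t em' st4' ht; split=> //; rewrite catA.
- by rewrite cats0; split.
- move=> [f' h'] t [/= -> h2 h3 h4] ht; apply: hQ => //.
  by rewrite h4 //; lia.
Qed.

End Emission.

Definition partition_init := Seq (iset 0 (IConst 0)) (iset 9 (IConst 0)).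
Definition partition_guard := BLtI (ir 0) nI.
Definition partition_prog := Seq partition_init (While partition_guard
  (Seq slab_grow (Seq (slice_pass emit_strip emit_col) (iset 0 (isucc (ir 6)))))).
Definition partition_row_cost :=
  (3 * slab_cost + pass_cost emit_cost 0 + 2 * col_cost + bcost partition_guard + 50)%N.
Definition partition_cost := (3 * partition_row_cost + partition_row_cost)%N.

Lemma partition_prog_wp (R : realType) n m (D : 'M[R]_(n, m)) (inp : memory R)
    gamma sigma (f : nat -> nat) (g : nat -> R) Q :
  icell inp 0 = n -> icell inp 1 = m -> (0 < n)%N -> (0 < m)%N -> 0 <= sigma ->
  tables D g -> g 0%N = gamma ^+ 2 * sigma -> g 1%N = gamma^-1 ->
  (forall f' Bs t, Defs.partition D gamma sigma Bs -> f' 9%N = size Bs -> stored m f' Bs ->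
     (t <= n * m * partition_cost)%N -> Q (Memory f' g) t) ->
  wp inp partition_prog (Memory f g) Q.
Proof.
move=> inp_n inp_m n0 m0 s0 T g0 g1 hQ.
have tau0 : 0 <= gamma ^+ 2 * sigma by rewrite mulr_ge0 ?sqr_ge0.
apply: wp_seq; apply: wp_loop_free => // t0 ht0 /=.
set f0 := update _ 9 0%N.
have f00 : f0 0%N = 0%N by rewrite /f0 update_neq // update_eq.
have f09 : f0 9%N = 0%N by rewrite /f0 update_eq.
apply: (wp_while (Inv := fun st => exists f' bs, [/\ st = Memory f' g, (f' 0%N <= n)%N,
    f' 9%N = size bs, stored m f' bs &
    forall rest, partition_loop D gamma sigma (f' 0%N) rest ->
      partition_loop D gamma sigma 0 (bs ++ rest)])
  (Phi := fun st => ((n - icell st 0) * (m.+2 * partition_row_cost))%N)).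
- by exists f0, [::]; split; rewrite ?f00 //.
- move=> _ [f1 [bs [-> f1n f19 st1 cont]]] guard.
  have [r rE] : {r | r = f1 0%N} by eexists.
  have rn : (r < n)%N by move: guard; rewrite /= inp_n -rE; lia.
  rewrite -rE in cont; apply: wp_seq.
  apply: (slab_grow_wp inp_n inp_m m0 rn tau0 T g0 g1) => // f2 e B' t1 f26 re slr hif fr ht1.
  have iE : inside n m (rows m r e) by rewrite /inside /=; lia.
  have [Bs sl] : exists Bs, slice_partition D (rows m r e) (gamma ^+ 2 * sigma) Bs.
    exact: slice_ex.
  have f20 : f2 0%N = r by rewrite fr.
  have f29 : f2 9%N = size bs by rewrite fr.
  have st2 : stored m f2 bs.
    by apply: stored_frame st1 => a ha; rewrite fr //; lia.
  apply: wp_seq; apply: (emission_wp inp_m m0 re tau0 T g0 f20 f26 erefl f29 st2 sl).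
  move=> f3 t2 f39 st3 f36 ht2; apply: wp_loop_free => // t3 ht3 /=.
  have e1 : (f3 6%N + 1 = e.+1)%N by rewrite f36 addn1.
  rewrite update_eq e1; split.
    exists (update f3 0 e.+1), (bs ++ Bs); split=> //.
      by rewrite update_eq; lia.
    move=> rest; rewrite update_eq -catA => part; apply: cont.
    by apply: (partition_step rn slr hif sl part).
  have {}ht3 : (t3 <= 10)%N by exact: leq_trans ht3 _.
  have P : ((n - r) * (m.+2 * partition_row_cost)
     = (e.+1 - r) * (m.+2 * partition_row_cost) + (n - e.+1) * (m.+2 * partition_row_cost))%N.
    by rewrite -mulnDl; congr (_ * _)%N; lia.
  rewrite -rE P ltn_add2r.
  have [h hE] : {h | h = (e.+1 - r)%N} by eexists.
  have h1 : (0 < h)%N by lia.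
  (* With [h >= 1] rows, [h + 1 <= 2 h]: the refused row is charged to the slab that it ended. *)
  have c1 : ((e.+2 - r) * (m.+2 * slab_cost) <= h * (m.+2 * (2 * slab_cost)))%N.
    have -> : (e.+2 - r = h.+1)%N by lia.
    by move: h1; move: (m.+2) (slab_cost) => a b; nia.
  have c2 : (m.+1 * pass_cost emit_cost ((e.+1 - r).+1 * col_cost)
      <= h * (m.+2 * (pass_cost emit_cost 0 + 2 * col_cost)))%N.
    rewrite -hE; have -> : pass_cost emit_cost (h.+1 * col_cost)
        = (pass_cost emit_cost 0 + h.+1 * col_cost)%N by rewrite /pass_cost; lia.
    move: h1; move: (pass_cost emit_cost 0) (col_cost) => a b; nia.
  have c3 : (slab_cost + bcost partition_guard + 50 <=
      h * (m.+2 * (slab_cost + bcost partition_guard + 50)))%N.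
    by move: h1; move: (slab_cost + bcost partition_guard + 50)%N => a; nia.
  have c4 : (h * (m.+2 * partition_row_cost) = h * (m.+2 * (2 * slab_cost))
     + h * (m.+2 * (pass_cost emit_cost 0 + 2 * col_cost))
     + h * (m.+2 * (slab_cost + bcost partition_guard + 50)))%N.
    by rewrite -!mulnDr; congr (_ * (_ * _))%N; rewrite /partition_row_cost; lia.
  by rewrite -hE c4; lia.
- move=> _ t1 [f1 [bs [-> f1n f19 st1 cont]]] guard ht1.
  have f10 : f1 0%N = n by move: guard; rewrite /= inp_n; lia.
  apply: (hQ f1 bs) => //.
    by rewrite -[bs]cats0; apply: cont; rewrite f10; apply: partition_done.
  move: ht1; rewrite /= f00 f10 subnn mul0n addn0 subn0 => ht1.
  have {}ht0 : (t0 <= 10)%N by exact: leq_trans ht0 _.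
  (* Since [m >= 1], [m + 2 <= 3 m]. *)
  have c1 : (n * (m.+2 * partition_row_cost) <= n * m * (3 * partition_row_cost))%N.
    by move: m0; move: partition_row_cost => a; nia.
  have c2 : (bcost partition_guard + 50 <= n * m * partition_row_cost)%N.
    apply: (@leq_trans partition_row_cost); first by rewrite /partition_row_cost; lia.
    by rewrite leq_pmull // muln_gt0 n0.
  have c3 : (n * m * partition_cost = n * m * (3 * partition_row_cost) + n * m * partition_row_cost)%N.
    by rewrite -mulnDr.
  by rewrite c3; lia.
Qed.

(** * Filling the tables of prefix sums *)

Definition entry := RInput (IAdd (IMul (ISub (ir 0) (IConst 1)) mI) (ISub (ir 1) (IConst 1))).
Definition cell_addr k e := IAdd (IConst (16 + k)) (IMul (IConst 2) e).
(** Register 2 is the row-major position: [m + 1] back is the entry above, 1 back the entry to the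
    left, [m + 2] back the diagonal one. *)
Definition table_next k y :=
  RAdd (RSub (RAdd (RLoad (cell_addr k (ISub (ir 2) (IAdd mI (IConst 1)))))
    (RLoad (cell_addr k (ISub (ir 2) (IConst 1)))))
    (RLoad (cell_addr k (ISub (ir 2) (IAdd mI (IConst 2)))))) y.
Definition table_store v1 v2 := Seq (RStore (cell_addr 0 (ir 2)) v1) (RStore (cell_addr 1 (ir 2)) v2).
Definition table_zero := table_store (ROfInt (IConst 0)) (ROfInt (IConst 0)).
Definition table_fill := If (BLeI (ir 0) (IConst 0)) table_zero
  (If (BLeI (ir 1) (IConst 0)) table_zero
    (table_store (table_next 0 entry) (table_next 1 (RMul entry entry)))).
Definition table_move := Seq (iset 2 (isucc (ir 2)))
  (If (BLeI (isucc (ir 1)) mI) (iset 1 (isucc (ir 1))) (Seq (iset 1 (IConst 0)) (iset 0 (isucc (ir 0))))).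
Definition tables_init := Seq (iset 0 (IConst 0)) (Seq (iset 1 (IConst 0)) (iset 2 (IConst 0))).
Definition tables_guard := BLeI (ir 0) nI.
Definition tables_prog := Seq tables_init (While tables_guard (Seq table_fill table_move)).
Definition tables_step_cost := (max_cost table_fill + max_cost table_move + bcost tables_guard + 50)%N.
Definition tables_cost := (5 * tables_step_cost)%N.

Section Tables.
Variables (R : realType) (n m : nat) (D : 'M[R]_(n, m)) (inp : memory R).
Hypotheses (inp_n : icell inp 0 = n) (inp_m : icell inp 1 = m).
Hypotheses (n_gt0 : (0 < n)%N) (m_gt0 : (0 < m)%N).
Hypothesis inp_D : forall (i : 'I_n) (j : 'I_m), rcell inp (i * m + j)%N = D i j.

Let P1 := pref (fun i j => D i j).
Let P2 := pref (fun i j => D i j ^+ 2).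

Lemma den_table_fill (f : nat -> nat) (g : nat -> R) i j :
  f 0%N = i -> f 1%N = j -> f 2%N = (i * m.+1 + j)%N -> (i <= n)%N -> (j <= m)%N ->
  (forall i' j', (j' <= m)%N -> (i' * m.+1 + j' < i * m.+1 + j)%N ->
     g (tab_index m i' j') = P1 i' j' /\ g (tab_index m i' j').+1 = P2 i' j') ->
  den inp table_fill (Memory f g)
  = Memory f (update (update g (tab_index m i j) (P1 i j)) (tab_index m i j).+1 (P2 i j)).
Proof.
move=> f0 f1 f2 hi hj tab; rewrite /table_fill; cbn [den].
have zeroE : den inp table_zero (Memory f g)
    = Memory f (update (update g (tab_index m i j) 0) (tab_index m i j).+1 0).
  by rewrite /table_zero /= f2 /tab_index addn0.
have -> : beval inp (Memory f g) (BLeI (ir 0) (IConst 0)) = (i == 0%N).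
  by rewrite /= f0 leqn0.
case: eqP => i0; first by rewrite zeroE i0 /P1 /P2 !pref0l.
have -> : beval inp (Memory f g) (BLeI (ir 1) (IConst 0)) = (j == 0%N).
  by rewrite /= f1 leqn0.
case: eqP => j0; first by rewrite zeroE j0 /P1 /P2 !pref0r.
have hi' : (i.-1 < n)%N by lia.
have hj' : (j.-1 < m)%N by lia.
have iE : i = (Ordinal hi').+1 by rewrite /=; lia.
have jE : j = (Ordinal hj').+1 by rewrite /=; lia.
have entryE h : reval inp (Memory f h) entry = D (Ordinal hi') (Ordinal hj').
  by rewrite -inp_D /= f0 f1 inp_m !subn1.
have addrE k i' j' : (i' * m.+1 + j')%N = f 2%N ->
    (16 + k + 2 * f 2%N)%N = (k + tab_index m i' j')%N.
  by move=> <-; rewrite /tab_index; lia.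
have nextE h k y : (k <= 1)%N ->
    (forall i' j', (j' <= m)%N -> (i' * m.+1 + j' < i * m.+1 + j)%N ->
      h (k + tab_index m i' j')%N = g (k + tab_index m i' j')%N) ->
    reval inp (Memory f h) (table_next k y)
    = g (k + tab_index m i.-1 j)%N + g (k + tab_index m i j.-1)%N
      - g (k + tab_index m i.-1 j.-1)%N + reval inp (Memory f h) y.
  move=> k1 hh; rewrite -!hh; try by lia.
  rewrite /table_next /cell_addr; cbn [reval ieval ir isucc mI icell rcell].
  by rewrite inp_m f2 /tab_index; congr (h _ + h _ - h _ + _); nia.
rewrite /table_store; cbn [den]; cbn [icell rcell].
have a0 h : ieval inp (Memory f h) (cell_addr 0 (ir 2)) = tab_index m i j.
  by rewrite /= f2 /tab_index.
have a1 h : ieval inp (Memory f h) (cell_addr 1 (ir 2)) = (tab_index m i j).+1.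
  by rewrite /= f2 /tab_index.
rewrite a0 a1 !nextE //; last first.
  by move=> i' j' h1 h2; rewrite update_neq // /tab_index; lia.
have tE i' j' : (j' <= m)%N -> (i' * m.+1 + j' < i * m.+1 + j)%N ->
    g (0 + tab_index m i' j')%N = P1 i' j' /\ g (1 + tab_index m i' j')%N = P2 i' j'.
  exact: tab.
have [u1 u2] := tE i.-1 j ltac:(lia) ltac:(nia).
have [v1 v2] := tE i j.-1 ltac:(lia) ltac:(lia).
have [w1 w2] := tE i.-1 j.-1 ltac:(lia) ltac:(nia).
rewrite u1 u2 v1 v2 w1 w2.
have -> : P1 i j = P1 i.-1 j + P1 i j.-1 - P1 i.-1 j.-1 + D (Ordinal hi') (Ordinal hj').
  by rewrite {1 2}iE {1 2}jE /P1 prefS /= -iE -jE.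
have -> : P2 i j = P2 i.-1 j + P2 i j.-1 - P2 i.-1 j.-1 + D (Ordinal hi') (Ordinal hj') ^+ 2.
  by rewrite {1 2}iE {1 2}jE /P2 prefS /= -iE -jE.
by cbn [reval]; rewrite !entryE expr2.
Qed.

Lemma tables_prog_wp (f : nat -> nat) (g : nat -> R) Q :
  (forall f' g' t, tables D g' -> g' 0%N = g 0%N -> g' 1%N = g 1%N ->
     (t <= n * m * tables_cost)%N -> Q (Memory f' g') t) ->
  wp inp tables_prog (Memory f g) Q.
Proof.
move=> hQ; apply: wp_seq; apply: wp_loop_free => // t0 ht0 /=.
set f0 := update _ 2 0%N.
have [f00 f01 f02] : [/\ f0 0%N = 0%N, f0 1%N = 0%N & f0 2%N = 0%N] by [].
apply: (wp_while (Inv := fun st => exists f' g', [/\ st = Memory f' g',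
    f' 2%N = (f' 0%N * m.+1 + f' 1%N)%N,
    (f' 0%N <= n)%N && (f' 1%N <= m)%N || (f' 0%N == n.+1) && (f' 1%N == 0%N),
    g' 0%N = g 0%N /\ g' 1%N = g 1%N &
    forall i j, (j <= m)%N -> (i * m.+1 + j < f' 2%N)%N ->
      g' (tab_index m i j) = P1 i j /\ g' (tab_index m i j).+1 = P2 i j])
  (Phi := fun st => ((n.+1 * m.+1 - icell st 2) * tables_step_cost)%N)).
- by exists f0, g; rewrite f00 f01 f02; split=> // i j; lia.
- move=> _ [f' [g' [-> f2 hij g01 tab]]] guard.
  have [i iE] : {i | i = f' 0%N} by eexists.
  have [j jE] : {j | j = f' 1%N} by eexists.
  have hi : (i <= n)%N by move: guard; rewrite /= inp_n -iE; lia.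
  have hj : (j <= m)%N by move: hij; rewrite -iE -jE; lia.
  rewrite -iE -jE in f2; rewrite f2 in tab.
  apply: wp_loop_free => // t ht; cbn [den].
  rewrite (den_table_fill (esym iE) (esym jE) f2 hi hj tab).
  set g1 := update (update g' _ _) _ _.
  have tab1 i' j' : (j' <= m)%N -> (i' * m.+1 + j' < (i * m.+1 + j).+1)%N ->
      g1 (tab_index m i' j') = P1 i' j' /\ g1 (tab_index m i' j').+1 = P2 i' j'.
    move=> h1 h2; have [E|ne] := eqVneq (i' * m.+1 + j')%N (i * m.+1 + j)%N.
      have ii : i' = i.
        have := congr1 (fun x => (x %/ m.+1)%N) E.
        by rewrite !divnMDl // !divn_small // !addn0.
      have jj : j' = j by move: E; rewrite ii; lia.
      rewrite ii jj.
      by rewrite /g1 update_eq update_neq ?update_eq //; lia.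
    have [<- <-] := tab i' j' h1 ltac:(lia).
    by rewrite /g1 /tab_index !update_neq //; lia.
  have g1c a : (a < 16)%N -> g1 a = g' a.
    by move=> ha; rewrite /g1 !update_neq // /tab_index; lia.
  have [f1 [mv f12 hij1]] : exists f1, [/\ den inp table_move (Memory f' g1) = Memory f1 g1,
      f1 2%N = (i * m.+1 + j).+1 &
      f1 2%N = (f1 0%N * m.+1 + f1 1%N)%N /\
      ((f1 0%N <= n)%N && (f1 1%N <= m)%N || (f1 0%N == n.+1) && (f1 1%N == 0%N))].
    have bE h : h 1%N = j -> beval inp (Memory h g1) (BLeI (isucc (ir 1)) mI) = (j < m)%N.
      by move=> E; rewrite /= E inp_m addn1.
    rewrite /table_move /iset; cbn [den ieval isucc ir icell rcell].
    rewrite f2 addn1 bE ?update_neq // -?jE //.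
    case: ltnP => jm.
      exists (update (update f' 2 (i * m.+1 + j).+1) 1 j.+1).
      split; first by rewrite addn1.
        by rewrite update_neq // update_eq.
      rewrite update_neq // !update_eq (update_neq _ _ (a := 1%N)) // update_neq // -iE.
      by split; lia.
    have jm' : j = m by lia.
    exists (update (update (update f' 2 (i * m.+1 + j).+1) 1 0%N) 0 i.+1).
    split; first by rewrite ?update_neq // -?iE addn1.
      by [].
    rewrite update_eq !(update_neq _ _ (a := 0%N)) // update_eq update_neq // update_eq.
    by rewrite jm'; split; lia.
  rewrite mv /=; split.
    exists f1, g1; case: hij1 => h1 h2; split=> //; rewrite f12 => i0 j0; exact: tab1.
  have P := @potential_step (n.+1 * m.+1) (i * m.+1 + j) (i * m.+1 + j).+1 tables_step_cost
    ltac:(lia) ltac:(nia).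
  have cE : tables_step_cost
     = (max_cost table_fill + max_cost table_move + bcost tables_guard + 50)%N by [].
  have {}ht : (t <= max_cost table_fill + max_cost table_move + 1)%N.
    by apply: leq_trans ht _; rewrite {1}/max_cost -/max_cost; lia.
  by rewrite f2 f12; lia.
- move=> _ t [f' [g' [-> f2 hij [g0 g1] tab]]] guard ht.
  have [hi hj] : f' 0%N = n.+1 /\ f' 1%N = 0%N.
    by move: guard; rewrite /= inp_n; lia.
  apply: hQ => //.
    by move=> i j hi' hj'; apply: tab => //; rewrite f2 hi; nia.
  have {}ht0 : (t0 <= 12)%N by exact: leq_trans ht0 _.
  move: ht; rewrite /= f2 hi hj f02 addn0 subnn mul0n addn0 subn0 => ht.
  (* The table has a border, and [(n + 1) (m + 1) <= 4 n m] for positive dimensions. *)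
  have c1 : (n.+1 * m.+1 * tables_step_cost <= n * m * (4 * tables_step_cost))%N.
    have : (n.+1 * m.+1 <= n * m * 4)%N by nia.
    by move: (tables_step_cost) => a; nia.
  have c2 : (bcost tables_guard + 50 <= n * m * tables_step_cost)%N.
    apply: (@leq_trans tables_step_cost); first by rewrite /tables_step_cost; lia.
    by rewrite leq_pmull // muln_gt0 n_gt0.
  have c3 : (n * m * tables_cost = n * m * (4 * tables_step_cost) + n * m * tables_step_cost)%N.
    by rewrite -mulnDr /tables_cost; congr (_ * _)%N; lia.
  by rewrite c3; lia.
Qed.

End Tables.

(** * Loss of the approximation and parameters of the partition *)

Lemma sum_row_major (R : realType) n m (F : nat -> R) :
  \sum_(i < n) \sum_(j < m) F (i * m + j)%N = \sum_(0 <= x < n * m) F x.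
Proof.
elim: n => [|n IH]; first by rewrite big_ord0 mul0n big_geq.
rewrite big_ord_recr /= IH mulSn addnC [RHS](@big_cat_nat _ _ _ (n * m)) ?leq_addr //=.
congr (_ + _); rewrite -[X in \sum_(X <= _ < _) _](add0n (n * m)%N) big_addn addKn big_mkord.
by apply: eq_bigr => j _; rewrite addnC.
Qed.

(** The first cell after the output of the approximation program, so that accumulating the loss
    destroys none of its values. *)
Definition acc_addr := IAdd (IConst 2) (IMul nI mI).
Definition loss_diff := RSub (RLoad (IAdd (IConst 2) (ir 0))) (RInput (ir 0)).
Definition loss_init := Seq (iset 0 (IConst 0)) (RStore acc_addr (ROfInt (IConst 0))).
Definition loss_step := Seq (RStore acc_addr (RAdd (RLoad acc_addr) (RMul loss_diff loss_diff)))
  (iset 0 (isucc (ir 0))).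
Definition loss_guard := BLtI (ir 0) (IMul nI mI).
Definition eps_in := RInput (IMul nI mI).
(** The first entry of [s], then [alpha], then [beta] are overwritten, each after its last use, by
    [gamma], the threshold and [1 / gamma]. *)
Definition parameters := Seq (rset 2 (RDiv (RMul eps_in eps_in) (RMul (rr 1) (ROfInt (IInput (IConst 2))))))
  (Seq (rset 0 (RMul (RMul (rr 2) (rr 2)) (RDiv (RLoad acc_addr) (rr 0))))
    (rset 1 (RDiv (ROfInt (IConst 1)) (rr 2)))).
Definition loss_prog := Seq loss_init (Seq (While loss_guard loss_step) parameters).
Definition loss_step_cost := (max_cost loss_step + bcost loss_guard + 50)%N.
Definition loss_cost := (loss_step_cost + (loss_step_cost + max_cost parameters + max_cost loss_init))%N.

Lemma loss_prog_wp (R : realType) n m k (D s : 'M[R]_(n, m)) (inp : memory R)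
    (f : nat -> nat) (g : nat -> R) alpha beta eps gamma sigma Q :
  icell inp 0 = n -> icell inp 1 = m -> icell inp 2 = k -> (0 < n)%N -> (0 < m)%N ->
  (forall (i : 'I_n) (j : 'I_m), rcell inp (i * m + j)%N = D i j) ->
  rcell inp (n * m)%N = eps ->
  g 0%N = alpha -> g 1%N = beta ->
  (forall (i : 'I_n) (j : 'I_m), g (2 + (i * m + j))%N = s i j) ->
  gamma = eps ^+ 2 / (beta * k%:R) -> sigma = loss D (full_rect n m) s / alpha ->
  (forall f' g' t, g' 0%N = gamma ^+ 2 * sigma -> g' 1%N = gamma^-1 ->
     (t <= n * m * loss_cost)%N -> Q (Memory f' g') t) ->
  wp inp loss_prog (Memory f g) Q.
Proof.
move=> inp_n inp_m inp_k n0 m0 inp_D inp_e g0 g1 gs gE sE hQ.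
have nm0 : (0 < n * m)%N by rewrite muln_gt0 n0.
pose A := (2 + n * m)%N.
have accE h : ieval inp h acc_addr = A by rewrite /= inp_n inp_m.
pose F x := (g (2 + x)%N - rcell inp x) ^+ 2.
apply: wp_seq; apply: wp_loop_free => // t0 ht0; rewrite /loss_init /iset; cbn [den]; rewrite accE; cbn [icell rcell reval ieval].
apply: wp_seq; apply: (wp_while (Inv := fun st => exists f', (f' 0%N <= n * m)%N /\
    st = Memory f' (update g A (\sum_(0 <= x < f' 0%N) F x)))
  (Phi := fun st => ((n * m - icell st 0) * loss_step_cost)%N)).
- exists (update f 0 0%N); split; first by rewrite update_eq.
  by rewrite update_eq big_geq.
- move=> _ [f' [hx ->]] guard; apply: wp_loop_free => // t ht.
  have [x xE] : {x | x = f' 0%N} by eexists.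
  have xlt : (x < n * m)%N by move: guard; rewrite /= inp_n inp_m -xE; lia.
  rewrite /loss_step /iset; cbn [den]; rewrite accE; cbn [icell rcell reval].
  rewrite accE /= -xE update_eq update_neq; last by rewrite /A; lia.
  split.
    exists (update f' 0 (x + 1)%N); rewrite update_eq; split; first by lia.
    congr Memory; apply/funext => y; rewrite /update; case: eqP => // _.
    by rewrite addn1 big_nat_recr //= expr2.
  rewrite update_eq.
  have P := @potential_step (n * m) x (x + 1) loss_step_cost ltac:(lia) ltac:(lia).
  have cE : loss_step_cost = (max_cost loss_step + bcost loss_guard + 50)%N by [].
  by lia.
- move=> _ t [f' [hx ->]] guard ht.
  have xE : f' 0%N = (n * m)%N by move: guard; rewrite /= inp_n inp_m; lia.
  have LE : \sum_(0 <= x < f' 0%N) F x = loss D (full_rect n m) s.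
    rewrite xE -sum_row_major lossE bsum_full; apply: eq_bigr => i _.
    by apply: eq_bigr => j _; rewrite /F gs inp_D.
  apply: wp_loop_free => // t1 ht1.
  have stE : den inp parameters (Memory f' (update g A (\sum_(0 <= x < f' 0%N) F x)))
    = Memory f' (update (update (update (update g A (loss D (full_rect n m) s)) 2 gamma)
         0 (gamma ^+ 2 * sigma)) 1 gamma^-1).
    rewrite LE /parameters /rset; cbn [den]; cbn [icell rcell reval ieval rr ir eps_in acc_addr nI mI].
    rewrite inp_n inp_m inp_k inp_e -/A.
    have A0 : A <> 0%N by rewrite /A; lia.
    have A1 : A <> 1%N by rewrite /A; lia.
    have A2 : A <> 2%N by rewrite /A; lia.
    have uA h v x : x <> A -> update h A v x = h x by exact: update_neq.
    rewrite !(update_eq, uA, update_neq _ _ (a := 2%N), update_neq _ _ (a := 0%N)) //; try exact: nesym.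
    by rewrite g0 g1 gE sE !expr2 div1r.
  rewrite stE; apply: hQ.
  - by rewrite update_neq // update_eq.
  - by rewrite update_eq.
  have [hA hB] : (t0 <= max_cost loss_init)%N /\ (t1 <= max_cost parameters)%N by [].
  move: ht; cbn [icell]; rewrite xE update_eq subnn mul0n addn0 subn0 => ht.
  have c : (bcost loss_guard + 50 + max_cost parameters + max_cost loss_init
      <= n * m * (loss_step_cost + max_cost parameters + max_cost loss_init))%N.
    apply: leq_trans (leq_pmull _ nm0).
    by rewrite /loss_step_cost; lia.
  rewrite /loss_cost mulnDr; lia.
Qed.

(** * Caratheodory points of a block *)

(* Let a <= b be the extreme labels of a block, z the point for which
   \sum_y (y - a) (y - z) = 0, and p <= z <= q the labels next to z. The weights of
   a, p, q with the required moments are quotients of \sum_y (y - p) (y - q), which has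
   only nonnegative terms, of - \sum_y (y - a) (y - q), a multiple of q - z, and of
   \sum_y (y - a) (y - p), a multiple of z - p. The fourth point has weight zero. *)
Definition weights (R : realType) (M0 M1 M2 a b p q : R) : R * R * R :=
  if b <= a then (M0, 0, 0)
  else if q <= p then (M0 - (M1 - a * M0) / (p - a), (M1 - a * M0) / (p - a), 0)
  else ((M2 - (p + q) * M1 + p * q * M0) / ((p - a) * (q - a)),
        - ((M2 - (a + q) * M1 + a * q * M0) / ((p - a) * (q - p))),
        (M2 - (a + p) * M1 + a * p * M0) / ((q - a) * (q - p))).

Section Caratheodory.
Variables (R : realType) (n m : nat) (D : 'M[R]_(n, m)) (B : rect).
Let M0 := area R n m B.
Let M1 := bsum (fun i j => D i j) B.
Let M2 := bsum (fun i j => D i j ^+ 2) B.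

Definition label (y : R) := exists (i : 'I_n) (j : 'I_m), in_rect B i j /\ D i j = y.

Lemma quadratic_sum u v :
  bsum (fun i j => (D i j - u) * (D i j - v)) B = M2 - (u + v) * M1 + u * v * M0.
Proof.
rewrite /M2 /M1 /M0 /area -mulNr -!bsumZ -!bsumD; apply: eq_bsum => i j _; ring.
Qed.

Lemma quadratic_ge0 u v : (forall y, label y -> 0 <= (y - u) * (y - v)) ->
  0 <= M2 - (u + v) * M1 + u * v * M0.
Proof.
move=> h; rewrite -quadratic_sum; apply: sumr_ge0 => i _; apply: sumr_ge0 => j ij.
by apply: h; exists i, j.
Qed.

Lemma quadratic_gt0 u v y : (forall y, label y -> 0 <= (y - u) * (y - v)) ->
  label y -> 0 < (y - u) * (y - v) -> 0 < M2 - (u + v) * M1 + u * v * M0.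
Proof.
move=> h [i [j [ij <-]]] gt; rewrite -quadratic_sum /bsum (bigD1 i) //= (bigD1 j) //=.
rewrite -addrA ltr_wpDr // addr_ge0 //.
  by apply: sumr_ge0 => j' /andP[ij' _]; apply: h; exists i, j'.
by apply: sumr_ge0 => i' _; apply: sumr_ge0 => j' ij'; apply: h; exists i', j'.
Qed.

Lemma linear_gt0 a b : (forall y, label y -> a <= y) -> label b -> a < b -> 0 < M1 - a * M0.
Proof.
move=> h [i [j [ij <-]]] gt.
have -> : M1 - a * M0 = bsum (fun i j => D i j - a) B.
  rewrite /M1 /M0 /area -mulNr -!bsumZ -!bsumD; apply: eq_bsum => i' j' _; ring.
rewrite /bsum (bigD1 i) //= (bigD1 j) //= -addrA ltr_wpDr ?subr_gt0 // addr_ge0 //.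
  by apply: sumr_ge0 => j' /andP[ij' _]; rewrite subr_ge0; apply: h; exists i, j'.
by apply: sumr_ge0 => i' _; apply: sumr_ge0 => j' ij'; rewrite subr_ge0; apply: h; exists i', j'.
Qed.

Variables (a b p q : R).
Let z := (M2 - a * M1) / (M1 - a * M0).
Hypotheses (a_label : label a) (b_label : label b) (p_label : label p) (q_label : label q).
Hypothesis ab : forall y, label y -> a <= y <= b.
Hypothesis p_max : forall y, label y -> y <= z -> y <= p.
Hypothesis q_min : forall y, label y -> z <= y -> q <= y.
Hypotheses (p_z : p <= z \/ p = a) (q_z : z <= q \/ q = b).

Lemma weightsP : let: (wa, wp, wq) := weights M0 M1 M2 a b p q in
  [/\ 0 <= wa, 0 <= wp & 0 <= wq] /\
  [/\ wa + wp + wq = M0, wa * a + wp * p + wq * q = M1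
    & wa * a ^+ 2 + wp * p ^+ 2 + wq * q ^+ 2 = M2].
Proof.
have ay y : label y -> a <= y by move=> /ab/andP[].
have yb y : label y -> y <= b by move=> /ab/andP[].
have W0 : 0 <= M0 by exact: area_ge0.
rewrite /weights; case: leP => [ba|a_b].
  have E y : label y -> y = a.
    by move=> ly; apply/eqP; rewrite eq_le ay // andbT (le_trans (yb y ly)).
  split=> //; rewrite !mul0r !addr0; split=> //.
    rewrite mulrC /M0 /area -bsumZ; apply: eq_bsum => i j ij.
    by rewrite mulr1 -(E (D i j)) //; exists i, j.
  rewrite mulrC /M0 /area -bsumZ; apply: eq_bsum => i j ij.
  by rewrite mulr1 -(E (D i j)) //; exists i, j.
have S0 : 0 < M1 - a * M0 by exact: linear_gt0 a_b.
have zE : M2 - a * M1 = z * (M1 - a * M0) by rewrite mulfVK // gt_eqF.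
(* The sum of [(y - a) (y - v)] is affine in [v] and vanishes at [z]; its sign is that of
   [z - v]. *)
have quadE v : M2 - (a + v) * M1 + a * v * M0 = (z - v) * (M1 - a * M0).
  by rewrite mulrBl -zE; ring.
have zb : z <= b.
  have : 0 <= - (M2 - (a + b) * M1 + a * b * M0).
    rewrite -quadratic_sum -mulN1r -bsumZ; apply: sumr_ge0 => i _; apply: sumr_ge0 => j ij.
    have ly : label (D i j) by exists i, j.
    rewrite mulN1r -mulrN opprB mulr_ge0 // subr_ge0; [exact: ay|exact: yb].
  by rewrite quadE -mulNr pmulr_lge0 // oppr_ge0 subr_le0.
have az : a < z.
  rewrite -subr_gt0 -(pmulr_lgt0 _ S0) -quadE.
  apply: (@quadratic_gt0 a a b) => // [y _|]; first by rewrite -expr2 sqr_ge0.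
  by rewrite mulr_gt0 // subr_gt0.
have zq : z <= q by case: q_z => [//|->].
have pz : p <= z by case: p_z => [//|->]; exact: ltW.
(* If [p] were [a], no label would lie above [a] and up to [z]. All terms [(y - a) (y - z)] would be
   nonnegative and the one at [b] positive, although their sum is 0. *)
have ap : a < p.
  rewrite lt_neqAle ay // andbT; apply/eqP => pa.
  have zb' : z < b.
    rewrite lt_neqAle zb andbT; apply/eqP => bz.
    by have := p_max b_label; rewrite bz => /(_ (lexx _)); rewrite -pa leNgt a_b.
  have : 0 < M2 - (a + z) * M1 + a * z * M0.
    apply: (@quadratic_gt0 a z b) => // [y ly|]; last by rewrite mulr_gt0 // subr_gt0.
    have [yz|zy] := leP y z.
      have := p_max ly yz; rewrite -pa => ya.
      have -> : y = a by apply/eqP; rewrite eq_le ya ay.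
      by rewrite subrr mul0r.
    by rewrite mulr_ge0 // subr_ge0 ?ay // ltW.
  by rewrite quadE subrr mul0r ltxx.
have pa0 : p - a != 0 by rewrite subr_eq0 gt_eqF.
case: leP => [qp|pq].
  (* [q <= p] squeezes both onto [z], which is thus a label, and the points [a] and [z] carry all
     the weight. *)
  have pE : p = z by apply/eqP; rewrite eq_le pz (le_trans zq).
  have eq1 : M0 - (M1 - a * M0) / (p - a) + (M1 - a * M0) / (p - a) = M0 by rewrite subrK.
  split; last first.
    rewrite !mul0r !addr0; split=> //; first by field.
    have -> : M2 = p * (M1 - a * M0) + a * M1 by rewrite pE -zE subrK.
    by field.
  split=> //; last by rewrite divr_ge0 ?(ltW S0) // subr_ge0 ltW.
  (* Multiplied by this square, the weight of [a] becomes the sum of [(y - p)^2]. *)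
  have pap : 0 < (p - a) ^+ 2 by rewrite exprn_gt0 // subr_gt0.
  rewrite -(pmulr_lge0 _ pap).
  have -> : (M0 - (M1 - a * M0) / (p - a)) * (p - a) ^+ 2 = M2 - (p + p) * M1 + p * p * M0.
    have -> : M2 = p * (M1 - a * M0) + a * M1 by rewrite pE -zE subrK.
    by field.
  by apply: quadratic_ge0 => y _; rewrite -expr2 sqr_ge0.
have aq : a < q by exact: lt_trans pq.
have qa0 : q - a != 0 by rewrite subr_eq0 gt_eqF.
have qp0 : q - p != 0 by rewrite subr_eq0 gt_eqF.
split; last by split; field; rewrite ?pa0 ?qa0 ?qp0.
split.
(* No label lies strictly between [p] and [q]. *)
- rewrite divr_ge0 ?mulr_ge0 ?subr_ge0 ?(ltW ap) ?(ltW aq) //.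
  apply: quadratic_ge0 => y ly; have [yz|zy] := leP y z.
    have yp := p_max ly yz.
    by rewrite mulr_le0 // subr_le0 // (le_trans yp) // ltW.
  have qy := q_min ly (ltW zy).
  by rewrite mulr_ge0 // subr_ge0 // (le_trans _ qy) // ltW.
- rewrite quadE -mulNr -mulNr divr_ge0 //.
    by rewrite mulr_ge0 ?(ltW S0) // opprB subr_ge0.
  by rewrite mulr_ge0 // subr_ge0 ltW.
- rewrite quadE divr_ge0 //.
    by rewrite mulr_ge0 ?(ltW S0) // subr_ge0.
  by rewrite mulr_ge0 // subr_ge0 ltW.
Qed.

Definition block_points (w : R * R * R) : seq (wpoint R) :=
  let: (wa, wp, wq) := w in
  [:: ((B.1.1, B.2.1), a, wa); ((B.1.1, B.2.2), p, wp);
      ((B.1.2, B.2.1), q, wq); ((B.1.2, B.2.2), a, 0)].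

Lemma block_points_coreset :
  block_coreset D B (block_points (weights M0 M1 M2 a b p q)).
Proof.
have := weightsP; case: weights => [[wa wp] wq] [[wa0 wp0 wq0] [e0 e1 e2]].
case: a_label p_label q_label => [ia [ja [ra ya]]] [ip [jp [rp yp]]] [iq [jq [rq yq]]].
pose X := [tuple (ia, ja); (ip, jp); (iq, jq); (ia, ja)].
pose W := [tuple wa; wp; wq; 0].
have sum4 (F : 'I_4 -> R) : \sum_(t < 4) F t = F ord0 + F (lift ord0 ord0) +
    F (lift ord0 (lift ord0 ord0)) + F (lift ord0 (lift ord0 (lift ord0 ord0))).
  by rewrite !big_ord_recl big_ord0 addr0 !addrA.
have E4 : enum 'I_4 = [:: ord0; lift ord0 ord0; lift ord0 (lift ord0 ord0);
    lift ord0 (lift ord0 (lift ord0 ord0))].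
  by apply: (inj_map val_inj); rewrite val_enum_ord.
exists (tnth X), (tnth W); split.
- move=> t; have : t \in enum 'I_4 by rewrite mem_enum.
  by rewrite E4 !inE => /or4P[] /eqP ->; rewrite (tnth_nth (ia, ja)).
- move=> t; have : t \in enum 'I_4 by rewrite mem_enum.
  by rewrite E4 !inE => /or4P[] /eqP ->; rewrite (tnth_nth 0).
- rewrite !sum4 !(tnth_nth 0) !(tnth_nth (ia, ja)) /= ya yp yq !mul0r !addr0.
  by split.
- rewrite E4; cbn [map].
  by rewrite !(tnth_nth (0 : R)) !(tnth_nth (ia, ja)) !(tnth_nth (0%N, 0%N)) /= ya yp yq.
Qed.

End Caratheodory.

(** * Programs for the Caratheodory points *)

Definition cur := RInput (IAdd (IMul (ir 1) mI) (ir 2)).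
Definition scan_step := If (BLtI (ir 2) (ir 6)) (iset 2 (isucc (ir 2)))
  (Seq (iset 2 (ir 5)) (iset 1 (isucc (ir 1)))).
Definition scan_guard := BLeI (ir 1) (ir 4).
(** Registers 3 to 6 bound the rectangle, and registers 1 and 2 are the current cell. *)
Definition scan body := Seq (Seq (iset 1 (ir 3)) (iset 2 (ir 5)))
  (While scan_guard (Seq body scan_step)).
Definition scan_cost body := (max_cost body + max_cost scan_step + bcost scan_guard + 30)%N.

Definition cells (B : rect) : nat := ((B.1.2.+1 - B.1.1) * (B.2.2.+1 - B.2.1))%N.

Lemma cells_gt0 n m B : inside n m B -> (0 < cells B)%N.
Proof. by rewrite /inside /cells muln_gt0 => h; apply/andP; split; lia. Qed.

Lemma den_scan_step (R : realType) (inp : memory R) (f : nat -> nat) g :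
  den inp scan_step (Memory f g) = Memory
    (if (f 2 < f 6)%N then update f 2 (f 2).+1
     else update (update f 2 (f 5)) 1 (f 1).+1) g.
Proof. by rewrite /scan_step /iset /=; rewrite !addn1; case: ifP. Qed.

Section Scan.
Variables (R : realType) (inp : memory R) (body : cmd).
Variables (B : rect) (step : nat -> nat -> (nat -> R) -> nat -> R).
Variables (G : (nat -> R) -> Prop) (P : nat -> nat -> (nat -> R) -> Prop).
Hypothesis body_loop_free : loop_free body.
Hypothesis body_step : forall f g i j, f 1%N = i -> f 2%N = j ->
  den inp body (Memory f g) = Memory f (step i j g).
Hypothesis step_G : forall i j g, in_rect B i j -> G g -> G (step i j g).
Hypothesis step_P : forall i j g, in_rect B i j -> G g -> P i j (step i j g).
Hypothesis step_keep : forall i j i' j' g, in_rect B i j -> in_rect B i' j' -> G g ->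
  P i' j' g -> P i' j' (step i j g).

(** A visit to a cell establishes [P] there and later visits keep it, so [P] holds everywhere at the
    end. The potential counts the unvisited cells in row-major order. *)
Lemma scan_wp (f : nat -> nat) (g : nat -> R) Q :
  f 3%N = B.1.1 -> f 4%N = B.1.2 -> f 5%N = B.2.1 -> f 6%N = B.2.2 ->
  (B.1.1 <= B.1.2)%N -> (B.2.1 <= B.2.2)%N -> G g ->
  (forall f' g' t, G g' -> (forall i j, in_rect B i j -> P i j g') ->
    (forall x, x != 1%N -> x != 2%N -> f' x = f x) ->
    (t <= (cells B).+1 * scan_cost body)%N -> Q (Memory f' g') t) ->
  wp inp (scan body) (Memory f g) Q.
Proof.
case: B step_G step_P step_keep => [[i1 i2] [j1 j2]] /= SG SP SK f3 f4 f5 f6 hi hj Gg hQ.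
have {SG SP SK} [SG SP SK] : [/\
  forall i j g, (i1 <= i <= i2)%N -> (j1 <= j <= j2)%N -> G g -> G (step i j g),
  forall i j g, (i1 <= i <= i2)%N -> (j1 <= j <= j2)%N -> G g -> P i j (step i j g) &
  forall i j i' j' g, (i1 <= i <= i2)%N -> (j1 <= j <= j2)%N ->
    (i1 <= i' <= i2)%N -> (j1 <= j' <= j2)%N -> G g -> P i' j' g -> P i' j' (step i j g)].
  split=> *; [apply: SG|apply: SP|apply: SK] => //; exact/andP.
have [w wE] : {w | w = (j2.+1 - j1)%N} by eexists.
apply: wp_seq; apply: wp_loop_free => // t0 ht0.
set st0 := den _ _ _.
have st0E : st0 = Memory (update (update f 1 i1) 2 j1) g.
  by rewrite -f3 -f5.
rewrite st0E.
apply: (wp_while (Inv := fun st => exists f' g', [/\ st = Memory f' g', G g',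
    (i1 <= f' 1%N <= i2)%N && (j1 <= f' 2%N <= j2)%N || (f' 1%N == i2.+1) && (f' 2%N == j1),
    forall x, x != 1%N -> x != 2%N -> f' x = f x &
    forall i j, (i1 <= i <= i2)%N -> (j1 <= j <= j2)%N ->
      (i < f' 1%N)%N || (i == f' 1%N) && (j < f' 2%N)%N -> P i j g'])
  (Phi := fun st => (((i2.+1 - icell st 1) * w - (icell st 2 - j1)) * scan_cost body)%N)).
- exists (update (update f 1 i1) 2 j1), g; split=> //.
  + by rewrite update_eq update_neq // update_eq; lia.
  + by move=> x x1 x2; rewrite !update_neq //; exact/eqP.
  + by rewrite update_eq update_neq // update_eq => i j; lia.
- move=> _ [f1 [g1 [-> Gg1 pos fr done]]] guard.
  have [i iE] : {i | i = f1 1%N} by eexists.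
  have [j jE] : {j | j = f1 2%N} by eexists.
  have f14 : f1 4%N = i2 by rewrite fr.
  have ile : (i <= i2)%N by move: guard; rewrite /= -iE f14.
  rewrite -iE -jE in pos.
  have [ir jr] : (i1 <= i <= i2)%N /\ (j1 <= j <= j2)%N by lia.
  apply: wp_loop_free => [|t ht]; first by rewrite /= body_loop_free.
  cbn [den]; rewrite (body_step _ (esym iE) (esym jE)) den_scan_step.
  rewrite -iE -jE (fr 6%N) // f6 (fr 5%N) // f5.
  have {}ht : (t <= max_cost body + max_cost scan_step + 1)%N.
    by apply: leq_trans ht _; rewrite {1}/max_cost -/max_cost; lia.
  have cE : scan_cost body = (max_cost body + max_cost scan_step + bcost scan_guard + 30)%N by [].
  case: ltnP => jj.
    split.
      eexists; eexists; split; first by [].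
      - exact: SG.
      - by rewrite update_eq update_neq // -iE; lia.
      - by move=> x x1 x2; rewrite update_neq ?fr //; exact/eqP.
      - rewrite update_eq update_neq // -iE => i' j' hi' hj' lt.
        have [E|ne] := boolP ((i' == i) && (j' == j)).
          by case/andP: E => /eqP -> /eqP ->; exact: SP.
        apply: SK => //; apply: done => //; rewrite -iE -jE; move: ne lt; lia.
    cbn [icell]; rewrite update_neq // update_eq -iE -jE.
    have := @potential_step ((i2.+1 - i) * w) (j - j1) (j.+1 - j1) (scan_cost body)
      ltac:(lia) ltac:(nia).
    by lia.
  have jE2 : j = j2 by lia.
  split.
    eexists; eexists; split; first by [].
    - exact: SG.
    - by rewrite update_eq update_neq // update_eq; lia.
    - by move=> x x1 x2; rewrite !update_neq ?fr //; exact/eqP.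
    - rewrite update_eq update_neq // update_eq => i' j' hi' hj' lt.
      have [E|ne] := boolP ((i' == i) && (j' == j)).
        by case/andP: E => /eqP -> /eqP ->; exact: SP.
      apply: SK => //; apply: done => //; rewrite -iE -jE; move: ne lt; lia.
  cbn [icell]; rewrite update_eq update_neq // update_eq -iE -jE subnn subn0.
  have E : ((i2.+1 - i) * w - (j - j1) = ((i2.+1 - i.+1) * w).+1)%N.
    have -> : (i2.+1 - i = (i2.+1 - i.+1).+1)%N by lia.
    by rewrite mulSn; move: ((i2.+1 - i.+1) * w)%N => x; lia.
  by rewrite E mulSn; lia.
- move=> _ t [f1 [g1 [-> Gg1 pos fr done]]] guard ht.
  have f11 : f1 1%N = i2.+1 by move: guard; rewrite /= (fr 4%N) // f4; lia.
  apply: hQ => //.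
    by move=> i j /andP[/= hi' hj']; apply: done => //; rewrite f11; move: hi'; lia.
  move: ht; cbn [icell]; rewrite f11 subnn mul0n sub0n mul0n addn0 update_neq // !update_eq subnn subn0.
  have {}ht0 : (t0 <= 20)%N by exact: leq_trans ht0 _.
  rewrite /cells /= -wE mulSn => ht.
  have cE : scan_cost body = (max_cost body + max_cost scan_step + bcost scan_guard + 30)%N by [].
  by lia.
Qed.

End Scan.

Definition out_base := IAdd (IMul (IConst 2) (IMul (isucc nI) (isucc mI))) (IMul (IConst 16) (ir 0)).
Definition out_index n m q t : nat := (16 + t + (2 * (n.+1 * m.+1) + 16 * q))%N.

Fixpoint store_list (t : nat) (es : seq rexp) : cmd :=
  match es with
  | [::] => Skip
  | e :: es => Seq (RStore (IAdd (IConst (16 + t)) out_base) e) (store_list t.+1 es)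
  end.

(** Such values are unaffected by the stores of [store_list], which go to addresses from 16 on. *)
Definition register_exp (R : realType) (inp : memory R) f (e : rexp) :=
  forall g g' : nat -> R, (forall x, (x < 16)%N -> g x = g' x) ->
    reval inp (Memory f g) e = reval inp (Memory f g') e.

Lemma den_store_list (R : realType) (inp : memory R) n m (f : nat -> nat) (g : nat -> R) q t es :
  icell inp 0 = n -> icell inp 1 = m -> f 0%N = q ->
  (forall l, (l < size es)%N -> register_exp inp f (nth (ROfInt (IConst 0)) es l)) ->
  exists g', [/\ den inp (store_list t es) (Memory f g) = Memory f g',
    forall l, (l < size es)%N ->
      g' (out_index n m q (t + l)) = reval inp (Memory f g) (nth (ROfInt (IConst 0)) es l) &
    forall x, ~~ (out_index n m q t <= x < out_index n m q (t + size es))%N -> g' x = g x].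
Proof.
move=> inp_n inp_m f0; elim: es t g => [|e es IH] t g reg; first by exists g.
have [|g' [E val fr]] := IH t.+1 (update g (out_index n m q t) (reval inp (Memory f g) e)).
  by move=> l hl; exact: (reg l.+1).
exists g'; split.
- rewrite -E; cbn [store_list den]; congr (den _ _ (Memory _ (update _ _ _))).
  by cbn [ieval out_base isucc nI mI ir icell]; rewrite inp_n inp_m f0 !addn1.
- case=> [|l] hl.
    rewrite addn0 fr ?update_eq //; rewrite /out_index; lia.
  rewrite addnS -addSn val //; apply: (reg l.+1) => // x hx.
  by rewrite update_neq // /out_index; lia.
- move=> x hx; rewrite fr; last by move: hx; rewrite /out_index /=; lia.
  by rewrite update_neq //; move: hx; rewrite /out_index /=; lia.
Qed.

Definition list_get t :=
  ILoad (IAdd (IConst (32 + t)) (IAdd (IMul (IConst 2) mI) (IMul (IConst 4) (ir 0)))).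
(** Starting both extremes at a label keeps them labels throughout the scan. *)
Definition first_label := RInput (IAdd (IMul (ir 3) mI) (ir 5)).
Definition block_load := seqs [:: iset 3 (list_get 0); iset 4 (list_get 1);
  iset 5 (list_get 2); iset 6 (list_get 3)].
Definition block_moments := seqs [:: rset 2 (rect_area (ir 3) (ir 4) (ir 5) (ir 6));
  rset 3 (rect_sum tab1 (ir 3) (ir 4) (ir 5) (ir 6));
  rset 4 (rect_sum tab2 (ir 3) (ir 4) (ir 5) (ir 6));
  rset 5 first_label; rset 6 first_label].
Definition extremes := Seq (rmin 5 cur) (rmax 6 cur).
Definition set_centre := seqs [:: rset 7 (RDiv (RSub (rr 4) (RMul (rr 5) (rr 3)))
    (RSub (rr 3) (RMul (rr 5) (rr 2)))); rset 8 (rr 5); rset 9 (rr 6)].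
Definition neighbours := Seq (If (BLeR cur (rr 7)) (rmax 8 cur) Skip)
  (If (BLeR (rr 7) cur) (rmin 9 cur) Skip).
Definition quadratic u v :=
  RAdd (RSub (rr 4) (RMul (RAdd u v) (rr 3))) (RMul (RMul u v) (rr 2)).
Definition linear := RSub (rr 3) (RMul (rr 5) (rr 2)).
Definition two_point := RDiv linear (RSub (rr 8) (rr 5)).
Definition set_weights := If (BLeR (rr 6) (rr 5))
  (seqs [:: rset 10 (rr 2); rset 11 (ROfInt (IConst 0)); rset 12 (ROfInt (IConst 0))])
  (If (BLeR (rr 9) (rr 8))
    (seqs [:: rset 10 (RSub (rr 2) two_point); rset 11 two_point; rset 12 (ROfInt (IConst 0))])
    (seqs [:: rset 10 (RDiv (quadratic (rr 8) (rr 9)) (RMul (RSub (rr 8) (rr 5)) (RSub (rr 9) (rr 5))));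
      rset 11 (RSub (ROfInt (IConst 0)) (RDiv (quadratic (rr 5) (rr 9)) (RMul (RSub (rr 8) (rr 5)) (RSub (rr 9) (rr 8)))));
      rset 12 (RDiv (quadratic (rr 5) (rr 8)) (RMul (RSub (rr 9) (rr 5)) (RSub (rr 9) (rr 8))))])).
Definition block_output := store_list 0
  [:: ROfInt (ir 3); ROfInt (ir 5); rr 5; rr 10; ROfInt (ir 3); ROfInt (ir 6); rr 8; rr 11;
      ROfInt (ir 4); ROfInt (ir 5); rr 9; rr 12; ROfInt (ir 4); ROfInt (ir 6); rr 5; ROfInt (IConst 0)].

Lemma den_set_weights (R : realType) (inp : memory R) f g : exists g',
  [/\ den inp set_weights (Memory f g) = Memory f g',
    (g' 10%N, g' 11%N, g' 12%N) = weights (g 2%N) (g 3%N) (g 4%N) (g 5%N) (g 6%N) (g 8%N) (g 9%N) &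
    forall x, ~~ (10 <= x <= 12)%N -> g' x = g x].
Proof.
have fr (u : nat -> R) v1 v2 v3 x : ~~ (10 <= x <= 12)%N ->
    update (update (update u 10 v1) 11 v2) 12 v3 x = u x.
  by move=> hx; rewrite !update_neq //; lia.
rewrite /set_weights /weights; cbn [den]; cbn [beval reval rr ieval rcell].
case: ifP => h1; [|case: ifP => h2].
- by eexists; split; [reflexivity|reflexivity|exact: fr].
- by eexists; split; [reflexivity|reflexivity|exact: fr].
- eexists; split; [reflexivity| |exact: fr].
  by cbn; rewrite sub0r.
Qed.

Section Block.
Variables (R : realType) (n m : nat) (D : 'M[R]_(n, m)) (inp : memory R).
Hypotheses (inp_n : icell inp 0 = n) (inp_m : icell inp 1 = m).
Hypothesis inp_D : forall (i : 'I_n) (j : 'I_m), rcell inp (i * m + j)%N = D i j.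
Variables (B : rect) (f : nat -> nat).
Hypothesis B_inside : inside n m B.

Let y i j := rcell inp (i * m + j)%N.

Lemma label_cell i j : in_rect B i j -> label D B (y i j).
Proof.
move=> hij; have hi : (i < n)%N by move: B_inside hij; nlia.
have hj : (j < m)%N by move: B_inside hij; nlia.
by exists (Ordinal hi), (Ordinal hj); rewrite -inp_D.
Qed.

Lemma cell_label v : label D B v -> exists i j, in_rect B i j /\ y i j = v.
Proof. by case=> i [j [hij <-]]; exists i, j; rewrite /y inp_D. Qed.

Lemma reval_cur f1 g i j : f1 1%N = i -> f1 2%N = j -> reval inp (Memory f1 g) cur = y i j.
Proof. by move=> h1 h2; rewrite /= h1 h2 inp_m. Qed.

Hypotheses (f3 : f 3%N = B.1.1) (f4 : f 4%N = B.1.2) (f5 : f 5%N = B.2.1) (f6 : f 6%N = B.2.2).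

Lemma extremes_wp (g : nat -> R) Q : label D B (g 5%N) -> label D B (g 6%N) ->
  (forall f' g' t, label D B (g' 5%N) -> label D B (g' 6%N) ->
     (forall v, label D B v -> g' 5%N <= v <= g' 6%N) ->
     (forall x, x != 5%N -> x != 6%N -> g' x = g x) ->
     (forall x, x != 1%N -> x != 2%N -> f' x = f x) ->
     (t <= (cells B).+1 * scan_cost extremes)%N -> Q (Memory f' g') t) ->
  wp inp (scan extremes) (Memory f g) Q.
Proof.
move=> l5 l6 hQ.
pose step i j (h : nat -> R) := let h1 := update h 5 (Num.min (h 5%N) (y i j)) in
  update h1 6 (Num.max (h1 6%N) (y i j)).
have stepE i j h : step i j h 5%N = Num.min (h 5%N) (y i j) /\
    step i j h 6%N = Num.max (h 6%N) (y i j).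
  by rewrite /step update_eq update_neq // update_eq update_neq.
apply: (@scan_wp _ _ _ B step
  (fun h => [/\ label D B (h 5%N), label D B (h 6%N) &
     forall x, x != 5%N -> x != 6%N -> h x = g x])
  (fun i j h => h 5%N <= y i j <= h 6%N)) => //.
- move=> f1 h i j h1 h2; rewrite /extremes; cbn [den].
  by rewrite den_rmin den_rmax !(reval_cur _ h1 h2).
- move=> i j h hij [h5 h6 fr]; have [-> ->] := stepE i j h; split.
  + by case: leP => // _; exact: label_cell.
  + by case: leP => // _; exact: label_cell.
  + by move=> x x5 x6; rewrite /step !update_neq ?fr //; exact/eqP.
- move=> i j h hij _; have [-> ->] := stepE i j h.
  by rewrite ge_min lexx orbT le_max lexx orbT.
- move=> i j i' j' h _ _ _ /andP[h5 h6]; have [-> ->] := stepE i j h.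
  by rewrite ge_min h5 le_max h6.
- by case/and4P: B_inside.
- by case/and4P: B_inside.
- move=> f' g' t [g5 g6 fr] P fr' ht; apply: hQ => // v /cell_label[i [j [hij <-]]].
  exact: P.
Qed.

(** Registers 8 and 9 start at the extreme labels. The disjunctions allow for start values on the
    wrong side of the centre and have the form of the hypotheses [p_z] and [q_z] of [weightsP]. *)
Lemma neighbours_wp (g : nat -> R) Q : label D B (g 8%N) -> label D B (g 9%N) ->
  (forall f' g' t, label D B (g' 8%N) -> label D B (g' 9%N) ->
     (forall v, label D B v -> v <= g 7%N -> v <= g' 8%N) ->
     (forall v, label D B v -> g 7%N <= v -> g' 9%N <= v) ->
     g' 8%N <= g 7%N \/ g' 8%N = g 8%N -> g 7%N <= g' 9%N \/ g' 9%N = g 9%N ->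
     (forall x, x != 8%N -> x != 9%N -> g' x = g x) ->
     (forall x, x != 1%N -> x != 2%N -> f' x = f x) ->
     (t <= (cells B).+1 * scan_cost neighbours)%N -> Q (Memory f' g') t) ->
  wp inp (scan neighbours) (Memory f g) Q.
Proof.
move=> l8 l9 hQ; set z := g 7%N in hQ *.
pose step i j (h : nat -> R) :=
  let h1 := if y i j <= h 7%N then update h 8 (Num.max (h 8%N) (y i j)) else h in
  if h1 7%N <= y i j then update h1 9 (Num.min (h1 9%N) (y i j)) else h1.
have stepE i j h : h 7%N = z ->
   [/\ step i j h 8%N = (if y i j <= z then Num.max (h 8%N) (y i j) else h 8%N),
       step i j h 9%N = (if z <= y i j then Num.min (h 9%N) (y i j) else h 9%N) &
       forall x, x != 8%N -> x != 9%N -> step i j h x = h x].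
  move=> h7; rewrite /step h7.
  have -> : (if y i j <= z then update h 8 (Num.max (h 8%N) (y i j)) else h) 7%N = z.
    by case: ifP.
  by case: ifP => c1; case: ifP => c2; split=> // x x8 x9; rewrite ?update_neq //; exact/eqP.
apply: (@scan_wp _ _ _ B step
  (fun h => [/\ label D B (h 8%N), label D B (h 9%N), h 8%N <= z \/ h 8%N = g 8%N,
       z <= h 9%N \/ h 9%N = g 9%N &
     forall x, x != 8%N -> x != 9%N -> h x = g x])
  (fun i j h => (y i j <= z -> y i j <= h 8%N) /\ (z <= y i j -> h 9%N <= y i j))) => //.
- move=> f1 h i j h1 h2; rewrite /neighbours; cbn [den].
  rewrite den_rmax /step; cbn [beval]; rewrite !(reval_cur _ h1 h2); cbn [reval rr ieval rcell].
  have ifE c (u v : nat -> R) :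
      (if c then Memory f1 u else Memory f1 v) = Memory f1 (if c then u else v) by case: c.
  by rewrite ifE den_rmin !(reval_cur _ h1 h2) ifE.
- move=> i j h hij [h8 h9 c8 c9 fr].
  have [-> -> fr'] := stepE i j h (fr 7%N isT isT); split.
  + by case: ifP => // _; case: leP => // _; exact: label_cell.
  + by case: ifP => // _; case: leP => // _; exact: label_cell.
  + by case: ifP => // c; case: (leP (h 8%N)) => // _; left.
  + by case: ifP => // c; case: (leP (h 9%N)) => // _; left.
  + by move=> x x8 x9; rewrite fr' // fr.
- move=> i j h hij [h8 h9 c8 c9 fr].
  have [-> -> fr'] := stepE i j h (fr 7%N isT isT).
  by split=> ->; rewrite ?le_max ?ge_min lexx orbT.
- move=> i j i' j' h _ _ [h8 h9 c8 c9 fr] [P1 P2].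
  have [-> -> fr'] := stepE i j h (fr 7%N isT isT).
  split=> c; case: ifP => _; rewrite ?le_max ?ge_min ?P1 ?P2 //.
- by case/and4P: B_inside.
- by case/and4P: B_inside.
- by split=> //; right.
- move=> f' g' t [g8 g9 c8 c9 fr] P fr' ht; apply: hQ => // v /cell_label[i [j [hij <-]]].
    by case: (P _ _ hij).
  by case: (P _ _ hij).
Qed.

End Block.

Definition block_tail := Seq set_weights (Seq block_output (iset 0 (isucc (ir 0)))).
Definition block_prog := Seq (Seq block_load block_moments)
  (Seq (scan extremes) (Seq set_centre (Seq (scan neighbours) block_tail))).
Definition block_cost := (max_cost (Seq block_load block_moments) + 2 * scan_cost extremes
  + max_cost set_centre + 2 * scan_cost neighbours + max_cost block_tail + 20)%N.

Lemma den_block_load (R : realType) (inp : memory R) m (f : nat -> nat) (g : nat -> R) q (B : rect) :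
  icell inp 1 = m -> f 0%N = q ->
  [/\ f (list_index m 0 q) = B.1.1, f (list_index m 1 q) = B.1.2,
      f (list_index m 2 q) = B.2.1 & f (list_index m 3 q) = B.2.2] ->
  den inp block_load (Memory f g) = Memory
    (update (update (update (update f 3 B.1.1) 4 B.1.2) 5 B.2.1) 6 B.2.2) g.
Proof.
move=> inp_m f0 [h0 h1 h2 h3].
have E h t : h 0%N = q -> ieval inp (Memory h g) (list_get t) = h (list_index m t q).
  by move=> E0; rewrite /= inp_m E0.
rewrite /block_load /iset; cbn [den seqs]; cbn [icell rcell]; rewrite !E // /list_index.
by rewrite !update_neq // -/(list_index m 0 q) -/(list_index m 1 q) -/(list_index m 2 q)
   -/(list_index m 3 q) h0 h1 h2 h3.
Qed.

Lemma den_seq (R : realType) (inp : memory R) p q st :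
  den inp (Seq p q) st = den inp q (den inp p st).
Proof. by []. Qed.

Section BlockProg.
Variables (R : realType) (n m : nat) (D : 'M[R]_(n, m)) (inp : memory R).
Hypotheses (inp_n : icell inp 0 = n) (inp_m : icell inp 1 = m).
Hypothesis inp_D : forall (i : 'I_n) (j : 'I_m), rcell inp (i * m + j)%N = D i j.

Lemma den_block_moments (B : rect) (f : nat -> nat) (g : nat -> R) : inside n m B ->
  f 3%N = B.1.1 -> f 4%N = B.1.2 -> f 5%N = B.2.1 -> f 6%N = B.2.2 -> tables D g ->
  exists g', [/\ den inp block_moments (Memory f g) = Memory f g',
    [/\ g' 2%N = area R n m B, g' 3%N = bsum (fun i j => D i j) B
      & g' 4%N = bsum (fun i j => D i j ^+ 2) B],
    label D B (g' 5%N), label D B (g' 6%N) & forall x, (16 <= x)%N -> g' x = g x].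
Proof.
case: B => [[i1 i2] [j1 j2]] iB /= f3 f4 f5 f6 T.
have T' (g' : nat -> R) : (forall x, (16 <= x)%N -> g' x = g x) -> tables D g'.
  by move=> fr i j hi hj; rewrite !fr /tab_index //; apply: T.
have sums (g' : nat -> R) : (forall x, (16 <= x)%N -> g' x = g x) ->
    [/\ reval inp (Memory f g') (rect_area (ir 3) (ir 4) (ir 5) (ir 6))
      = area R n m ((i1, i2), (j1, j2)),
    reval inp (Memory f g') (rect_sum tab1 (ir 3) (ir 4) (ir 5) (ir 6))
      = bsum (fun i j => D i j) ((i1, i2), (j1, j2)),
    reval inp (Memory f g') (rect_sum tab2 (ir 3) (ir 4) (ir 5) (ir 6))
      = bsum (fun i j => D i j ^+ 2) ((i1, i2), (j1, j2)) &
    label D ((i1, i2), (j1, j2)) (reval inp (Memory f g') first_label)].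
  move=> fr; have E : ((ieval inp (Memory f g') (ir 3), ieval inp (Memory f g') (ir 4)),
      (ieval inp (Memory f g') (ir 5), ieval inp (Memory f g') (ir 6))) = ((i1, i2), (j1, j2)).
    by rewrite /= f3 f4 f5 f6.
  have [] := @reval_rect_sum _ n m D inp inp_m (Memory f g') (ir 3) (ir 4) (ir 5) (ir 6) (T' _ fr).
    by rewrite E.
  rewrite E => -> ->; split=> //.
    have := @reval_rect_area R n m inp inp_m (Memory f g') (ir 3) (ir 4) (ir 5) (ir 6).
    by rewrite E; exact.
  have -> : reval inp (Memory f g') first_label = rcell inp (i1 * m + j1)%N.
    by rewrite /= f3 f5 inp_m.
  by apply: label_cell => //; move: iB; nlia.
have up (h : nat -> R) k v : (k < 16)%N -> (forall x, (16 <= x)%N -> h x = g x) ->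
    forall x, (16 <= x)%N -> update h k v x = g x.
  by move=> hk hh x hx; rewrite update_neq ?hh //; lia.
rewrite /block_moments /rset; cbn [seqs den]; cbn [icell rcell ieval].
set h2 := update g 2 _; have fr2 : forall x, (16 <= x)%N -> h2 x = g x by exact: up.
set h3 := update h2 3 _; have fr3 : forall x, (16 <= x)%N -> h3 x = g x by exact: up.
set h4 := update h3 4 _; have fr4 : forall x, (16 <= x)%N -> h4 x = g x by exact: up.
set h5 := update h4 5 _; have fr5 : forall x, (16 <= x)%N -> h5 x = g x by exact: up.
set h6 := update h5 6 _; have fr6 : forall x, (16 <= x)%N -> h6 x = g x by exact: up.
have [e2 _ _ _] := sums g (fun x _ => erefl).
have [_ e3 _ _] := sums h2 fr2.
have [_ _ e4 _] := sums h3 fr3.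
have [_ _ _ e5] := sums h4 fr4.
have [_ _ _ e6] := sums h5 fr5.
by exists h6; split.
Qed.

Lemma den_block_tail (B : rect) (f : nat -> nat) (g : nat -> R) q :
  f 0%N = q -> f 3%N = B.1.1 -> f 4%N = B.1.2 -> f 5%N = B.2.1 -> f 6%N = B.2.2 ->
  exists g', [/\ den inp block_tail (Memory f g) = Memory (update f 0 q.+1) g',
    (forall l, (l < 16)%N -> g' (out_index n m q l) = nth 0 (points_data
      (block_points B (g 5%N) (g 8%N) (g 9%N)
        (weights (g 2%N) (g 3%N) (g 4%N) (g 5%N) (g 6%N) (g 8%N) (g 9%N)))) l) &
    (forall x, (16 <= x)%N -> ~~ (out_index n m q 0 <= x < out_index n m q 16)%N ->
        g' x = g x)].
Proof.
move=> f0 f3 f4 f5 f6; rewrite /block_tail (den_seq inp set_weights) (den_seq inp block_output).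
have [g5 [-> wE fr5]] := den_set_weights inp f g.
rewrite -wE /block_output; set es := (X in store_list _ X).
have es16 : size es = 16 by [].
have [l|g6 [-> val fr6]] := @den_store_list R inp n m f g5 q 0 es inp_n inp_m f0.
  by do 16! [case: l => [_ h h' E|l]; first by first [exact: E|reflexivity]].
rewrite add0n es16 in fr6.
exists g6; split.
- by cbn [icell rcell iset den isucc ir ieval]; rewrite f0 addn1.
- have [v5 v8 v9] : [/\ g5 5%N = g 5%N, g5 8%N = g 8%N & g5 9%N = g 9%N] by rewrite !fr5.
  move=> l hl; transitivity (reval inp (Memory f g5) (nth (ROfInt (IConst 0)) es l)).
    by rewrite -val ?add0n ?es16.
  move: hl => {val}.
  by do 16! [case: l => [_|l]; first by rewrite /= ?v5 ?v8 ?v9 ?f3 ?f4 ?f5 ?f6].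
- by move=> x x16 hx; rewrite fr6 // fr5 //; lia.
Qed.

Lemma block_prog_wp (B : rect) (f : nat -> nat) (g : nat -> R) q Q : inside n m B ->
  f 0%N = q ->
  [/\ f (list_index m 0 q) = B.1.1, f (list_index m 1 q) = B.1.2,
      f (list_index m 2 q) = B.2.1 & f (list_index m 3 q) = B.2.2] -> tables D g ->
  (forall f' g' P t, block_coreset D B P -> f' 0%N = q.+1 ->
     (forall x, (7 <= x)%N -> f' x = f x) ->
     (forall l, (l < 16)%N -> g' (out_index n m q l) = nth 0 (points_data P) l) ->
     (forall x, (16 <= x)%N -> ~~ (out_index n m q 0 <= x < out_index n m q 16)%N ->
        g' x = g x) ->
     (t <= cells B * block_cost)%N -> Q (Memory f' g') t) ->
  wp inp block_prog (Memory f g) Q.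
Proof.
move=> iB f0 lst T hQ; apply: wp_seq; apply: wp_loop_free => // t1 ht1.
rewrite den_seq (den_block_load _ inp_m f0 lst).
set f1 := update _ 6 _.
have f1fr x : (7 <= x)%N -> f1 x = f x by move=> hx; rewrite /f1 !update_neq //; lia.
have [f10 f13 f14 f15 f16] : [/\ f1 0%N = q, f1 3%N = B.1.1, f1 4%N = B.1.2, f1 5%N = B.2.1 &
  f1 6%N = B.2.2] by [].
have [g1 [-> [m0 m1 m2] l5 l6 fr1]] := den_block_moments iB f13 f14 f15 f16 T.
apply: wp_seq; apply: (extremes_wp inp_n inp_m inp_D iB f13 f14 f15 f16 l5 l6).
move=> f2 g2 t2 a_label b_label ab fr2 ffr2 ht2.
set a := g2 5%N in a_label ab; set b := g2 6%N in b_label ab.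
have f2E x : x != 1%N -> x != 2%N -> f2 x = f1 x by exact: ffr2.
apply: wp_seq; apply: wp_loop_free => // t3 ht3.
set z := (g2 4%N - a * g2 3%N) / (g2 3%N - a * g2 2%N).
have -> : den inp set_centre (Memory f2 g2)
   = Memory f2 (update (update (update g2 7 z) 8 a) 9 b) by [].
set g3 := update _ 9 _.
have [g37 g38 g39] : [/\ g3 7%N = z, g3 8%N = a & g3 9%N = b] by [].
apply: wp_seq; apply: (neighbours_wp inp_n inp_m inp_D iB); rewrite ?g38 ?g39 ?f2E //.
rewrite g37 => f4 g4 t4 p_label q_label p_max q_min p_z q_z fr4 ffr4 ht4.
have g4E : [/\ g4 2%N = area R n m B, g4 3%N = bsum (fun i j => D i j) B,
    g4 4%N = bsum (fun i j => D i j ^+ 2) B, g4 5%N = a & g4 6%N = b].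
  by split; rewrite fr4 // /g3 !update_neq // fr2.
have zE : z = (bsum (fun i j => D i j ^+ 2) B - a * bsum (fun i j => D i j) B)
   / (bsum (fun i j => D i j) B - a * area R n m B).
  by rewrite /z -m0 -m1 -m2 !fr2.
rewrite zE in p_max q_min p_z q_z.
have cor := block_points_coreset a_label b_label p_label q_label ab p_max q_min p_z q_z.
case: g4E => e2 e3 e4 e5 e6; rewrite -e2 -e3 -e4 -e5 -e6 in cor.
have f4E x : x != 1%N -> x != 2%N -> f4 x = f1 x by move=> x1 x2; rewrite ffr4 // f2E.
apply: wp_loop_free => // t5 ht5.
have [] := @den_block_tail B f4 g4 q; rewrite ?f4E //.
move=> g6 [-> val fr6]; apply: (hQ _ _ _ _ cor) => //.
- move=> x hx; rewrite update_neq; last by lia.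
  by rewrite f4E ?f1fr //; lia.
- move=> x x16 hx; rewrite fr6 // fr4; try by apply/eqP; lia.
  rewrite /g3 !update_neq; try by lia.
  by rewrite fr2 ?fr1 //; apply/eqP; lia.
have c0 := cells_gt0 iB.
(* A block has at least one cell, so [cells B + 1] is at most twice [cells B]. *)
have d1 : ((cells B).+1 * scan_cost extremes <= cells B * (2 * scan_cost extremes))%N.
  by move: c0; move: (scan_cost extremes) (cells B) => u v; nia.
have d2 : ((cells B).+1 * scan_cost neighbours <= cells B * (2 * scan_cost neighbours))%N.
  by move: c0; move: (scan_cost neighbours) (cells B) => u v; nia.
pose K := (max_cost (Seq block_load block_moments) + max_cost set_centre + max_cost block_tail + 20)%N.
have d3 : (K <= cells B * K)%N by exact: leq_pmull.
have -> : (cells B * block_cost = cells B * (2 * scan_cost extremes)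
    + cells B * (2 * scan_cost neighbours) + cells B * K)%N.
  by rewrite -!mulnDr; congr (_ * _)%N; rewrite /block_cost /K; lia.
move: d3; rewrite /K; lia.
Qed.

End BlockProg.

(** * Points of all blocks *)

Definition blocks_guard := BLtI (ir 0) (ir 9).
Definition blocks_prog := Seq (iset 0 (IConst 0)) (While blocks_guard block_prog).
Definition copy_guard := BLtI (ir 0) (IMul (IConst 16) (ir 9)).
(** The source is always [16 + 2 (n + 1) (m + 1)] cells ahead of the target, so copying upwards
    never destroys a cell still to be read. *)
Definition copy_step := Seq (RStore (ir 0) (RLoad (IAdd (IConst 16) (IAdd (IMul (IConst 2)
  (IMul (isucc nI) (isucc mI))) (ir 0))))) (iset 0 (isucc (ir 0))).
Definition copy_prog := Seq (iset 0 (IConst 0)) (Seq (While copy_guard copy_step)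
  (iset 0 (IMul (IConst 4) (ir 9)))).
Definition copy_cost := (bcost copy_guard + max_cost copy_step + 20)%N.
Definition blocks_cost := (block_cost + 2 * bcost blocks_guard + 30)%N.

(** The blocks tile the matrix, so their areas add up to its area. This turns costs linear in each
    block into a total linear in [n m]. *)
Lemma sum_cells (R : realType) n m (Bs : seq rect) : (0 < n)%N -> (0 < m)%N ->
  (forall i j, count (fun B => in_rect B i j) Bs = in_rect (rows m 0 n.-1) i j) ->
  (forall B, B \in Bs -> inside n m B) -> (\sum_(B <- Bs) cells B = n * m)%N.
Proof.
move=> n0 m0 cov ins; apply/eqP; rewrite -(eqr_nat R) natr_sum; apply/eqP.
have -> : \sum_(B <- Bs) (cells B)%:R = \sum_(B <- Bs) area R n m B.
  apply: eq_big_seq => B /ins; rewrite /inside => iB; rewrite areaE //; lia.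
rewrite /area (@bsum_cover _ _ _ _ _ (rows m 0 n.-1)) => [|i j]; last exact: cov.
have -> : bsum (fun (_ : 'I_n) (_ : 'I_m) => 1) (rows m 0 n.-1) = area R n m (rows m 0 n.-1) by [].
by rewrite areaE /=; do ?lia; rewrite !subn0 !prednK.
Qed.

(** A nonempty rectangle listed twice would cover its first cell twice. Distinctness lets points
    computed by position in the list be read as a function of the rectangle, as [signal_coreset]
    demands. *)
Lemma cover_uniq n m (Bs : seq rect) :
  (forall i j, count (fun B => in_rect B i j) Bs <= 1)%N ->
  (forall B, B \in Bs -> inside n m B) -> uniq Bs.
Proof.
move=> cov ins; apply: count_mem_uniq => B; case: (boolP (B \in Bs)) => hB; last first.
  exact/count_memPn.
have [h1 h2] : (B.1.1 <= B.1.2)%N /\ (B.2.1 <= B.2.2)%N by case/and4P: (ins B hB).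
apply/eqP; rewrite eqn_leq; apply/andP; split; last by rewrite -has_count has_pred1.
apply: leq_trans (cov B.1.1 B.2.1); apply: sub_count => _ /eqP ->.
by rewrite /in_rect !leqnn h1 h2.
Qed.

Section Blocks.
Variables (R : realType) (n m : nat) (D : 'M[R]_(n, m)) (inp : memory R) (Bs : seq rect).
Hypotheses (inp_n : icell inp 0 = n) (inp_m : icell inp 1 = m).
Hypotheses (n_gt0 : (0 < n)%N) (m_gt0 : (0 < m)%N).
Hypothesis inp_D : forall (i : 'I_n) (j : 'I_m), rcell inp (i * m + j)%N = D i j.
Hypothesis Bs_cover :
  forall i j, count (fun B => in_rect B i j) Bs = in_rect (rows m 0 n.-1) i j.
Hypothesis Bs_inside : forall B, B \in Bs -> inside n m B.

Let B0 : rect := ((0, 0), (0, 0))%N.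

(** The potential is the number of cells in the blocks still to be treated. *)
Lemma blocks_prog_wp (f : nat -> nat) (g : nat -> R) Q :
  f 9%N = size Bs -> stored m f Bs -> tables D g ->
  (forall f' g' Ps t, f' 9%N = size Bs ->
     (forall q, (q < size Bs)%N -> block_coreset D (nth B0 Bs q) (Ps q) /\
        forall l, (l < 16)%N -> g' (out_index n m q l) = nth 0 (points_data (Ps q)) l) ->
     (t <= n * m * blocks_cost)%N -> Q (Memory f' g') t) ->
  wp inp blocks_prog (Memory f g) Q.
Proof.
move=> f9 stf T hQ.
have total := sum_cells R n_gt0 m_gt0 Bs_cover Bs_inside.
pose left q := (\sum_(B <- drop q Bs) cells B)%N.
have leftS q : (q < size Bs)%N -> (left q = cells (nth B0 Bs q) + left q.+1)%N.
  by move=> hq; rewrite /left (drop_nth B0 hq) big_cons.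
apply: wp_seq; apply: wp_loop_free => // t0 ht0; cbn [den iset].
set f0 := update _ _ _.
apply: (wp_while (Inv := fun st => exists f' g', [/\ st = Memory f' g', (f' 0%N <= size Bs)%N,
    forall x, (7 <= x)%N -> f' x = f x, tables D g' &
    forall q, (q < f' 0%N)%N -> exists P, block_coreset D (nth B0 Bs q) P /\
      forall l, (l < 16)%N -> g' (out_index n m q l) = nth 0 (points_data P) l])
  (Phi := fun st => (left (icell st 0) * (block_cost + bcost blocks_guard + 10))%N)).
- exists f0, g; split=> //.
  by move=> x hx; rewrite /f0 update_neq //=; lia.
- move=> _ [f1 [g1 [-> hq fr T1 out]]] guard.
  have [q qE] : {q | q = f1 0%N} by eexists.
  have f19 : f1 9%N = size Bs by rewrite fr.
  have qlt : (q < size Bs)%N by move: guard; rewrite /= f19 -qE; lia.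
  have iB : inside n m (nth B0 Bs q) by apply: Bs_inside; exact: mem_nth.
  have lst := stored_frame (f' := f1) ltac:(by move=> a ha; apply: fr; lia) stf qlt.
  apply: (block_prog_wp inp_n inp_m inp_D iB (esym qE) lst T1).
  move=> f2 g2 P t cor f20 fr2 val fr2g ht; split.
    exists f2, g2; split=> //.
    + by rewrite f20.
    + by move=> x hx; rewrite fr2 // fr.
    + move=> i j hi hj; have lt : (i * m.+1 + j < n.+1 * m.+1)%N by nia.
      by rewrite !fr2g /tab_index /out_index; [exact: T1|lia..].
    + rewrite f20 => q' hq'; have [->|ne] := eqVneq q' q; first by exists P.
      have [|P' [cor' val']] := out q'; first by rewrite -qE; lia.
      exists P'; split=> // l hl; rewrite fr2g ?val' // /out_index; lia.
  cbn [icell]; rewrite f20 -qE (leftS q qlt) mulnDl.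
  have c0 := cells_gt0 iB.
  have : (cells (nth B0 Bs q) * block_cost + (bcost blocks_guard + 10)
    <= cells (nth B0 Bs q) * (block_cost + bcost blocks_guard + 10))%N.
    by rewrite -addnA mulnDr leq_add2l leq_pmull.
  by lia.
- move=> _ t [f1 [g1 [-> hq fr T1 out]]] guard ht.
  have f19 : f1 9%N = size Bs by rewrite fr.
  have f10 : f1 0%N = size Bs by move: guard; rewrite /= f19; lia.
  have [q|Ps PsP] := choice (P := fun q P => (q < size Bs)%N ->
      block_coreset D (nth B0 Bs q) P /\
      forall l, (l < 16)%N -> g1 (out_index n m q l) = nth 0 (points_data P) l).
    have [hq'|hq'] := ltnP q (size Bs); last by exists [::].
    by have [|P hP] := out q; [rewrite f10|exists P].
  apply: (hQ _ _ Ps) => //; move: ht; cbn [icell].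
  rewrite f10 /left drop_size big_nil mul0n addn0 /f0 update_eq drop0 total => ht.
  have {}ht0 : (t0 <= 10)%N by exact: leq_trans ht0 _.
  have c : (bcost blocks_guard + 20 <= n * m * (bcost blocks_guard + 20))%N.
    by apply: leq_pmull; rewrite muln_gt0 n_gt0.
  have : (n * m * blocks_cost = n * m * (block_cost + bcost blocks_guard + 10)
     + n * m * (bcost blocks_guard + 20))%N.
    by rewrite -mulnDr; congr (_ * _)%N; rewrite /blocks_cost; lia.
  lia.
Qed.

End Blocks.

Lemma copy_prog_wp (R : realType) n m (inp : memory R) (f : nat -> nat) (g : nat -> R) nb Q :
  icell inp 0 = n -> icell inp 1 = m -> f 9%N = nb -> (nb <= n * m)%N -> (0 < n * m)%N ->
  (forall f' g' t, f' 0%N = (4 * nb)%N ->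
     (forall x, (x < 16 * nb)%N -> g' x = g (out_index n m 0 x)) ->
     (t <= n * m * (17 * copy_cost))%N -> Q (Memory f' g') t) ->
  wp inp copy_prog (Memory f g) Q.
Proof.
move=> inp_n inp_m f9 nb_le nm0 hQ.
apply: wp_seq; apply: wp_loop_free => // t0 ht0; cbn [den iset ieval icell rcell].
set f0 := update _ _ _.
have [f00 f09] : f0 0%N = 0%N /\ f0 9%N = nb by split; rewrite /f0 ?update_eq ?update_neq.
apply: wp_seq; apply: (wp_while (Inv := fun st => exists f' g', [/\ st = Memory f' g',
    (f' 0%N <= 16 * nb)%N, f' 9%N = nb &
    forall x, g' x = if (x < f' 0%N)%N then g (out_index n m 0 x) else g x])
  (Phi := fun st => ((16 * nb - icell st 0) * copy_cost)%N)).
- by exists f0, g; rewrite f00 f09.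
- move=> _ [f1 [g1 [-> hx f19 val]]] guard; apply: wp_loop_free => // t ht.
  have [x xE] : {x | x = f1 0%N} by eexists.
  have xlt : (x < 16 * nb)%N by move: guard; rewrite /= f19 -xE; lia.
  have -> : den inp copy_step (Memory f1 g1)
     = Memory (update f1 0 x.+1) (update g1 x (g1 (out_index n m 0 x))).
    rewrite /copy_step /iset; cbn [den]; cbn [ieval ir isucc reval icell rcell nI mI].
    by rewrite inp_n inp_m -xE !addn1; congr (Memory _ (update _ _ (g1 _))); rewrite /out_index; lia.
  split.
    exists (update f1 0 x.+1), (update g1 x (g1 (out_index n m 0 x))).
    split=> // y; rewrite update_eq; have [->|ne] := eqVneq y x.
      rewrite update_eq ltnSn val -xE; case: ltnP => //; rewrite /out_index; lia.
    rewrite update_neq; last exact/eqP.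
    have -> : (y < x.+1)%N = (y < x)%N by move/eqP: ne; lia.
    by rewrite val -xE.
  cbn [icell]; rewrite update_eq -xE.
  have := @potential_step (16 * nb) x x.+1 copy_cost ltac:(lia) ltac:(lia).
  have cE : copy_cost = (bcost copy_guard + max_cost copy_step + 20)%N by [].
  by lia.
- move=> _ t [f1 [g1 [-> hx f19 val]]] guard ht; apply: wp_loop_free => // t1 ht1.
  have f10 : f1 0%N = (16 * nb)%N by move: guard; rewrite /= f19; lia.
  have -> : den inp (iset 0 (IMul (IConst 4) (ir 9))) (Memory f1 g1)
     = Memory (update f1 0 (4 * nb)%N) g1 by rewrite /iset /= f19.
  apply: hQ => //.
    by move=> x hx'; rewrite val f10 hx'.
  move: ht; cbn [icell]; rewrite f10 f00 subnn mul0n addn0 subn0 => ht.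
  have {}ht0 : (t0 <= 10)%N by exact: leq_trans ht0 _.
  have {}ht1 : (t1 <= 10)%N by exact: leq_trans ht1 _.
  have c1 : (16 * nb * copy_cost <= n * m * (16 * copy_cost))%N.
    by rewrite mulnA leq_mul2r mulnC leq_mul2r nb_le orbT.
  have c2 : (copy_cost + n * m * (16 * copy_cost) <= n * m * (17 * copy_cost))%N.
    by rewrite (mulSn 16) mulnDr leq_add2r leq_pmull.
  have cE : copy_cost = (bcost copy_guard + max_cost copy_step + 20)%N by [].
  have m1 : (1 <= max_cost copy_step)%N by [].
  have : (t0 + (t + t1) <= 20 + (16 * nb * copy_cost + bcost copy_guard + 1))%N by lia.
  have : (25 <= max_cost copy_step + 20)%N by [].
  lia.
Qed.

(** * The coreset program *)

Definition coreset_tail :=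
  Seq loss_prog (Seq tables_prog (Seq partition_prog (Seq blocks_prog copy_prog))).
Definition coreset_cost :=
  (loss_cost + (tables_cost + (partition_cost + (blocks_cost + 17 * copy_cost))) + 4)%N.

(** Apart from the cells holding the approximation, the initial memory is arbitrary, since the
    approximation program may leave anything there. *)
Lemma coreset_tail_wp (R : realType) n m k (D s : 'M[R]_(n, m)) (inp : memory R)
    (f : nat -> nat) (g : nat -> R) alpha beta eps gamma sigma Q :
  (0 < n)%N -> (0 < m)%N -> signal_input inp D k -> rcell inp (n * m)%N = eps ->
  g 0%N = alpha -> g 1%N = beta ->
  (forall (i : 'I_n) (j : 'I_m), g (2 + (i * m + j))%N = s i j) ->
  gamma = eps ^+ 2 / (beta * k%:R) -> sigma = loss D (full_rect n m) s / alpha ->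
  0 < gamma -> 0 <= sigma ->
  (forall out Bs CB t, Defs.partition D gamma sigma Bs ->
     (forall B, B \in Bs -> block_coreset D B (CB B)) ->
     let C := flatten [seq CB B | B <- Bs] in
     icell out 0 = size C -> holds 0 (rcell out) 0 (points_data C) ->
     (t <= n * m * coreset_cost)%N -> Q out t) ->
  wp inp coreset_tail (Memory f g) Q.
Proof.
move=> n0 m0 [inpI inp_D] inp_e g0 g1 gs gE sE gamma0 sigma0 hQ.
have nm0 : (0 < n * m)%N by rewrite muln_gt0 n0.
have [inp_n inp_m inp_k] : [/\ icell inp 0 = n, icell inp 1 = m & icell inp 2 = k].
  by split; [exact: (inpI 0%N)|exact: (inpI 1%N)|exact: (inpI 2%N)].
apply: wp_seq; apply: (loss_prog_wp f inp_n inp_m inp_k n0 m0 inp_D inp_e g0 g1 gs gE sE).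
move=> f1 gg1 t1 h0 h1 ht1; apply: wp_seq.
apply: (tables_prog_wp inp_n inp_m n0 m0 inp_D) => f2 g2 t2 T h20 h21 ht2.
rewrite -h20 in h0; rewrite -h21 in h1; apply: wp_seq.
apply: (partition_prog_wp f2 inp_n inp_m n0 m0 sigma0 T h0 h1) => f3 Bs t3 part f39 st3 ht3.
have [cov ins] := partition_cover n0 m0 gamma0 sigma0 part.
have {}ins B : B \in Bs -> inside n m B by move=> /ins[].
apply: wp_seq; apply: (blocks_prog_wp inp_n inp_m n0 m0 inp_D cov ins f39 st3 T).
move=> f4 g4 Ps t4 f49 PsP ht4.
have total := sum_cells R n0 m0 cov ins.
have size_le : (size Bs <= n * m)%N.
  rewrite -total -sum1_size big_seq [X in (_ <= X)%N]big_seq; apply: leq_sum => B /ins.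
  exact: cells_gt0.
have uBs : uniq Bs by apply: (cover_uniq (n := n) (m := m)) => // i j; rewrite cov; case: in_rect.
pose CB B := Ps (index B Bs).
have CBP B : B \in Bs -> block_coreset D B (CB B).
  move=> hB; have hi : (index B Bs < size Bs)%N by rewrite index_mem.
  by have [] := PsP _ hi; rewrite nth_index.
apply: (copy_prog_wp inp_n inp_m f49 size_le nm0) => f5 g5 t5 f50 val ht5.
apply: (hQ _ Bs CB) => //.
- by rewrite (size_coreset_list CBP) mulnC.
- move=> l; rewrite size_points_data (size_coreset_list CBP) add0n => hl.
  rewrite points_dataE; have lE := divn_eq l 16.
  have u16 : (l %% 16 < 16)%N by rewrite ltn_mod.
  have hq : (l %/ 16 < size Bs)%N by rewrite ltn_divLR //; lia.
  have all16 : all (fun s => size s == 16%N) [seq points_data (CB B) | B <- Bs].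
    apply/allP => _ /mapP[B hB ->].
    by rewrite size_points_data (size_block_coreset CBP).
  rewrite {2}lE (nth_flatten_uniform _ all16) ?size_map //.
  rewrite (nth_map ((0, 0), (0, 0))%N) // /CB index_uniq //.
  have [_ <-] := PsP _ hq => //.
  by rewrite [LHS]val /=; [congr (g4 _); rewrite /out_index; lia|lia].
have : (n * m * coreset_cost = n * m * loss_cost + (n * m * tables_cost + (n * m * partition_cost
   + (n * m * blocks_cost + n * m * (17 * copy_cost)))) + n * m * 4)%N.
  by rewrite -!mulnDr.
lia.
Qed.

(** Execution is deterministic, so the run named in [signal_coreset] is the one whose quality
    [approx_algorithm] guarantees. *)
Lemma approx_output_det (R : realType) A n m (D : 'M[R]_(n, m)) k inp t alpha beta s t' alpha' beta' s' :
  approx_output A D k inp t alpha beta s -> approx_output A D k inp t' alpha' beta' s' ->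
  [/\ t = t', alpha = alpha', beta = beta' & s = s'].
Proof.
case=> out [r <- <- sE] [out' [r' <- <- sE']].
have [oE tE] := exec_det r r'; subst out'; split=> //.
by apply/matrixP => i j; rewrite -sE -sE'.
Qed.

Lemma ln_unbounded (R : realType) (K : R) : exists M : nat, forall N, (M <= N)%N -> K <= ln N%:R.
Proof.
exists (Num.bound (expR K)) => N hN.
have lt : expR K < N%:R.
  apply: (lt_le_trans (archi_boundP (expR_ge0 K))); by rewrite ler_nat.
rewrite -[X in X <= _](expRK K) ler_ln ?ltW // posrE ?expR_gt0 //.
exact: lt_trans (expR_gt0 K) lt.
Qed.

(** Four points in each of [6 alpha / gamma^2] blocks give the 24. The bounds on [alpha] and [beta]
    leave a constant times [k^(2 b + 3) L^5]; one more factor [L] absorbs the constant, and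
    [2 b + 6] dominates both exponents. *)
Lemma partition_size_log (R : realType) n m k (D s : 'M[R]_(n, m)) (b : nat)
    eps Delta alpha beta gamma sigma ca cb Bs :
  let L := ln (n * m)%:R in
  (0 < n)%N -> (0 < m)%N -> (0 < k)%N -> 0 < eps -> eps < 4%:R^-1 -> 18 <= Delta ->
  Defs.approximation alpha beta k D s -> gamma = (eps / Delta) ^+ 2 / (beta * k%:R) ->
  sigma = loss D (full_rect n m) s / alpha -> Defs.partition D gamma sigma Bs ->
  alpha <= ca * k%:R * L -> beta <= cb * k%:R ^+ b * L ^+ 2 ->
  1 <= L -> 24 * `|ca| * cb ^+ 2 * Delta ^+ 4 <= L ->
  (size Bs * 4)%:R <= (k%:R * L) ^+ (2 * b + 6) / eps ^+ 4.
Proof.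
move=> L n0 m0 k0 e0 e1 hDelta ap gE sE part ha hb L1 LK.
have sz := partition_size n0 m0 k0 e0 e1 hDelta ap gE sE part.
case: ap => a1 b1 _ _.
have K1 : 1 <= k%:R :> R by rewrite ler1n.
have D0 : 0 < Delta by exact: lt_le_trans hDelta.
have k0' : 0 < k%:R :> R by rewrite ltr0n.
have b0 : 0 < beta by exact: lt_trans b1.
rewrite ler_pdivlMr ?exprn_gt0 //.
have gamE : gamma * (beta * k%:R) * Delta ^+ 2 = eps ^+ 2.
  by rewrite gE; field; rewrite !lt0r_neq0.
set x : R := (size Bs)%:R in sz *; have x0 : 0 <= x by rewrite ler0n.
rewrite natrM -/x; have -> : x * 4 * eps ^+ 4
    = 4 * (gamma ^+ 2 * x) * ((beta * k%:R) ^+ 2 * Delta ^+ 4).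
  by rewrite -[4%N]/(2 * 2)%N exprM -gamE; ring.
have c0 : 0 <= (beta * k%:R) ^+ 2 * Delta ^+ 4.
  by rewrite mulr_ge0 ?sqr_ge0 // exprn_ge0 // ltW.
have L0 : 0 <= L by exact: le_trans L1.
have h1 : 4 * (gamma ^+ 2 * x) <= 24 * (`|ca| * k%:R * L).
  have : alpha <= `|ca| * k%:R * L.
    apply: (le_trans ha); apply: ler_wpM2r => //; apply: ler_wpM2r; rewrite ?ler_norm //.
  by lra.
apply: (le_trans (ler_wpM2r c0 h1)).
have h2 : beta ^+ 2 <= (cb * k%:R ^+ b * L ^+ 2) ^+ 2.
  by rewrite ler_sqr ?nnegrE ?(ltW b0) // (le_trans (ltW b0)).
have c1 : 0 <= 24 * (`|ca| * k%:R * L) * (k%:R ^+ 2 * Delta ^+ 4).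
  by rewrite !mulr_ge0 ?exprn_ge0 // ltW.
have -> : 24 * (`|ca| * k%:R * L) * ((beta * k%:R) ^+ 2 * Delta ^+ 4)
   = beta ^+ 2 * (24 * (`|ca| * k%:R * L) * (k%:R ^+ 2 * Delta ^+ 4)) by ring.
apply: (le_trans (ler_wpM2r c1 h2)).
have -> : (cb * k%:R ^+ b * L ^+ 2) ^+ 2 * (24 * (`|ca| * k%:R * L) * (k%:R ^+ 2 * Delta ^+ 4))
   = (24 * `|ca| * cb ^+ 2 * Delta ^+ 4) * (k%:R ^+ (2 * b + 3) * L ^+ 5).
  by rewrite !exprMn [(2 * b)%N]mulnC exprD exprM; ring.
have c2 : 0 <= k%:R ^+ (2 * b + 3) * L ^+ 5 :> R by rewrite mulr_ge0 ?exprn_ge0 // ltW.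
apply: (le_trans (ler_wpM2r c2 LK)).
rewrite exprMn mulrCA -exprS; apply: ler_pM; rewrite ?exprn_ge0 //; try exact: ltW.
  by rewrite ler_weXn2l // leq_add2l.
by rewrite ler_weXn2l // addnC.
Qed.

Theorem theorem8 (R : realType) (A : cmd) (ca cb : R) (b ct N1 : nat)
    (hA : approx_algorithm A ca cb b ct N1) :
  exists (L : cmd) (T : nat -> nat -> nat) (Delta0 : R),
    1 <= Delta0 /\
    forall Delta : R, Delta0 <= Delta ->
    exists (P : cmd) (a c N0 : nat),
    forall (n m k : nat) (D : 'M[R]_(n, m)) (eps : R),
      (0 < n)%N -> (0 < m)%N -> (0 < k)%N -> 0 < eps < 4%:R^-1 ->
      (forall C : seq (wpoint R), signal_coreset A D k (eps / Delta) C ->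
         coreset L T k eps D C /\
         ((N0 <= n * m)%N ->
          (size C)%:R <= (k%:R * ln (n * m)%:R) ^+ a / eps ^+ 4)) /\
      (forall inp : memory R,
         signal_input inp D k -> rcell inp (n * m)%N = eps / Delta ->
         exists (t : nat) (C : seq (wpoint R)),
           [/\ computes_coreset P D k (eps / Delta) inp t C,
               signal_coreset A D k (eps / Delta) C &
               (N0 <= n * m)%N -> (t <= c * (k * (n * m)))%N]).
Proof.
exists fitting_loss, fitting_loss_time, 18; split; first by rewrite ler1n.
move=> Delta hDelta.
(* From [M] on, the logarithm exceeds the constant of the size bound; as this involves [Delta], so
   does the threshold on [n m]. *)
have [M hM] := ln_unbounded (Num.max 1 (24 * `|ca| * cb ^+ 2 * Delta ^+ 4)).
(* The summand 1 in the time constant pays for the sequencing of the two programs. *)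
exists (Seq A coreset_tail), (2 * b + 6)%N, (ct + coreset_cost + 1)%N, (maxn N1 M).
move=> n m k D eps n0 m0 k0 /andP[e0 e1]; split.
- move=> C [inp [t [alpha [beta [s [sig out]]]]]] /=.
  have [t' [alpha' [beta' [s' [out' ap asym]]]]] := hA _ _ _ _ _ n0 m0 k0 sig.
  have [_ ? ? ?] := approx_output_det out out'; subst alpha' beta' s'.
  move=> [Bs [CB [part CBP ->]]].
  have gamma0 := gamma_gt0 k0 e0 hDelta ap erefl.
  have sigma0 := sigma_ge0 ap erefl.
  have [cov ins] := partition_cover n0 m0 gamma0 sigma0 part.
  have {}ins B : B \in Bs -> inside n m B by move=> /ins[].
  split; last first.
    rewrite geq_max => /andP[/asym[ha hb _] /hM]; rewrite ge_max => /andP[L1 LK].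
    rewrite (size_coreset_list CBP).
    exact: (partition_size_log n0 m0 k0 e0 e1 hDelta ap erefl erefl part ha hb L1 LK).
  split.
    move=> p /flattenP[_ /mapP[B hB ->]]; have [x [u [_ u0 _ ->]]] := CBP B hB.
    case/mapP=> l _ -> /=; have iB := ins B hB.
    have : tnth (corners B) l \in [:: (B.1.1, B.2.1); (B.1.1, B.2.2); (B.1.2, B.2.1); (B.1.2, B.2.2)].
      exact: mem_tnth.
    by rewrite !inE => /or4P[] /eqP ->; split=> //=; move: iB; rewrite /inside; lia.
  move=> s1 c inp1 seg code hI hR.
  have [out1 [t1 [r [vE ht]]]] := fitting_loss_wp ins CBP code hI hR.
  exists out1, t1; split=> //; rewrite vE.
  exact: (estimate_sum n0 m0 k0 e0 e1 hDelta ap erefl erefl part).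
- move=> inp sig inp_e.
  (* The error parameter stored after the entries leaves [signal_input] true, so the guarantee for
     [A] applies to this very input. *)
  have [t [alpha [beta [s [out ap asym]]]]] := hA _ _ _ _ _ n0 m0 k0 sig.
  have gamma0 := gamma_gt0 k0 e0 hDelta ap erefl.
  have sigma0 := sigma_ge0 ap erefl.
  have [mem [r mem0 mem1 mems]] := out; case: mem r mem0 mem1 mems => f g r mem0 mem1 mems.
  have [st [t' [r' [Bs [CB [C [part CBP CE [stI stR] ht]]]]]]] : wp inp coreset_tail (Memory f g)
      (fun out t => exists Bs CB C, [/\
        Defs.partition D ((eps / Delta) ^+ 2 / (beta * k%:R)) (loss D (full_rect n m) s / alpha) Bs,
        forall B, B \in Bs -> block_coreset D B (CB B), C = flatten [seq CB B | B <- Bs],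
        icell out 0 = size C /\ holds 0 (rcell out) 0 (points_data C) &
        (t <= n * m * coreset_cost)%N]).
    apply: (coreset_tail_wp f n0 m0 sig inp_e mem0 mem1 mems erefl erefl gamma0 sigma0).
    move=> out1 Bs CB t1 part CBP C h1 h2 h3.
    by exists Bs, CB, C; split.
  exists (t + t').+1, C; split.
  + split=> //; exists st; split=> //; exact: exec_Seq r r'.
  + by exists inp, t, alpha, beta, s; split=> //; exists Bs, CB.
  rewrite geq_max => /andP[/asym[_ _ ht'] _].
  have h1 : (n * m * coreset_cost <= k * (n * m) * coreset_cost)%N.
    by rewrite leq_mul2r leq_pmull // orbT.
  have h2 : (0 < k * (n * m))%N by rewrite !muln_gt0 k0 n0.
  have -> : ((ct + coreset_cost + 1) * (k * (n * m)) = ct * (k * (n * m))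
    + k * (n * m) * coreset_cost + k * (n * m))%N by rewrite (mulnDl _ 1%N) (mulnDl ct) mul1n (mulnC coreset_cost).
  lia.
Qed.
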